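(* Assume that $(u_h,p_h)\in V_h^0\times Q_h^0$ is the solution of the weak Galerkin scheme (WG) of the context, and that $2\le r<\infty$ if $n=2$, $2\le r\le6$ if $n=3$. Given $u_h^0\in V_h^0$, let $(u_h^l,p_h^l)\in V_h^0\times Q_h^0$, $l=1,2,\dots$, be defined by Oseen's iteration $$a_h(u_h^l,v_h)+b_h(v_h,p_h^l)+c_h(u_h^{l-1};u_h^l,v_h)+d_h(u_h^{l-1};u_h^l,v_h)=(f,v_{hi}),\qquad b_h(u_h^l,q_h)=0,$$ for all $(v_h,q_h)\in V_h^0\times Q_h^0$. Under the condition $$2C_{\widetilde r}^{\,r}C_r\,\alpha\,\frac{\|f\|_{*,h}^{r-2}}{\nu^{r-1}}+\frac{\mathcal N_h\|f\|_{*,h}}{\nu^2}<1,$$ the iteration converges in the sense that $$\lim_{l\to\infty}|||u_h^l-u_h|||_V=0,\qquad\lim_{l\to\infty}|||p_h^l-p_h|||_Q=0.$$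
   Context: $\Omega\subset\mathbb R^n$ ($n\in\{2,3\}$) is a bounded Lipschitz polygonal/polyhedral domain; $\nu>0$, $\alpha>0$, $r\ge2$ are real numbers and $f\in[L^2(\Omega)]^n$. $L^2_0(\Omega)=\{q\in L^2(\Omega):\int_\Omega q=0\}$. Mesh and notation. $\mathcal T_h$ is a shape regular partition of $\Omega$ into closed simplexes, $\mathcal E_h$ is the set of all edges (faces) of its elements, $h_K$ is the diameter of $K\in\mathcal T_h$, and $n$ also denotes the outward unit normal on $\partial K$. $(\cdot,\cdot)_D$ is the $L^2(D)$ inner product, $(\cdot,\cdot)=(\cdot,\cdot)_\Omega$, $\|\cdot\|_0$ the $L^2(\Omega)$ norm, $\|\cdot\|_{0,r}$ the $L^r(\Omega)$ norm, $\langle\cdot,\cdot\rangle_{\partial\mathcal T_h}=\sum_{K\in\mathcal T_h}\langle\cdot,\cdot\rangle_{\partial K}$ with $\langle\cdot,\cdot\rangle_{\partial K}$ the $L^2(\partial K)$ inner product, $\|\cdot\|_{0,\partial\mathcal T_h}=(\sum_K\|\cdot\|_{0,\partial K}^2)^{1/2}$. $P_j(D)$ denotes polynomials of degree at most $j$ on $D$. $(u\otimes v)_{ij}=u_iv_j$. Integers $m\ge1$ and $k\in\{m-1,m\}$ are fixed; $\eta|_{\partial K}=h_K^{-1}$; $\Pi_k^B$ is the (componentwise) $L^2$-projection onto $P_k(e)$ on each $e\in\mathcal E_h$. Discrete weak operators. For an integer $\gamma\ge0$ and $v=\{v_i,v_b\}$ ($v_i$ on element interiors, $v_b$ on element boundaries),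 $\nabla_{w,\gamma}v|_K\in[P_\gamma(K)]^n$ is defined by $(\nabla_{w,\gamma}v,\varsigma)_K=-(v_i,\nabla\cdot\varsigma)_K+\langle v_b,\varsigma\cdot n\rangle_{\partial K}$ for all $\varsigma\in[P_\gamma(K)]^n$; for vector-valued $v$ it is applied componentwise. For vector-valued $w=\{w_i,w_b\}$, $\nabla_{w,\gamma}\cdot w|_K\in P_\gamma(K)$ is defined by $(\nabla_{w,\gamma}\cdot w,\varsigma)_K=-(w_i,\nabla\varsigma)_K+\langle w_b\cdot n,\varsigma\rangle_{\partial K}$ for all $\varsigma\in P_\gamma(K)$; for tensors it is applied row by row. Discrete spaces. $V_h^0$ is the set of $v_h=\{v_{hi},v_{hb}\}$ with $v_{hi}|_K\in[P_m(K)]^n$ for all $K\in\mathcal T_h$, $v_{hb}|_e\in[P_k(e)]^n$ for all $e\in\mathcal E_h$, and $v_{hb}|_{\partial\Omega}=0$. $Q_h^0$ is the set of $q_h=\{q_{hi},q_{hb}\}$ with $q_{hi}|_K\in P_{m-1}(K)$, $q_{hb}|_e\in P_m(e)$, and $q_{hi}\in L^2_0(\Omega)$. Forms. $a_h(u_h,v_h)=\nu(\nabla_{w,m-1}u_h,\nabla_{w,m-1}v_h)+\nu\langle\eta(\Pi_k^Bu_{hi}-u_{hb}),\Pi_k^Bv_{hi}-v_{hb}\rangle_{\partial\mathcal T_h}$, $b_h(v_h,q_h)=(\nabla_{w,m}q_h,v_{hi})$, $c_h(\kappa_h;u_h,v_h)=\alpha(|\kappa_{hi}|^{r-2}u_{hi},v_{hi})$,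 $d_h(\kappa_h;u_h,v_h)=\tfrac12(\nabla_{w,m}\cdot\{u_{hi}\otimes\kappa_{hi},u_{hb}\otimes\kappa_{hb}\},v_{hi})-\tfrac12(\nabla_{w,m}\cdot\{v_{hi}\otimes\kappa_{hi},v_{hb}\otimes\kappa_{hb}\},u_{hi})$. Scheme (WG): find $(u_h,p_h)\in V_h^0\times Q_h^0$ such that $a_h(u_h,v_h)+b_h(v_h,p_h)+c_h(u_h;u_h,v_h)+d_h(u_h;u_h,v_h)=(f,v_{hi})$ for all $v_h\in V_h^0$, and $b_h(u_h,q_h)=0$ for all $q_h\in Q_h^0$. Norms and constants. $|||v_h|||_V^2=\|\nabla_{w,m-1}v_h\|_0^2+\|\eta^{1/2}(\Pi_k^Bv_{hi}-v_{hb})\|_{0,\partial\mathcal T_h}^2$, $|||q_h|||_Q^2=\|q_{hi}\|_0^2+\sum_{K}h_K^2\|\nabla_{w,m}q_h\|_{0,K}^2$, $V_{0h}=\{\kappa_h\in V_h^0: b_h(\kappa_h,q_h)=0\ \forall q_h\in Q_h^0\}$, $$\mathcal N_h=\sup_{0\ne\kappa_h,u_h,v_h\in V_{0h}}\frac{d_h(\kappa_h;u_h,v_h)}{|||\kappa_h|||_V\,|||u_h|||_V\,|||v_h|||_V},\qquad \|f\|_{*,h}=\sup_{0\ne v_h\in V_{0h}}\frac{(f,v_{hi})}{|||v_h|||_V}.$$ $C_{\widetilde r}>0$ is a constant (independent of $h$) such that $\|v_{hi}\|_{0,r}\le C_{\widetilde r}|||v_h|||_V$ for all $v_h\in V_h^0$;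 such a constant exists for $2\le r<\infty$ if $n=2$ and $2\le r\le6$ if $n=3$. $C_r>0$ is a constant depending only on $r$ such that, for all $\lambda,\mu\in\mathbb R^n$ (whenever the powers are defined), $\big||\lambda|^{r-2}-|\mu|^{r-2}\big|\le C_r(|\lambda|^{r-3}+|\mu|^{r-3})|\lambda-\mu|$, $\big||\lambda|^{r-2}\lambda-|\mu|^{r-2}\mu\big|\le C_r(|\lambda|+|\mu|)^{r-2}|\lambda-\mu|$, and $\big||\lambda|^{r-2}-|\mu|^{r-2}-(r-2)|\mu|^{r-4}\mu\cdot(\lambda-\mu)\big|\le C_r(|\lambda|^{r-4}+|\mu|^{r-4})|\lambda-\mu|^2$. *)

(* Defs.v *)
From HB Require Import structures.
From mathcomp Require Import all_boot all_order all_algebra.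
From mathcomp Require Import all_classical all_reals all_analysis.
(* Only the canonical instances of multinomials are imported: its notations
   clash with those of MathComp-Analysis. *)
From mathcomp Require mpoly.
Import (canonicals, coercions) mpoly.

Set Implicit Arguments.
Unset Strict Implicit.
Unset Printing Implicit Defensive.

Import Order.TTheory GRing.Theory Num.Theory.
Import numFieldNormedType.Exports.

Local Open Scope classical_set_scope.
Local Open Scope ring_scope.

Section rV_measurable.
Context {R : realType} (n : nat).

Let coord (i : 'I_n) (x : 'rV[R]_n) : measurableTypeR R := x 0 i.

Let rV_set0 : g_sigma_preimage coord set0.
Proof. exact: sigma_algebra0. Qed.

Let rV_setC A : g_sigma_preimage coord A -> g_sigma_preimage coord (~` A).
Proof. exact: sigma_algebraC. Qed.

Let rV_bigcup (F : _^nat) : (forall i, g_sigma_preimage coord (F i)) ->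
  g_sigma_preimage coord (\bigcup_i F i).
Proof. exact: sigma_algebra_bigcup. Qed.

(* The sigma-algebra generated by the coordinates, i.e. the Borel one, as the
   library does for n-tuples. *)
HB.instance Definition _ := @isMeasurable.Build default_measure_display
  'rV[R]_n (g_sigma_preimage coord) rV_set0 rV_setC rV_bigcup.

End rV_measurable.

Section lebesgue_rV.
Context {R : realType}.

Definition rV_snoc n (p : 'rV[R]_n * R) : 'rV[R]_n.+1 :=
  \row_i oapp (p.1 0) p.2 (unlift ord_max i).

Lemma measurable_coord n (i : 'I_n) :
  measurable_fun setT (fun x : 'rV[R]_n => x 0 i).
Proof.
move=> _ Y mY; rewrite setTI; apply: sub_sigma_algebra => /=.
rewrite -bigcup_seq/=; exists i => /=; first by rewrite mem_index_enum.
by exists Y => //; rewrite setTI.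
Qed.

Lemma measurable_rV_snoc n :
  measurable_fun setT (@rV_snoc n : _ * measurableTypeR R -> _).
Proof.
apply: (@measurability _ _ _ _ _ _ (\big[setU/set0]_(i < n.+1)
  preimage_set_system setT
    (fun x : 'rV[R]_n.+1 => x 0 i : measurableTypeR R) measurable)) => //.
move=> _ [A + <-]; rewrite -bigcup_seq /= => -[i _ [Y mY <-]].
rewrite !setTI -[X in measurable X]setTI.
have : measurable_fun setT (fun p : 'rV[R]_n * measurableTypeR R =>
    rV_snoc p 0 i : measurableTypeR R).
  rewrite /rV_snoc; under eq_fun do rewrite mxE.
  case: unliftP => [j|] _ /=; last exact: measurable_snd.
  exact: (measurableT_comp (@measurable_coord n j)).
by move=> /(_ measurableT _ mY).
Qed.

Definition lebesgue_snoc n (mu : {measure set 'rV[R]_n -> \bar R}) :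
    {measure set 'rV[R]_n.+1 -> \bar R} :=
  measure_function_pushforward__canonical__measure_function_Measure
    [the measure _ _ of (mu \x (@lebesgue_measure R))%E]
    (@measurable_rV_snoc n).

(* n-fold product of the one-dimensional Lebesgue measure. *)
Fixpoint lebesgue n : {measure set 'rV[R]_n -> \bar R} :=
  if n is n'.+1 then lebesgue_snoc (lebesgue n') else dirac (0 : 'rV[R]_0).

End lebesgue_rV.

Section euclidean.
Context {R : realType} {n : nat}.
Implicit Types (x y : 'rV[R]_n) (Omega : set 'rV[R]_n).

Definition dotv x y : R := \sum_i x 0 i * y 0 i.

(* The library norm of 'rV[R]_n is the sup norm. *)
Definition enorm x : R := Num.sqrt (dotv x x).

Definition diam (A : set 'rV[R]_n) : R :=
  sup [set d | exists x y, [/\ A x, A y & d = enorm (x - y)]].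

Definition indiam (A : set 'rV[R]_n) : R :=
  sup [set d | exists c rho, [/\ 0 <= rho,
    [set x | enorm (x - c) <= rho] `<=` A & d = 2 * rho]].

Definition boundary Omega : set 'rV[R]_n := closure Omega `\` interior Omega.

(* Convex hull of the vertices pos v, v in S. *)
Definition hull (V : finType) (pos : V -> 'rV[R]_n) (S : {set V}) :
    set 'rV[R]_n :=
  [set x | exists t : V -> R, [/\ (forall v, v \in S -> 0 <= t v),
    \sum_(v in S) t v = 1 & x = \sum_(v in S) t v *: pos v]].

Definition affinely_independent (V : finType) (pos : V -> 'rV[R]_n)
    (S : {set V}) : Prop :=
  forall t : V -> R, \sum_(v in S) t v = 0 ->
    \sum_(v in S) t v *: pos v = 0 -> forall v, v \in S -> t v = 0.

(* S spans a nondegenerate closed n-simplex. *)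
Definition nsimplex (V : finType) (pos : V -> 'rV[R]_n) (S : {set V}) : Prop :=
  #|S| = n.+1 /\ affinely_independent pos S.

(* Near each boundary point, Omega is, for some unit direction d, the set
   strictly above the graph of a Lipschitz function over the hyperplane
   orthogonal to d. *)
Definition lipschitz_boundary Omega : Prop :=
  forall x, boundary Omega x ->
    exists (e L : R) (d : 'rV[R]_n) (phi : 'rV[R]_n -> R),
    [/\ 0 < e, enorm d = 1,
        (forall y z, `|phi y - phi z| <= L * enorm (y - z)) &
        forall y, enorm (y - x) < e ->
          (Omega y <-> phi (y - dotv y d *: d) < dotv y d)].

Definition polyhedral Omega : Prop :=
  exists (V : finType) (pos : V -> 'rV[R]_n) (T : {set {set V}}),
    (forall K, K \in T -> nsimplex pos K) /\
    closure Omega = \bigcup_(K in [set` T]) hull pos K.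

Definition lipschitz_polyhedral_domain Omega : Prop :=
  [/\ Omega !=set0, open Omega, connected Omega & bounded_set Omega] /\
  lipschitz_boundary Omega /\ polyhedral Omega.

Definition L2_vector Omega (f : 'rV[R]_n -> 'rV[R]_n) : Prop :=
  forall i, measurable_fun Omega (fun x => f x 0 i) /\
    (lebesgue n).-integrable Omega (fun x => ((f x 0 i) ^+ 2)%:E).

End euclidean.

Section polynomials.
Context {R : realType} {n : nat}.

Definition peval (p : mpoly.mpoly n R) (x : 'rV[R]_n) : R :=
  mpoly.meval (fun i => x 0 i) p.

(* msize is 1 + the total degree. *)
Definition deg_le (j : nat) (p : mpoly.mpoly n R) : Prop :=
  (mpoly.msize p <= j.+1)%N.

(* P_j(D): only the values on D matter. *)
Definition Pol (j : nat) (D : set 'rV[R]_n) (g : 'rV[R]_n -> R) : Prop :=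
  exists2 p, deg_le j p & forall x, D x -> g x = peval p x.

Definition pgrad (p : mpoly.mpoly n R) (x : 'rV[R]_n) : 'rV[R]_n :=
  \row_i peval (mpoly.mderiv i p) x.

Definition pvec (s : 'I_n -> mpoly.mpoly n R) (x : 'rV[R]_n) : 'rV[R]_n :=
  \row_i peval (s i) x.

Definition pdiv (s : 'I_n -> mpoly.mpoly n R) (x : 'rV[R]_n) : R :=
  \sum_i peval (mpoly.mderiv i (s i)) x.

End polynomials.

(* An element is the set of its n+1 vertices. *)
Record mesh (R : realType) (n : nat) := Mesh {
  vtx : finType;
  pos : vtx -> 'rV[R]_n;
  elts : {set {set vtx}} }.

Section mesh_geometry.
Context {R : realType} {n : nat} (M : mesh R n).
Implicit Types (K e : {set vtx M}) (v : vtx M).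

Definition cell K : set 'rV[R]_n := hull (@pos R n M) K.

(* The face of K opposite to v is K :\ v. *)
Definition faces : {set {set vtx M}} := [set K :\ v | K in elts M, v in K].

(* No hanging nodes: two cells meet in a common face, possibly empty. *)
Definition conforming_partition (Omega : set 'rV[R]_n) : Prop :=
  [/\ (forall K, K \in elts M -> nsimplex (@pos R n M) K),
      closure Omega = \bigcup_(K in [set` elts M]) cell K &
      forall K K', K \in elts M -> K' \in elts M ->
        cell K `&` cell K' = cell (K :&: K')].

(* Meant for one sigma common to a whole family of meshes. *)
Definition shape_regular (sigma : R) : Prop :=
  forall K, K \in elts M -> diam (cell K) <= sigma * indiam (cell K).

Definition int_cell K (g : 'rV[R]_n -> R) : R :=
  \int[lebesgue n]_(x in cell K) g x.

Definition ref_simplex (d : nat) : set 'rV[R]_d :=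
  [set t | (forall i, 0 <= t 0 i) /\ \sum_i t 0 i <= 1].

Definition face_pt e (i : nat) : 'rV[R]_n :=
  nth 0 [seq @pos R n M v | v <- enum e] i.

Definition face_dir e : 'M[R]_(n.-1, n) :=
  \matrix_(i, j) (face_pt e i.+1 - face_pt e 0) 0 j.

(* Integral for the surface measure of the flat (n-1)-simplex with vertices
   a_0, ..., a_(n-1), through the parametrisation t |-> a_0 + t *m E with
   rows a_i - a_0 in E, whose area element is sqrt (det (E E^T)). *)
Definition int_face e (g : 'rV[R]_n -> R) : R :=
  Num.sqrt (\det (face_dir e *m (face_dir e)^T)) *
  \int[lebesgue n.-1]_(t in @ref_simplex n.-1)
    g (face_pt e 0 + t *m face_dir e).

(* Outward unit normal of K on the face opposite to v. *)
Definition normal K v : 'rV[R]_n :=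
  xget 0 [set d | [/\ enorm d = 1,
    (forall w w', w \in K :\ v -> w' \in K :\ v ->
       dotv d (pos w - pos w') = 0) &
    forall w, w \in K :\ v -> dotv d (pos v - pos w) < 0]].

End mesh_geometry.

(* {v_i, v_b}: v_i is indexed by the elements and v_b by the faces, so that
   v_b is single-valued on each face but has no constraint at the points that
   several faces share. *)
Definition wfun (R : realType) (n : nat) (M : mesh R n) (W : Type) : Type :=
  (({set vtx M} -> 'rV[R]_n -> W) * ({set vtx M} -> 'rV[R]_n -> W))%type.

Section weak.
Context {R : realType} {n : nat} {M : mesh R n}.
Local Notation pt := 'rV[R]_n.
Local Notation scalar := (wfun M R).
Local Notation vector := (wfun M 'rV[R]_n).
Implicit Types (K e : {set vtx M}) (j m k : nat).

Definition wfun_sub (W : zmodType) (u v : wfun M W) : wfun M W :=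
  (fun K x => u.1 K x - v.1 K x, fun e x => u.2 e x - v.2 e x).

Definition wcomp (u : vector) (i : 'I_n) : scalar :=
  (fun K x => u.1 K x 0 i, fun e x => u.2 e x 0 i).

(* Row i of {u_i (x) w_i, u_b (x) w_b}. *)
Definition wtensor (u w : vector) (i : 'I_n) : vector :=
  (fun K x => u.1 K x 0 i *: w.1 K x, fun e x => u.2 e x 0 i *: w.2 e x).

(* In the next three definitions the defining conditions determine the values
   of the function on the cell (face). *)
Definition wgrad j (q : scalar) K : pt -> pt :=
  xget (cst 0) [set g : pt -> pt |
    (forall i, Pol j (cell K) (fun x => g x 0 i)) /\
    forall s : 'I_n -> mpoly.mpoly n R, (forall i, deg_le j (s i)) ->
      int_cell K (fun x => dotv (g x) (pvec s x)) =
      - int_cell K (fun x => q.1 K x * pdiv s x) +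
      \sum_(v in K) int_face (K :\ v)
        (fun x => q.2 (K :\ v) x * dotv (pvec s x) (normal K v))].

Definition wdiv j (w : vector) K : pt -> R :=
  xget (cst 0) [set g : pt -> R |
    Pol j (cell K) g /\
    forall s : mpoly.mpoly n R, deg_le j s ->
      int_cell K (fun x => g x * peval s x) =
      - int_cell K (fun x => dotv (w.1 K x) (pgrad s x)) +
      \sum_(v in K) int_face (K :\ v)
        (fun x => dotv (w.2 (K :\ v) x) (normal K v) * peval s x)].

Definition face_proj k e (g : pt -> R) : pt -> R :=
  xget (cst 0) [set p : pt -> R |
    Pol k (cell e) p /\
    forall s : mpoly.mpoly n R, deg_le k s ->
      int_face e (fun x => p x * peval s x) =
      int_face e (fun x => g x * peval s x)].

(* Pi_k^B v_i - v_b on the face of K opposite to v. *)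
Definition jump k (u : vector) K (v : vtx M) (x : pt) : pt :=
  \row_i (face_proj k (K :\ v) (fun y => u.1 K y 0 i) x - u.2 (K :\ v) x 0 i).

Definition Vh (Omega : set pt) m k (v : vector) : Prop :=
  [/\ (forall K, K \in elts M ->
         forall i, Pol m (cell K) (fun x => v.1 K x 0 i)),
      (forall e, e \in faces M ->
         forall i, Pol k (cell e) (fun x => v.2 e x 0 i)) &
      forall e, e \in faces M -> cell e `<=` boundary Omega ->
         forall x, cell e x -> v.2 e x = 0].

Definition Qh m (q : scalar) : Prop :=
  [/\ (forall K, K \in elts M -> Pol m.-1 (cell K) (q.1 K)),
      (forall e, e \in faces M -> Pol m (cell e) (q.2 e)) &
      \sum_(K in elts M) int_cell K (q.1 K) = 0].

Definition wnonzero (v : vector) : Prop :=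
  (exists K x, [/\ K \in elts M, cell K x & v.1 K x != 0]) \/
  (exists e x, [/\ e \in faces M, cell e x & v.2 e x != 0]).

(* (f, v_i): f is only relevant in Omega, while cells are closed. *)
Definition load (Omega : set pt) (f : pt -> pt) (v : vector) : R :=
  \sum_(K in elts M)
    \int[lebesgue n]_(x in cell K `&` Omega) dotv (f x) (v.1 K x).

Definition grad_form m (u v : vector) : R :=
  \sum_(K in elts M) int_cell K (fun x =>
    \sum_i dotv (wgrad m.-1 (wcomp u i) K x) (wgrad m.-1 (wcomp v i) K x)).

Definition jump_form k (u v : vector) : R :=
  \sum_(K in elts M) \sum_(w in K) int_face (K :\ w)
    (fun x => (diam (cell K))^-1 * dotv (jump k u K w x) (jump k v K w x)).

Definition ah (nu : R) m k (u v : vector) : R :=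
  nu * grad_form m u v + nu * jump_form k u v.

Definition bh m (v : vector) (q : scalar) : R :=
  \sum_(K in elts M) int_cell K (fun x => dotv (wgrad m q K x) (v.1 K x)).

Definition ch (alpha r : R) (w u v : vector) : R :=
  alpha * \sum_(K in elts M) int_cell K (fun x =>
    enorm (w.1 K x) `^ (r - 2) * dotv (u.1 K x) (v.1 K x)).

Definition conv_form m (w u v : vector) : R :=
  \sum_(K in elts M) int_cell K (fun x =>
    \sum_i wdiv m (wtensor u w i) K x * v.1 K x 0 i).

Definition dh m (w u v : vector) : R :=
  2^-1 * conv_form m w u v - 2^-1 * conv_form m w v u.

Definition normV m k (v : vector) : R :=
  Num.sqrt (grad_form m v v + jump_form k v v).

Definition normQ m (q : scalar) : R :=
  Num.sqrt (\sum_(K in elts M) int_cell K (fun x => (q.1 K x) ^+ 2) +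
    \sum_(K in elts M) (diam (cell K)) ^+ 2 *
      int_cell K (fun x => dotv (wgrad m q K x) (wgrad m q K x))).

Definition Lr_norm (r : R) (v : vector) : R :=
  (\sum_(K in elts M) int_cell K (fun x => enorm (v.1 K x) `^ r)) `^ r^-1.

Definition V0h (Omega : set pt) m k (v : vector) : Prop :=
  Vh Omega m k v /\ forall q, Qh m q -> bh m v q = 0.

End weak.

Arguments load {R n} M Omega f v.

(* As usual, a supremum over the empty set (V_0h = 0) is 0, which is also the
   convention of sup. *)
Definition Nh (R : realType) (n : nat) (M : mesh R n) (Omega : set 'rV[R]_n)
    (m k : nat) : R :=
  sup [set t | exists w u v : wfun M 'rV[R]_n,
    [/\ V0h Omega m k w /\ wnonzero w, V0h Omega m k u /\ wnonzero u,
        V0h Omega m k v /\ wnonzero v &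
        t = dh m w u v / (normV m k w * normV m k u * normV m k v)]].

Definition load_norm (R : realType) (n : nat) (M : mesh R n)
    (Omega : set 'rV[R]_n) (m k : nat) (f : 'rV[R]_n -> 'rV[R]_n) : R :=
  sup [set t | exists v : wfun M 'rV[R]_n,
    [/\ V0h Omega m k v, wnonzero v & t = load M Omega f v / normV m k v]].

(* (u, p) solves the WG problem linearised at w; with w = u it is the scheme
   itself. *)
Definition solves_linearised (R : realType) (n : nat) (M : mesh R n)
    (Omega : set 'rV[R]_n) (m k : nat) (nu alpha r : R)
    (f : 'rV[R]_n -> 'rV[R]_n) (w u : wfun M 'rV[R]_n) (p : wfun M R) : Prop :=
  [/\ Vh Omega m k u, Qh m p,
      (forall v, Vh Omega m k v ->
         ah nu m k u v + bh m v p + ch alpha r w u v + dh m w u v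
         = load M Omega f v) &
      forall q, Qh m q -> bh m u q = 0].

(* The inequalities defining C_r. A power with a negative exponent is defined
   for nonzero vectors only; 0 `^ 0 = 1. *)
Definition power_constant (R : realType) (n : nat) (r C : R) : Prop :=
  forall x y : 'rV[R]_n,
  [/\ (3 <= r \/ (x != 0 /\ y != 0)) ->
        `|enorm x `^ (r - 2) - enorm y `^ (r - 2)|
        <= C * (enorm x `^ (r - 3) + enorm y `^ (r - 3)) * enorm (x - y),
      enorm (enorm x `^ (r - 2) *: x - enorm y `^ (r - 2) *: y)
        <= C * (enorm x + enorm y) `^ (r - 2) * enorm (x - y) &
      (4 <= r \/ (x != 0 /\ y != 0)) ->
        `|enorm x `^ (r - 2) - enorm y `^ (r - 2)
          - (r - 2) * enorm y `^ (r - 4) * dotv y (x - y)|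
        <= C * (enorm x `^ (r - 4) + enorm y `^ (r - 4)) * enorm (x - y) ^+ 2].

(* Main.v *)
Require Import Defs.
From HB Require Import structures.
From mathcomp Require Import all_boot all_order all_algebra.
From mathcomp Require Import all_classical all_reals all_analysis.
From mathcomp Require Import measurable_realfun.
From mathcomp Require mpoly.
Import (canonicals, coercions) mpoly.
From mathcomp Require Import ring lra.

(* The weak Galerkin forms are linear in the values of their arguments on the
   cells and faces, so on the finite dimensional space V_h they are bounded
   with respect to |||.|||_V, and |||v|||_V = 0 forces v = 0 by the discrete
   embedding. Testing with the solutions gives |||u_h|||, |||u_h^l||| <=
   ||f||_* / nu. Testing the difference of the two schemes with the error e^l
   and applying Hoelder's inequality to the reaction term gives
   |||e^(l+1)||| <= theta |||e^l|||, where theta is the left-hand side of the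
   smallness condition. The pressure error is recovered by testing with
   v = {grad_w q, 0}: a q in Q_h^0 with vanishing weak gradient is constant on
   each cell, hence constant since the mesh is connected through faces, hence
   zero by its mean. *)

Set Implicit Arguments.
Unset Strict Implicit.
Unset Printing Implicit Defensive.
Import Order.TTheory GRing.Theory Num.Theory.
Import numFieldNormedType.Exports.
Local Open Scope classical_set_scope.
Local Open Scope ring_scope.

(** * Semidefinite forms *)

Section semidefinite_forms.
Context {R : realType} {W : lmodType R}.
Implicit Types (S : W -> Prop) (L : W -> R) (B : W -> W -> R).

(** A [wfun] is defined on all of space while only its values on cells and faces matter, so the
    discrete spaces are not literally finite dimensional and the energy is only semidefinite on
    them. Boundedness is therefore proved for semidefinite forms of finite rank: finitely many
    moments determine the form up to its kernel, Gram-Schmidt modulo the kernel gives a finite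
    expansion, and every bilinear or trilinear form that ignores the kernel is bounded. The
    resulting constants may depend on the mesh, which is fixed along the iteration; this replaces
    inverse, trace and inf-sup estimates. The factor 2 C_r comes from the two powers with exponent r
    - 3 in the inequality defining C_r when r >= 3. For r < 3 these powers are singular, and an
    elementary inequality with constant 1 <= 2 C_r takes its place. The kernel of the weak gradient
    is found with test fields along an edge, weighted by barycentric coordinates so as to see the
    interior or a single face. The divergence theorem is needed for such fields only; after an
    affine change of variables it is the fundamental theorem of calculus in one variable. *)

Definition subspace S := S 0 /\ forall a x y, S x -> S y -> S (a *: x + y).

Definition linear_on S L :=
  forall a x y, S x -> S y -> L (a *: x + y) = a * L x + L y.

Definition psd_on S B :=
  [/\ forall x y, S x -> S y -> B x y = B y x,
      forall z, S z -> linear_on S (B^~ z) &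
      forall x, S x -> 0 <= B x x].

(** Finite dimension of S modulo the kernel of B, expressed by finitely many functionals whose
    common kernel is null for B; no basis of S has to be exhibited. *)
Definition finite_rank S B := exists N (l : nat -> W -> R),
  (forall i, linear_on S (l i)) /\
  forall x, S x -> (forall i, (i < N)%N -> l i x = 0) -> B x x = 0.

Lemma subspaceZ S a x : subspace S -> S x -> S (a *: x).
Proof. by move=> [S0 SL] Sx; rewrite -[_ *: _]addr0; exact: SL. Qed.

Lemma subspaceD S x y : subspace S -> S x -> S y -> S (x + y).
Proof. by move=> [S0 SL] Sx Sy; rewrite -[x]scale1r; exact: SL. Qed.

Lemma subspaceB S x y : subspace S -> S x -> S y -> S (x - y).
Proof. by move=> [S0 SL] Sx Sy; rewrite addrC -scaleN1r; exact: SL. Qed.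

Lemma linear_on0 S L : subspace S -> linear_on S L -> L 0 = 0.
Proof.
move=> [S0 _] lL; have := lL 1 0 0 S0 S0.
by rewrite scaler0 addr0 mul1r -{1}[L 0]addr0 => /addrI.
Qed.

Lemma linear_onZ S L a x : subspace S -> linear_on S L -> S x ->
  L (a *: x) = a * L x.
Proof.
by move=> sS lL Sx; rewrite -[_ *: _]addr0 lL// ?(linear_on0 sS)// ?addr0//; case: sS.
Qed.

Lemma linear_onD S L x y : linear_on S L -> S x -> S y ->
  L (x + y) = L x + L y.
Proof. by move=> lL Sx Sy; rewrite -[x in LHS]scale1r lL// mul1r. Qed.

Lemma linear_onB S L x y : linear_on S L -> S x -> S y ->
  L (x - y) = L x - L y.
Proof. by move=> lL Sx Sy; rewrite addrC -scaleN1r lL// mulN1r addrC. Qed.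

Lemma psd_cs S B x y : subspace S -> psd_on S B -> S x -> S y ->
  B x y ^+ 2 <= B x x * B y y.
Proof.
move=> sS [Bs Bl Bp] Sx Sy.
have SZ a z : S z -> S (a *: z) by exact: subspaceZ.
have q t : 0 <= B x x * t ^+ 2 + 2 * B x y * t + B y y.
  have Sz : S (t *: x + y) by case: sS => _; apply.
  have := Bp _ Sz.
  rewrite (Bl _ Sz)// (Bs x)// (Bs y)// !(Bl _ Sx, Bl _ Sy)// (Bs y x)//.
  by move=> h; apply: (le_trans h); rewrite le_eqVlt; apply/orP; left; apply/eqP; ring.
have [B0|B0] := eqVneq (B x x) 0.
  suff -> : B x y = 0 by rewrite expr0n B0 mul0r.
  apply: contrapT => /eqP n0.
  (* With B x x = 0 the quadratic is affine in t, and this t gives it the value -1. *)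
  have := q (- (B y y + 1) / (2 * B x y)).
  rewrite B0 mul0r add0r mulrC mulfVK; last by rewrite mulf_neq0.
  by move=> ?; lra.
have := q (- B x y / B x x).
have -> : B x x * (- B x y / B x x) ^+ 2 + 2 * B x y * (- B x y / B x x) + B y y
   = (B x x * B y y - B x y ^+ 2) / B x x by field.
by rewrite pmulr_lge0 ?subr_ge0// invr_gt0 lt_neqAle eq_sym B0 Bp.
Qed.

Lemma psd_null S B x y : subspace S -> psd_on S B -> S x -> S y ->
  B x x = 0 -> B x y = 0.
Proof.
move=> sS pB Sx Sy B0; have := psd_cs sS pB Sx Sy.
by rewrite B0 mul0r => h; apply/eqP; rewrite -sqrf_eq0 eq_le h sqr_ge0.
Qed.


Definition fourier B (f : seq W) x := \sum_(g <- f) B x g *: g.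

(** That the expansion fixes every member of f stands in for orthonormality and avoids indexing
    pairs; the second clause is completeness up to null vectors. *)
Definition orthobasis S B (f : seq W) :=
  (forall g, g \in f -> S g /\ fourier B f g = g) /\
  forall x, S x -> B (x - fourier B f x) (x - fourier B f x) = 0.

Lemma subspace_fourier S B f x : subspace S -> (forall g, g \in f -> S g) ->
  S (fourier B f x).
Proof.
move=> sS Sf; rewrite /fourier big_seq; elim/big_ind: _ => [|y z|g gf].
- by case: sS.
- exact: subspaceD.
- by apply: subspaceZ => //; exact: Sf.
Qed.

Lemma linear_on_fourier S L B f x : subspace S -> linear_on S L ->
  (forall g, g \in f -> S g) ->
  L (fourier B f x) = \sum_(g <- f) B x g * L g.
Proof.
move=> sS lL Sf; rewrite /fourier.
elim: f Sf => [|g f IH] Sf; first by rewrite !big_nil (linear_on0 sS).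
have Sg : S g by apply: Sf; rewrite mem_head.
have Sf' h : h \in f -> S h by move=> hf; apply: Sf; rewrite in_cons hf orbT.
rewrite !big_cons lL// ?IH//.
exact: (subspace_fourier B x sS Sf').
Qed.

(** Induction on the number of functionals: a family f for the kernel of the last one is either
    complete for S, or one Gram-Schmidt step on a vector that f misses adds the single direction
    transversal to that kernel. *)
Lemma orthobasis_exists S B : subspace S -> psd_on S B -> finite_rank S B ->
  exists f, orthobasis S B f.
Proof.
move=> sS pB [N [l [lin sep]]].
elim: N S sS pB lin sep => [|N IH] S sS pB lin sep.
  exists [::]; split => // x Sx.
  by rewrite /fourier big_nil subr0; apply: sep.
pose S' x := S x /\ l N x = 0.
have S'S x : S' x -> S x by case.
have sS' : subspace S'.
  split; first by split; [case: sS|exact: linear_on0 (lin N)].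
  move=> a x y [Sx x0] [Sy y0]; split; first by case: sS => _; exact.
  by rewrite lin// x0 y0 mulr0 addr0.
have pB' : psd_on S' B.
  case: pB => Bs Bl Bp; split.
  - by move=> x y /S'S Sx /S'S Sy; exact: Bs.
  - by move=> z /S'S Sz a x y /S'S Sx /S'S Sy; exact: Bl.
  - by move=> x /S'S; exact: Bp.
have lin' i : linear_on S' (l i).
  by move=> a x y /S'S Sx /S'S Sy; exact: lin.
have sep' x : S' x -> (forall i, (i < N)%N -> l i x = 0) -> B x x = 0.
  move=> [Sx x0] h; apply: sep => // i; rewrite ltnS leq_eqVlt.
  by case/predU1P => [->//|]; exact: h.
have [f [ff fP]] := IH S' sS' pB' lin' sep'.
have Sf g : g \in f -> S g by move=> /ff[/S'S].
pose P x := x - fourier B f x.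
have SP x : S x -> S (P x).
  by move=> Sx; apply: subspaceB => //; exact: subspace_fourier.
have [Bs Bl Bp] := pB.
have [allnull|] := pselect (forall x, S x -> B (P x) (P x) = 0).
  by exists f; split=> // g gf; split; [exact: Sf|case: (ff g gf)].
move=> /existsNP [x0 /not_implyP [Sx0 /eqP nx0]].
have Porth g : g \in f -> B (P x0) g = 0.
  move=> gf; have Sg := Sf _ gf.
  rewrite /P (linear_onB (Bl _ Sg))//; last exact: subspace_fourier.
  rewrite (linear_on_fourier _ _ sS (Bl _ Sg))//.
  rewrite (Bs x0)// -{1}[g](proj2 (ff g gf)).
  rewrite (linear_on_fourier _ _ sS (Bl _ Sx0))// !big_seq.
  apply/eqP; rewrite subr_eq0; apply/eqP; apply: eq_bigr => h hf.
  by rewrite (Bs x0)// ?(Bs h)//; [rewrite mulrC|exact: Sf..].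
pose c := Num.sqrt (B (P x0) (P x0)).
have c2 : c ^+ 2 = B (P x0) (P x0) by rewrite sqr_sqrtr// Bp//; exact: SP.
have c0 : c != 0 by rewrite -sqrf_eq0 c2.
pose f0 := c^-1 *: P x0.
have Sf0 : S f0 by apply: subspaceZ => //; exact: SP.
have f0f g : g \in f -> B f0 g = 0.
  by move=> gf; rewrite (linear_onZ _ sS (Bl _ (Sf _ gf))) ?Porth ?mulr0//; exact: SP.
have f0f0 : B f0 f0 = 1.
  rewrite {1}/f0 (linear_onZ _ sS (Bl _ Sf0)); last exact: SP.
  rewrite Bs//; last exact: SP.
  rewrite (linear_onZ _ sS (Bl _ (SP _ Sx0))); last exact: SP.
  by rewrite -c2; field.
have ff0 : fourier B f f0 = 0.
  rewrite /fourier big_seq; apply: big1 => g gf; by rewrite f0f// scale0r.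
have fcons x : fourier B (f0 :: f) x = B x f0 *: f0 + fourier B f x.
  by rewrite /fourier big_cons.
(* Otherwise [f0] would lie in [S'], where f is complete; being orthogonal to f, it would be
   null. *)
have lf0 : l N f0 != 0.
  apply/eqP => l0; have := fP f0 (conj Sf0 l0).
  by rewrite ff0 subr0 f0f0 => /eqP; rewrite oner_eq0.
exists (f0 :: f); split => [g|x Sx].
  rewrite in_cons => /predU1P [->|gf]; first by rewrite fcons f0f0 ff0 addr0 scale1r.
  split; first exact: Sf.
  by rewrite fcons Bs// ?f0f// ?scale0r ?add0r; [case: (ff g gf)|exact: Sf].
(* The coefficient a moves x into the kernel of [l N], where the induction hypothesis applies. *)
pose a := l N x / l N f0; pose x' := x - a *: f0.
have Sx' : S x' by apply: subspaceB => //; exact: subspaceZ.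
have S'x' : S' x'.
  split=> //; rewrite (linear_onB (lin N) Sx (subspaceZ a sS Sf0)).
  by rewrite (linear_onZ a sS (lin N) Sf0) divfK// subrr.
have z0 := fP x' S'x'.
set z := x' - fourier B f x' in z0.
have Sz : S z by exact: SP.
have Sfx' : S (fourier B f x') by exact: subspace_fourier.
have Bx'f0 : B x' f0 = 0.
  have -> : x' = z + fourier B f x' by rewrite subrK.
  rewrite (linear_onD (Bl _ Sf0))// (psd_null sS pB Sz Sf0)// add0r.
  rewrite (linear_on_fourier _ _ sS (Bl _ Sf0))// big_seq; apply: big1 => g gf.
  by rewrite (Bs g)// ?f0f ?mulr0//; exact: Sf.
have -> : x - fourier B (f0 :: f) x = z; last by [].
have xE : x = a *: f0 + x' by rewrite addrC subrK.
have -> : fourier B (f0 :: f) x = a *: f0 + fourier B f x'.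
  rewrite fcons {1}xE (Bl _ Sf0)// f0f0 Bx'f0 mulr1 addr0; congr (_ + _).
  rewrite /fourier [LHS]big_seq [RHS]big_seq; apply: eq_bigr => g gf.
  by rewrite xE (Bl _ (Sf _ gf))// f0f// mulr0 add0r.
by rewrite /z {1}xE opprD addrACA subrr add0r.
Qed.

Lemma null_expansion S B f L x : subspace S -> orthobasis S B f ->
  linear_on S L -> (forall z, S z -> B z z = 0 -> L z = 0) -> S x ->
  L x = \sum_(g <- f) B x g * L g.
Proof.
move=> sS [ff fP] lL L0 Sx.
have Sf g : g \in f -> S g by move=> /ff[].
have Sfx : S (fourier B f x) by exact: subspace_fourier.
rewrite -(linear_on_fourier _ _ sS lL)//; apply/eqP.
rewrite -subr_eq0 -(linear_onB lL)//; apply/eqP; apply: L0; last exact: fP.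
exact: subspaceB.
Qed.

Lemma psd_cs_sqrt S B x y : subspace S -> psd_on S B -> S x -> S y ->
  `|B x y| <= Num.sqrt (B x x) * Num.sqrt (B y y).
Proof.
move=> sS pB Sx Sy; have [_ _ Bp] := pB; rewrite -sqrtrM ?Bp//.
by rewrite -sqrtr_sqr; apply: ler_wsqrtr; exact: psd_cs sS pB Sx Sy.
Qed.

(* The constant is explicit so that it can be made uniform in parameters on
   which L depends. *)
Lemma null_linear_bound S B f L x : subspace S -> psd_on S B ->
  orthobasis S B f -> linear_on S L ->
  (forall z, S z -> B z z = 0 -> L z = 0) -> S x ->
  `|L x| <= Num.sqrt (B x x) * \sum_(g <- f) Num.sqrt (B g g) * `|L g|.
Proof.
move=> sS pB bf lL L0 Sx; rewrite (null_expansion sS bf lL L0 Sx).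
apply: (le_trans (ler_norm_sum _ _ _)); rewrite mulr_sumr !big_seq.
apply: ler_sum => g gf; rewrite normrM mulrA ler_wpM2r//.
have [/(_ _ gf)[Sg _] _] := bf.
exact: psd_cs_sqrt sS pB Sx Sg.
Qed.

(** The functional estimate is applied to one variable at a time: the basis does not depend on the
    other variable, so the sums over it give a uniform constant. *)
Lemma bilinear_bound S B (T : W -> W -> R) : subspace S -> psd_on S B ->
  finite_rank S B ->
  (forall y, S y -> linear_on S (T^~ y)) -> (forall x, S x -> linear_on S (T x)) ->
  (forall z y, S z -> S y -> B z z = 0 -> T z y = 0 /\ T y z = 0) ->
  exists2 C, 0 <= C & forall x y, S x -> S y ->
    `|T x y| <= C * Num.sqrt (B x x) * Num.sqrt (B y y).
Proof.
move=> sS pB rB T1 T2 T0; have [f bf] := orthobasis_exists sS pB rB.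
have Sf g : g \in f -> S g by case: bf => + _ => /[apply] -[].
exists (\sum_(g <- f) Num.sqrt (B g g) * \sum_(h <- f) Num.sqrt (B h h) * `|T g h|).
  by apply: sumr_ge0 => g _; rewrite mulr_ge0// sumr_ge0// => h _; rewrite mulr_ge0.
move=> x y Sx Sy.
have T0y z : S z -> B z z = 0 -> T z y = 0 by move=> Sz /(T0 z y Sz Sy)[].
apply: (le_trans (null_linear_bound sS pB bf (T1 y Sy) T0y Sx)).
rewrite [leRHS]mulrAC [leRHS]mulrC; apply: ler_wpM2l => //.
rewrite mulr_suml !big_seq; apply: ler_sum => g gf.
rewrite -mulrA; apply: ler_wpM2l => //; rewrite mulrC.
apply: (null_linear_bound sS pB bf (T2 g (Sf _ gf))) => //.
by move=> z Sz /(T0 z g Sz (Sf _ gf))[].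
Qed.

Lemma trilinear_bound S B (T : W -> W -> W -> R) : subspace S -> psd_on S B ->
  finite_rank S B ->
  (forall y z, S y -> S z -> linear_on S (fun x => T x y z)) ->
  (forall x z, S x -> S z -> linear_on S (fun y => T x y z)) ->
  (forall x y, S x -> S y -> linear_on S (T x y)) ->
  (forall w y z, S w -> S y -> S z -> B w w = 0 ->
     [/\ T w y z = 0, T y w z = 0 & T y z w = 0]) ->
  exists2 C, 0 <= C & forall x y z, S x -> S y -> S z ->
    `|T x y z| <= C * Num.sqrt (B x x) * Num.sqrt (B y y) * Num.sqrt (B z z).
Proof.
move=> sS pB rB T1 T2 T3 T0; have [f bf] := orthobasis_exists sS pB rB.
have Sf g : g \in f -> S g by case: bf => + _ => /[apply] -[].
have bil g : exists C, 0 <= C /\ (S g -> forall y z, S y -> S z ->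
    `|T g y z| <= C * Num.sqrt (B y y) * Num.sqrt (B z z)).
  have [Sg|nSg] := pselect (S g); last by exists 0.
  have [|||C C0 CP] := @bilinear_bound S B (T g) sS pB rB.
  - by move=> z Sz; exact: T2.
  - by move=> y Sy; exact: T3.
  - by move=> z y Sz Sy z0; have [_ -> ->] := T0 z g y Sz Sg Sy z0.
  - by exists C; split.
have [C CP] := choice bil.
exists (\sum_(g <- f) Num.sqrt (B g g) * C g).
  by apply: sumr_ge0 => g _; rewrite mulr_ge0//; case: (CP g).
move=> x y z Sx Sy Sz.
have T0x w : S w -> B w w = 0 -> T w y z = 0 by move=> Sw /(T0 w y z Sw Sy Sz)[].
apply: (le_trans (null_linear_bound sS pB bf (T1 y z Sy Sz) T0x Sx)).
rewrite -[leRHS]mulrA -[leRHS]mulrA [leRHS]mulrCA; apply: ler_wpM2l => //.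
rewrite mulr_suml !big_seq; apply: ler_sum => g gf.
rewrite -mulrA; apply: ler_wpM2l => //.
have [_ /(_ (Sf _ gf) y z Sy Sz) h] := CP g.
by rewrite mulrA.
Qed.

(** The form may be degenerate, so the representer is unique only up to null vectors, and L has to
    vanish on these. Existence of all weak operators and projections rests on this. *)
Lemma riesz S B L : subspace S -> psd_on S B -> finite_rank S B ->
  linear_on S L -> (forall z, S z -> B z z = 0 -> L z = 0) ->
  exists2 g, S g & forall x, S x -> B g x = L x.
Proof.
move=> sS pB rB lL L0; have [f bf] := orthobasis_exists sS pB rB.
have Sf g : g \in f -> S g by case: bf => + _ => /[apply] -[].
have [Bs Bl _] := pB.
pose r := \sum_(g <- f) L g *: g.
have Sr : S r.
  rewrite /r big_seq; elim/big_ind: _ => [|y z|g gf].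
  - by case: sS.
  - exact: subspaceD.
  - by apply: subspaceZ => //; exact: Sf.
exists r => // x Sx; rewrite (null_expansion sS bf lL L0 Sx).
have -> : B r x = \sum_(g <- f) L g * B g x.
  exact: (@linear_on_fourier S _ (fun _ => L) f r sS (Bl x Sx) Sf).
rewrite !big_seq; apply: eq_bigr => g gf.
by rewrite (Bs g x (Sf _ gf) Sx) mulrC.
Qed.

End semidefinite_forms.

(** * Lebesgue measure and affine maps *)

Section row_vector_measure.
Context {R : realType}.

Lemma measurable_row d (T : measurableType d) (D : set T) n (f : T -> 'rV[R]_n) :
  measurable D -> (forall i, measurable_fun D (fun x => f x 0 i)) ->
  measurable_fun D f.
Proof.
move=> mD mf; apply: (@measurability _ _ _ _ _ _ (\big[setU/set0]_(i < n)
  preimage_set_system setT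
    (fun x : 'rV[R]_n => x 0 i : measurableTypeR R) measurable)) => //.
move=> _ [A + <-]; rewrite -bigcup_seq /= => -[i _ [Y mY <-]].
by have := mf i mD Y mY; rewrite setTI.
Qed.

Definition cube n (a : 'rV[R]_n) (rho : R) : set 'rV[R]_n :=
  [set x | forall i, `|x 0 i - a 0 i| <= rho].

Lemma measurable_forall d (T : measurableType d) (I : finType) (P : I -> set T) :
  (forall i, measurable (P i)) -> measurable [set x | forall i, P i x].
Proof.
move=> mP; have -> : [set x | forall i, P i x] = \bigcap_(i in [set: I]) P i.
  by apply/seteqP; split => x h i; [move=> _; exact: h|exact: h].
exact: fin_bigcap_measurable.
Qed.

Lemma measurable_le d (T : measurableType d) (f g : T -> R) :
  measurable_fun setT f -> measurable_fun setT g ->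
  measurable [set x | f x <= g x].
Proof.
move=> mf mg; have := measurable_funB mg mf measurableT (measurable_itv `[0, +oo[).
rewrite setTI; congr (measurable _); apply/seteqP.
by split => x /=; rewrite in_itv/= andbT subr_ge0.
Qed.

Lemma measurable_cube n (a : 'rV[R]_n) rho : measurable (cube a rho).
Proof.
apply: measurable_forall => i; apply: measurable_le => //.
apply: measurableT_comp => //.
by apply: measurable_funB => //; exact: measurable_coord.
Qed.

Lemma rV_snoc_lift n (y : 'rV[R]_n) t i : rV_snoc (y, t) 0 (lift ord_max i) = y 0 i.
Proof. by rewrite mxE liftK. Qed.

Lemma rV_snoc_max n (y : 'rV[R]_n) t : rV_snoc (y, t) 0 ord_max = t.
Proof. by rewrite mxE unlift_none. Qed.

Lemma forall_ord_max n (P : 'I_n.+1 -> Prop) :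
  (forall i, P i) <-> (forall i, P (lift ord_max i)) /\ P ord_max.
Proof.
split=> [h|[h1 h2] i]; first by split.
by case: (unliftP ord_max i) => [j ->|->].
Qed.

Lemma lebesgue_cube n (a : 'rV[R]_n) rho : 0 <= rho ->
  lebesgue n (cube a rho) = ((2 * rho) ^+ n)%:E.
Proof.
move=> rho0; elim: n a => [|n IH] a.
  by rewrite expr0 /= /dirac indicE mem_set// => -[].
pose b : 'rV[R]_n := \row_i a 0 (lift ord_max i).
have -> : lebesgue n.+1 (cube a rho) =
    ((lebesgue n \x @lebesgue_measure R)%E
      (cube b rho `*` `[a 0 ord_max - rho, a 0 ord_max + rho])).
  rewrite /= /pushforward; congr (_ _); apply/seteqP; split => -[y t] /=.
    rewrite /cube /= forall_ord_max => -[h1 h2]; split.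
      by move=> i; have := h1 i; rewrite rV_snoc_lift mxE.
    by rewrite rV_snoc_max ler_distl in h2; rewrite in_itv.
  rewrite /cube /= forall_ord_max => -[h1 h2]; split.
    by move=> i; have := h1 i; rewrite rV_snoc_lift mxE.
  by rewrite rV_snoc_max ler_distl; rewrite in_itv/= in h2.
rewrite product_measure1E//; last exact: measurable_cube.
transitivity (((2 * rho) ^+ n)%:E * (2 * rho)%:E)%E; last by rewrite -EFinM exprSr.
rewrite (IH b); congr (_ * _)%E.
apply: (etrans (lebesgue_measure_itv `[a 0 ord_max - rho, a 0 ord_max + rho])).
rewrite /= lte_fin; case: ltP => h; first by rewrite -EFinB; congr EFin; ring.
by congr EFin; lra.
Qed.

Lemma lebesgue_sigma_finite n : sigma_finite [set: 'rV[R]_n] (lebesgue n).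
Proof.
exists (fun k => cube 0 k%:R) => [|k].
  apply/esym/seteqP; split => // x _.
  exists (Num.bound (\sum_i `|x 0 i|)) => // i.
  rewrite mxE subr0; apply: ltW; apply: (@le_lt_trans _ _ (\sum_i `|x 0 i|)).
    by rewrite (bigD1 i)//= lerDl sumr_ge0.
  by apply: archi_boundP; rewrite sumr_ge0.
by split; [exact: measurable_cube|rewrite lebesgue_cube// ltry].
Qed.

(** A constant head for the recursively defined measure, on which the sigma-finite structure
    required by Fubini-Tonelli is declared. *)
Definition leb n : set 'rV[R]_n -> \bar R := lebesgue n.

HB.instance Definition _ n := Measure.on (@leb n).
HB.instance Definition _ n :=
  @Measure_isSigmaFinite.Build _ _ _ (@leb n) (lebesgue_sigma_finite n).

Lemma measurable_snoc n (y : 'rV[R]_n) :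
  measurable_fun setT (fun t => rV_snoc (y, t)).
Proof.
apply: measurable_row => // i; under eq_fun do rewrite mxE /=.
by case: (unlift ord_max i) => [j|]; [exact: measurable_cst|exact: measurable_id].
Qed.

Lemma tonelli_snoc n (F : 'rV[R]_n.+1 -> \bar R) :
  measurable_fun setT F -> (forall x, 0 <= F x)%E ->
  (\int[lebesgue n.+1]_x F x =
   \int[lebesgue n]_y \int[lebesgue_measure]_t F (rV_snoc (y, t)))%E.
Proof.
move=> mF F0.
rewrite /= /lebesgue_snoc /= ge0_integral_pushforward//; last exact: measurable_rV_snoc.
rewrite preimage_setT.
rewrite (@fubini_tonelli1 _ _ _ _ _ (@leb n) lebesgue_measure (F \o @rV_snoc R n))//.
  by apply: measurableT_comp => //; exact: measurable_rV_snoc.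
by move=> x; exact: F0.
Qed.

Lemma tonelli_snoc_sym n (F : 'rV[R]_n.+1 -> \bar R) :
  measurable_fun setT F -> (forall x, 0 <= F x)%E ->
  (\int[lebesgue n.+1]_x F x =
   \int[lebesgue_measure]_t \int[lebesgue n]_y F (rV_snoc (y, t)))%E.
Proof.
move=> mF F0; rewrite tonelli_snoc//.
apply: (@fubini_tonelli _ _ _ _ _ (@leb n) lebesgue_measure (F \o @rV_snoc R n)).
  by apply: measurableT_comp => //; exact: measurable_rV_snoc.
by move=> x; exact: F0.
Qed.

End row_vector_measure.

(** * Linear change of variables for the iterated product measure *)

Section change_of_variables.
Context {R : realType}.

Lemma measurable_mulmx n p (A : 'M[R]_(n, p)) (b : 'rV[R]_p) :
  measurable_fun setT (fun x : 'rV[R]_n => x *m A + b).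
Proof.
apply: measurable_row => // j; under eq_fun do rewrite !mxE.
apply: measurable_funD; last exact: measurable_cst.
apply: measurable_sum => i.
apply: measurable_funM; [exact: measurable_coord|exact: measurable_cst].
Qed.

(** The image of Lebesgue measure under the affine map, multiplied by |c|, has the right value on
    half-open intervals and hence is Lebesgue measure by uniqueness. *)
Lemma integral_affine1 (c b : R) (F : R -> \bar R) : c != 0 ->
  measurable_fun setT F -> (forall x, 0 <= F x)%E ->
  (`|c|%:E * \int[lebesgue_measure]_t F (c * t + b)%R =
   \int[lebesgue_measure]_t F t)%E.
Proof.
move=> c0 mF F0.
pose phi t := c * t + b : measurableTypeR R.
have mphi : measurable_fun setT (phi : measurableTypeR R -> _).
  apply: measurable_funD; last exact: measurable_cst.
  by apply: measurable_funM; [exact: measurable_cst|exact: measurable_id].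
have nn : 0 <= `|c| by [].
pose nu := measure_function_pushforward__canonical__measure_function_Measure
    (@lebesgue_measure R) mphi.
pose mu := mscale (NngNum nn) nu.
have mu_itv X : ocitv X -> lebesgue_measure X = mu X.
  move=> [[x y] /= _ <-].
  transitivity (if x < y then (y - x)%:E else 0%E).
    apply: (etrans (lebesgue_measure_itv `]x, y])) => /=.
    by rewrite lte_fin -EFinB.
  rewrite /mu /mscale /= /pushforward.
  have [cp|cn|c00] := ltgtP 0 c; last by rewrite -c00 eqxx in c0.
    have -> : phi @^-1` `]x, y] = `](x - b) / c, (y - b) / c]%classic.
      apply/seteqP; split => t /=; rewrite !in_itv /= /phi
       ltr_pdivrMr// ler_pdivlMr//; lra.
    rewrite (lebesgue_measure_itv `](x - b) / c, (y - b) / c]) /= lte_fin.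
    rewrite ltr_pM2r ?invr_gt0// ltrD2r gtr0_norm//; case: ltP => h; last by rewrite mule0.
    by rewrite -!EFinB -EFinM; congr EFin; field.
  (* A negative factor exchanges the open and the closed end, which leaves the length unchanged. *)
  have -> : phi @^-1` `]x, y] = `[(y - b) / c, (x - b) / c[%classic.
    apply/seteqP; split => t /=; rewrite !in_itv /= /phi
       ltr_ndivlMr// ler_ndivrMr//; lra.
  rewrite (lebesgue_measure_itv `[(y - b) / c, (x - b) / c[) /= lte_fin.
  rewrite ltr_nM2r ?invr_lt0// ltrD2r ltr0_norm//; case: ltP => h; last by rewrite mule0.
  by rewrite -!EFinB -EFinM; congr EFin; field.
transitivity (\int[mu]_t F t)%E; last first.
  apply: (eq_measure_integral lebesgue_measure) => A mA _.
  by apply/esym; exact: (@lebesgue_measure_unique R mu).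
rewrite /mu ge0_integral_mscale//=; congr (_ * _)%E.
by rewrite ge0_integral_pushforward// preimage_setT.
Qed.

Lemma rV_snoc_inv n (x : 'rV[R]_n.+1) :
  x = rV_snoc (\row_i x 0 (lift ord_max i), x 0 ord_max).
Proof.
by apply/rowP => i; rewrite mxE; case: unliftP => [j ->|->] //=; rewrite mxE.
Qed.

Lemma rV_snocD n (y z : 'rV[R]_n) t u :
  rV_snoc (y, t) + rV_snoc (z, u) = rV_snoc (y + z, t + u).
Proof. by apply/rowP => i; rewrite !mxE; case: unlift => [j|] //=; rewrite mxE. Qed.

Lemma integral_translate n (c : 'rV[R]_n) (F : 'rV[R]_n -> \bar R) :
  measurable_fun setT F -> (forall x, 0 <= F x)%E ->
  (\int[lebesgue n]_x F (x + c)%R = \int[lebesgue n]_x F x)%E.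
Proof.
elim: n c F => [|n IH] c F mF F0.
  by apply: eq_integral => x _; congr F; apply/rowP => -[].
have mt n' (c' : 'rV[R]_n') : measurable_fun setT (fun x : 'rV[R]_n' => x + c').
  by have := measurable_mulmx 1%:M c'; under eq_fun do rewrite mulmx1.
rewrite (rV_snoc_inv c); set c1 := \row_i _; set c2 := c 0 _.
rewrite tonelli_snoc//; last exact: (measurableT_comp mF (mt _ _)).
rewrite tonelli_snoc//.
rewrite -[RHS](IH c1) => [||y]; last 2 first.
- apply: (measurable_fun_fubini_tonelli_F (m2 := lebesgue_measure) (F \o @rV_snoc R n)).
    by apply: measurableT_comp => //; exact: measurable_rV_snoc.
  by move=> x; exact: F0.
- by apply: integral_ge0.
apply: eq_integral => y _.
under eq_integral do rewrite rV_snocD.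
rewrite -[RHS](@integral_affine1 1 c2 (fun t => F (rV_snoc (y + c1, t))))//; last first.
  by apply: measurableT_comp => //; exact: measurable_snoc.
by rewrite normr1 mul1e; apply: eq_integral => t _; rewrite mul1r.
Qed.

(** The bordered matrix with rows (P q) and (s d). The border sits at [ord_max], the coordinate
    appended by [rV_snoc], so that the matrix acts separately on slices and on the last variable. *)
Definition blk n (P : 'M[R]_n) (q : 'cV[R]_n) (s : 'rV[R]_n) (d : R) : 'M[R]_n.+1 :=
  \matrix_(i, j) match unlift ord_max i, unlift ord_max j with
    | Some i', Some j' => P i' j' | Some i', None => q i' 0
    | None, Some j' => s 0 j' | None, None => d end.

Lemma big_ord_max n (F : 'I_n.+1 -> R) :
  \sum_i F i = \sum_(i < n) F (lift ord_max i) + F ord_max.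
Proof.
rewrite big_ord_recr /=; congr (_ + _); apply: eq_bigr => i _; congr F.
by apply: val_inj; rewrite /= /bump leqNgt ltn_ord.
Qed.

Lemma snoc_blk n (P : 'M[R]_n) q s d y t :
  rV_snoc (y, t) *m blk P q s d =
  rV_snoc (y *m P + t *: s, (y *m q) 0 0 + t * d).
Proof.
apply/rowP => j; rewrite mxE big_ord_max rV_snoc_max.
case: (unliftP ord_max j) => [j' ->|->]; rewrite ?rV_snoc_lift ?rV_snoc_max !mxE.
  rewrite unlift_none liftK; congr (_ + _); apply: eq_bigr => i _.
  by rewrite !mxE !liftK.
rewrite unlift_none; congr (_ + _); apply: eq_bigr => i _.
by rewrite !mxE !liftK unlift_none.
Qed.

Lemma blk_inv n (A : 'M[R]_n.+1) :
  A = blk (\matrix_(i, j) A (lift ord_max i) (lift ord_max j))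
          (\col_i A (lift ord_max i) ord_max)
          (\row_j A ord_max (lift ord_max j)) (A ord_max ord_max).
Proof.
apply/matrixP => i j; rewrite mxE.
by case: (unliftP ord_max i) => [i' ->|->]; case: (unliftP ord_max j) => [j' ->|->];
  rewrite ?mxE.
Qed.

Lemma row_mulmx_inj m n (A B : 'M[R]_(m, n)) :
  (forall x : 'rV[R]_m, x *m A = x *m B) -> A = B.
Proof. by move=> h; apply/row_matrixP => i; rewrite !rowE. Qed.

Lemma mul_blk n (P P' : 'M[R]_n) q q' s s' d d' :
  blk P q s d *m blk P' q' s' d' =
  blk (P *m P' + q *m s') (P *m q' + d' *: q) (s *m P' + d *: s')
      ((s *m q') 0 0 + d * d').
Proof.
apply: row_mulmx_inj => x; rewrite (rV_snoc_inv x) mulmxA !snoc_blk.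
set y := \row_i _; set t := x 0 _.
have yq : y *m q = ((y *m q) 0 0)%:M by rewrite -mx11_scalar.
congr rV_snoc; congr (_, _).
  rewrite !mulmxDl !mulmxDr !mulmxA -scalemxAl scalerDr scalerDl scalerA yq mul_scalar_mx.
  by rewrite [_%:M _ _]mxE eqxx mulr1n addrACA.
have addmE (M N : 'M[R]_1) : (M + N) 0 0 = M 0 0 + N 0 0 by rewrite mxE.
have scmE a (M : 'M[R]_1) : (a *: M) 0 0 = a * M 0 0 by rewrite mxE.
rewrite mulmxDl mulmxDr !mulmxA -scalemxAl !addmE scmE -scalemxAr scmE; ring.
Qed.

Lemma det_blk_up n (P : 'M[R]_n) q d : \det (blk P q 0 d) = \det P * d.
Proof.
rewrite (expand_det_row _ ord_max) big_ord_max big1 ?add0r => [|i _]; last first.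
  by rewrite mxE unlift_none liftK mxE mul0r.
rewrite mxE unlift_none /cofactor -signr_odd oddD addbb mul1r mulrC; congr (_ * _).
by congr (\det _); apply/matrixP => i j; rewrite !mxE !liftK.
Qed.

Lemma det_blk_low n (P : 'M[R]_n) s d : \det (blk P 0 s d) = \det P * d.
Proof.
rewrite -det_tr -[\det P]det_tr -(det_blk_up _ s^T); congr (\det _).
apply/matrixP => i j; rewrite !mxE.
by case: (unlift ord_max i) => [i'|]; case: (unlift ord_max j) => [j'|]; rewrite ?mxE.
Qed.

(** Restricted to nonnegative measurable F: Tonelli then needs no integrability, and the property is
    multiplicative in A. *)
Definition covar n (A : 'M[R]_n) := forall F : 'rV[R]_n -> \bar R,
  measurable_fun setT F -> (forall x, 0 <= F x)%E ->
  (`|\det A|%:E * \int[lebesgue n]_x F (x *m A) = \int[lebesgue n]_x F x)%E.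

Lemma measurable_mulmx0 n p (A : 'M[R]_(n, p)) :
  measurable_fun setT (fun x : 'rV[R]_n => x *m A).
Proof. by have := measurable_mulmx A 0; under eq_fun do rewrite addr0. Qed.

Lemma covar_mul n (A B : 'M[R]_n) : covar A -> covar B -> covar (A *m B).
Proof.
move=> cA cB F mF F0; rewrite det_mulmx normrM mulrC EFinM -muleA.
under eq_integral do rewrite mulmxA.
rewrite (cA (fun x => F (x *m B)))//; first exact: cB.
by apply: measurableT_comp => //; exact: measurable_mulmx0.
Qed.

Lemma covar_blk1 n (B : 'M[R]_n) : covar B -> covar (blk B 0 0 1).
Proof.
move=> cB F mF F0; rewrite det_blk_up mulr1.
have mG := measurableT_comp mF (measurable_mulmx0 (blk B 0 0 1)).
rewrite tonelli_snoc_sym//.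
rewrite tonelli_snoc_sym// -ge0_integralZl//=; last 2 first.
- apply: (measurable_fun_fubini_tonelli_G (m1 := @leb R n)
    ((fun x => F (x *m blk B 0 0 1)) \o @rV_snoc R n)).
    exact: (measurableT_comp mG (@measurable_rV_snoc R n)).
  by move=> x; exact: F0.
- by move=> t _; apply: integral_ge0.
apply: eq_integral => t _.
under eq_integral do rewrite snoc_blk scaler0 addr0 mulmx0 mxE add0r mulr1.
rewrite (cB (fun y => F (rV_snoc (y, t))))//.
apply: measurableT_comp => //.
apply: (measurableT_comp (@measurable_rV_snoc R n)).
exact: measurable_pair2.
Qed.

(** For fixed y the last variable undergoes the affine map t to c t + y b of the line. *)
Lemma covar_blk2 n (b : 'cV[R]_n) c : c != 0 -> covar (blk 1%:M b 0 c).
Proof.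
move=> c0 F mF F0; rewrite det_blk_up det1 mul1r.
have mG := measurableT_comp mF (measurable_mulmx0 (blk 1%:M b 0 c)).
rewrite tonelli_snoc//.
rewrite tonelli_snoc// -ge0_integralZl//=; last 2 first.
- apply: (measurable_fun_fubini_tonelli_F (m2 := lebesgue_measure)
    ((fun x => F (x *m blk 1%:M b 0 c)) \o @rV_snoc R n)).
    exact: (measurableT_comp mG (@measurable_rV_snoc R n)).
  by move=> x; exact: F0.
- by move=> t _; apply: integral_ge0.
apply: eq_integral => y _.
rewrite -[RHS](@integral_affine1 c ((y *m b) 0 0) (fun t => F (rV_snoc (y, t))))//.
  congr (_ * _)%E; apply: eq_integral => t _.
  by rewrite snoc_blk mulmx1 scaler0 addr0 addrC (mulrC c).
by apply: measurableT_comp => //; exact: measurable_snoc.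
Qed.

(** A shear: the slice at height t is translated by t w. *)
Lemma covar_blk3 n (w : 'rV[R]_n) : covar (blk 1%:M 0 w 1).
Proof.
move=> F mF F0; rewrite det_blk_low det1 mul1r normr1 mul1e.
rewrite tonelli_snoc_sym//; last first.
  by apply: measurableT_comp => //; exact: measurable_mulmx0.
rewrite tonelli_snoc_sym//; apply: eq_integral => t _.
under eq_integral do rewrite snoc_blk mulmx1 mulmx0 mxE add0r mulr1.
rewrite (@integral_translate n (t *: w) (fun y => F (rV_snoc (y, t))))//.
apply: measurableT_comp => //.
apply: (measurableT_comp (@measurable_rV_snoc R n)).
exact: measurable_pair2.
Qed.

Lemma unitmx_row_inj n (M : 'M[R]_n) :
  (forall x : 'rV[R]_n, x *m M = 0 -> x = 0) -> M \in unitmx.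
Proof.
move=> h; rewrite -row_free_unit -kermx_eq0.
by apply/rowV0P => x /sub_kermxP; exact: h.
Qed.

(* r is the last row of the inverse; it spans the left kernel of the first n
   columns of the matrix. *)
Lemma blk_unit_perturb n (P : 'M[R]_n) q s d : blk P q s d \in unitmx ->
  exists b : 'cV[R]_n, P + b *m s \in unitmx.
Proof.
set A := blk P q s d => uA.
pose r := row ord_max (invmx A).
have rA : r *m A = rV_snoc (0, 1).
  rewrite -row_mul mulVmx//; apply/rowP => i; rewrite !mxE.
  by case: unliftP => [j ->|->]; rewrite /= ?mxE ?eqxx// eq_sym -(inj_eq val_inj)
    /= /bump leqNgt ltn_ord /= add0n ltn_eqF.
pose k := \row_i r 0 (lift ord_max i); pose kappa := r 0 ord_max.
have rE : r = rV_snoc (k, kappa) by exact: rV_snoc_inv.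
(* If x annihilates P + b s, then x extended by x b is a multiple tau of r, whose entries are k and
   kappa; comparing last entries gives tau (k b - kappa) = 0, so this choice of b forces x = 0. Such
   a b exists because r is not zero. *)
have [b bP] : exists b : 'cV[R]_n, (k *m b) 0 0 != kappa.
  have [kap0|kap0] := eqVneq kappa 0; last by exists 0; rewrite mulmx0 mxE eq_sym.
  have [k0|] := eqVneq k 0.
    exfalso; have := rA; rewrite rE k0 kap0 snoc_blk mul0mx scale0r addr0.
    rewrite mul0mx mxE mul0r addr0 => /rowP /(_ ord_max).
    by rewrite !rV_snoc_max => /eqP; rewrite eq_sym oner_eq0.
  move=> /rV0Pn [i ki]; exists (delta_mx i 0); rewrite kap0.
  rewrite mxE (bigD1 i)//= big1 ?addr0 => [|j ji]; last first.
    by rewrite [delta_mx _ _ _ _]mxE (negbTE ji) mulr0.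
  by rewrite [delta_mx _ _ _ _]mxE !eqxx mulr1.
exists b; apply: unitmx_row_inj => x.
rewrite mulmxDr mulmxA => x0.
pose xb := (x *m b) 0 0.
have xbE : x *m b = xb%:M by rewrite -mx11_scalar.
have : rV_snoc (x, xb) *m A = ((x *m q) 0 0 + xb * d) *: (r *m A).
  rewrite rA snoc_blk; apply/rowP => i; rewrite !mxE.
  move: x0; rewrite xbE mul_scalar_mx => ->.
  by case: unlift => [j|] /=; rewrite ?mxE ?mulr0// mulr1.
set tau := (_ + _); rewrite scalemxAl => /(can_inj (mulmxK uA)).
move=> e; have xk : x = tau *: k.
  apply/rowP => i; have /rowP /(_ (lift ord_max i)) := e.
  by rewrite rV_snoc_lift => ->; rewrite !mxE.
have xbk : xb = tau * kappa.
  by have /rowP /(_ ord_max) := e; rewrite rV_snoc_max [RHS]mxE.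
have : tau * ((k *m b) 0 0 - kappa) = 0.
  by rewrite mulrBr -xbk; apply/eqP; rewrite subr_eq0 /xb xk -scalemxAl [X in _ == X]mxE.
move=> /eqP; rewrite mulf_eq0 subr_eq0 (negbTE bP) orbF => /eqP t0.
by rewrite xk t0 scale0r.
Qed.

Let mx0E m p i j : (0 : 'M[R]_(m, p)) i j = 0. Proof. by rewrite mxE. Qed.
Let blkE := (mul0mx, mulmx0, mul1mx, mulmx1, mx0E, scale1r, scaler0, scale0r,
  mul1r, mulr1, mul0r, mulr0, addr0, add0r).

(** Block elimination with an invertible pivot P: a shear, then P on the slices, then an affine map
    of the last variable whose factor [d'] is the Schur complement, nonzero because the matrix is
    invertible. *)
Lemma covar_blk_unit n (P : 'M[R]_n) q s d :
  (forall B : 'M[R]_n, B \in unitmx -> covar B) -> P \in unitmx ->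
  blk P q s d \in unitmx -> covar (blk P q s d).
Proof.
move=> IH uP uA.
pose d' := d - (s *m invmx P *m q) 0 0.
have AE : blk P q s d = blk 1%:M 0 (s *m invmx P) 1 *m
    (blk P 0 0 1 *m blk 1%:M (invmx P *m q) 0 d').
  have e : P *m (invmx P *m q) = q by rewrite mulmxA mulmxV// mul1mx.
  rewrite !mul_blk !blkE e ?blkE mulmxKV//; congr blk.
  by rewrite /d' addrC subrK.
have d'0 : d' != 0.
  move: uA; rewrite AE unitmxE !det_mulmx det_blk_low !det_blk_up !det1 !mul1r mulr1.
  by rewrite unitfE mulf_eq0 negb_or => /andP[].
rewrite AE; apply: covar_mul; first exact: covar_blk3.
apply: covar_mul; last exact: covar_blk2.
by apply: covar_blk1; exact: IH.
Qed.

(** The leading block of an invertible matrix may be singular; a preliminary shear replaces it by P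
    + b s, made invertible by [blk_unit_perturb], and the induction hypothesis applies to that
    block. *)
Lemma covar_unit n (A : 'M[R]_n) : A \in unitmx -> covar A.
Proof.
elim: n A => [|n IH] A uA.
  move=> F mF F0; rewrite det_mx00 normr1 mul1e.
  by apply: eq_integral => x _; congr F; apply/rowP => -[].
move: uA; rewrite [A]blk_inv; set P := \matrix_(i, j) _.
set q := \col_i _; set s := \row_j _; set d := A _ _ => uA.
have [b ub] := blk_unit_perturb uA.
have AE : blk P q s d = blk 1%:M (- b) 0 1 *m (blk 1%:M b 0 1 *m blk P q s d).
  by rewrite mulmxA !mul_blk !blkE subrr !blkE.
rewrite AE; apply: covar_mul; first by apply: covar_blk2; exact: oner_neq0.
have uX : blk 1%:M b 0 1 \in unitmx by rewrite unitmxE det_blk_up det1 mulr1 unitr1.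
have : blk 1%:M b 0 1 *m blk P q s d \in unitmx by rewrite unitmx_mul uX.
rewrite mul_blk mul1mx => uA'.
exact: covar_blk_unit.
Qed.

Theorem integral_affine n (A : 'M[R]_n) (b : 'rV[R]_n) (F : 'rV[R]_n -> \bar R) :
  A \in unitmx -> measurable_fun setT F -> (forall x, 0 <= F x)%E ->
  (`|\det A|%:E * \int[lebesgue n]_x F (x *m A + b)%R =
   \int[lebesgue n]_x F x)%E.
Proof.
move=> uA mF F0.
have mG : measurable_fun setT (fun x : 'rV[R]_n => F (x + b)).
  apply: measurableT_comp => //.
  by have := measurable_mulmx 1%:M b; under eq_fun do rewrite mulmx1.
by rewrite (covar_unit uA mG)// integral_translate.
Qed.

End change_of_variables.

(** * Integration of polynomials on simplexes *)

Section bounded_measurable.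
Context d (T : measurableType d) (R : realType).
Variables (mu : {measure set T -> \bar R}) (D : set T).
Hypotheses (mD : measurable D) (fD : (mu D < +oo)%E).
Implicit Types f g : T -> R.

(** Bounded measurable functions are stable under sums, products, powers and square roots, and
    integrable on sets of finite measure. All integrands of the discrete forms are of this kind, so
    this one class carries the integrability conditions. *)
Definition bmeas f := measurable_fun D f /\ exists B, forall x, D x -> `|f x| <= B.

Lemma bmeas_ext f g : (forall x, D x -> f x = g x) -> bmeas f -> bmeas g.
Proof.
move=> fg [mf [B fB]]; split; last by exists B => x Dx; rewrite -fg// fB.
by apply: eq_measurable_fun mf => x /set_mem; exact: fg.
Qed.

Lemma bmeas_cst c : bmeas (cst c).
Proof. by split; [exact: measurable_cst|exists `|c|]. Qed.

Lemma bmeasD f g : bmeas f -> bmeas g -> bmeas (fun x => f x + g x).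
Proof.
move=> [mf [B fB]] [mg [C gC]]; split; first exact: measurable_funD.
by exists (B + C) => x Dx; rewrite (le_trans (ler_normD _ _))// lerD ?fB ?gC.
Qed.

Lemma bmeasM f g : bmeas f -> bmeas g -> bmeas (fun x => f x * g x).
Proof.
move=> [mf [B fB]] [mg [C gC]]; split; first exact: measurable_funM.
by exists (B * C) => x Dx; rewrite normrM ler_pM ?fB ?gC.
Qed.

Lemma bmeasZ c f : bmeas f -> bmeas (fun x => c * f x).
Proof. by move=> bf; apply: bmeasM => //; exact: bmeas_cst. Qed.

Lemma bmeas_sum (I : Type) (s : seq I) (F : I -> T -> R) :
  (forall i, bmeas (F i)) -> bmeas (fun x => \sum_(i <- s) F i x).
Proof.
move=> bF; elim: s => [|i s IH].
  by apply: bmeas_ext (bmeas_cst 0) => x _; rewrite big_nil.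
by apply: bmeas_ext (bmeasD (bF i) IH) => x _; rewrite big_cons.
Qed.

Lemma bmeas_prod (I : Type) (s : seq I) (F : I -> T -> R) :
  (forall i, bmeas (F i)) -> bmeas (fun x => \prod_(i <- s) F i x).
Proof.
move=> bF; elim: s => [|i s IH].
  by apply: bmeas_ext (bmeas_cst 1) => x _; rewrite big_nil.
by apply: bmeas_ext (bmeasM (bF i) IH) => x _; rewrite big_cons.
Qed.

Lemma bmeas_powR f p : 0 <= p -> bmeas f -> (forall x, D x -> 0 <= f x) ->
  bmeas (fun x => f x `^ p).
Proof.
move=> p0 [mf [B fB]] f0; split.
  exact: (measurableT_comp (measurable_powR p) mf).
exists (B `^ p) => x Dx; rewrite ger0_norm ?powR_ge0//.
have fxB : f x <= B by rewrite (le_trans (ler_norm _))// fB.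
by apply: ge0_ler_powR => //; rewrite nnegrE ?f0// (le_trans _ fxB)// f0.
Qed.

Lemma bmeas_sqrt f : bmeas f -> bmeas (fun x => Num.sqrt (f x)).
Proof.
move=> [mf [B fB]]; split.
  apply: (measurableT_comp _ mf); apply: continuous_measurable_fun.
  exact: sqrt_continuous.
exists (Num.sqrt B) => x Dx; rewrite ger0_norm ?sqrtr_ge0//.
by apply: ler_wsqrtr; rewrite (le_trans (ler_norm _))// fB.
Qed.

Lemma bmeas_integrable f : bmeas f -> mu.-integrable D (EFin \o f).
Proof.
move=> [mf [B fB]]; apply: measurable_bounded_integrable => //.
exists B; split; first exact: num_real.
by move=> C BC x Dx; rewrite /= (le_trans (fB _ Dx))// ltW.
Qed.

Lemma bmeas_int_lin c f g : bmeas f -> bmeas g ->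
  \int[mu]_(x in D) (c * f x + g x) =
  c * \int[mu]_(x in D) f x + \int[mu]_(x in D) g x.
Proof.
move=> bf bg; rewrite RintegralD ?RintegralZl//; apply: bmeas_integrable => //.
exact: bmeasZ.
Qed.

Lemma bmeas_int_le f g : bmeas f -> bmeas g -> (forall x, D x -> f x <= g x) ->
  \int[mu]_(x in D) f x <= \int[mu]_(x in D) g x.
Proof. by move=> bf bg fg; apply: le_Rintegral => //; exact: bmeas_integrable. Qed.

End bounded_measurable.

Section reference_simplex.
Context {R : realType}.

Lemma measurable_ref_simplex d : measurable (@ref_simplex R d).
Proof.
apply: measurableI.
  apply: measurable_forall => i; apply: measurable_le; first exact: measurable_cst.
  exact: measurable_coord.
apply: measurable_le; last exact: measurable_cst.
by apply: measurable_sum => i; exact: measurable_coord.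
Qed.

Lemma ref_simplex_le1 d (t : 'rV[R]_d) i : ref_simplex t -> 0 <= t 0 i <= 1.
Proof.
move=> [t0 t1]; rewrite t0 /=; apply: le_trans t1.
by rewrite (bigD1 i)//= lerDl sumr_ge0.
Qed.

Lemma ref_simplex_finite d : (lebesgue d (@ref_simplex R d) < +oo)%E.
Proof.
apply: (@le_lt_trans _ _ (lebesgue d (cube 0 1))).
  apply: le_measure; rewrite ?inE; [exact: measurable_ref_simplex|exact: measurable_cube|].
  move=> t Tt i; rewrite mxE subr0.
  by have /andP[t0 t1] := ref_simplex_le1 i Tt; rewrite ger0_norm.
by rewrite lebesgue_cube// ltry.
Qed.

Lemma cube_in_ref_simplex d (t0 : 'rV[R]_d) delta : ref_simplex t0 -> 0 < delta ->
  exists c rho, [/\ 0 < rho, cube c rho `<=` @ref_simplex R d &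
    forall x, cube c rho x -> forall i, `|x 0 i - t0 0 i| < delta].
Proof.
move=> [t00 t01] d0.
pose s := Num.min 2^-1 (delta / 4).
have s0 : 0 < s by rewrite lt_min; apply/andP; split; [lra|rewrite divr_gt0].
have s1 : s <= 2^-1 by rewrite ge_min lexx.
have s2 : s * 4 <= delta by rewrite -ler_pdivlMr// ge_min lexx orbT.
pose a : R := d.+1%:R^-1.
have a0 : 0 < a by rewrite invr_gt0.
have a1 : d%:R * a + a = 1.
  by rewrite -[X in _ + X]mul1r -mulrDl natr1 /a divff// pnatr_eq0.
have ale1 : a <= 1 by rewrite invf_le1// ler1n.
(* The centre is moved from t0 by the fraction s towards the barycentre, all of whose coordinates
   are a = 1 / (d + 1). The radius s a^2 fits because a^2 <= a and d a^2 <= a. *)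
exists (\row_i (t0 0 i + s * (a - t0 0 i))), (s * a ^+ 2).
have sa2 : 0 < s * a ^+ 2 by rewrite mulr_gt0// exprn_gt0.
have a2a : a ^+ 2 <= a by rewrite expr2 ger_pMr.
split => // x Cx.
  have xl i : t0 0 i * (1 - s) + s * (a - a ^+ 2) <= x 0 i.
    have := Cx i; rewrite mxE ler_distl => /andP[h _]; apply: le_trans h; lra.
  have xu i : x 0 i <= t0 0 i * (1 - s) + s * (a + a ^+ 2).
    have := Cx i; rewrite mxE ler_distl => /andP[_ h]; apply: (le_trans h); lra.
  split=> [i|].
    apply: le_trans (xl i); rewrite addr_ge0// mulr_ge0//; [lra|exact: ltW|].
    by rewrite subr_ge0.
  apply: (@le_trans _ _ (\sum_i (t0 0 i * (1 - s) + s * (a + a ^+ 2)))).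
    by apply: ler_sum => i _.
  rewrite big_split/= -mulr_suml sumr_const card_ord -[_ *+ d]mulr_natl.
  have : d%:R * a ^+ 2 <= a.
    by rewrite expr2 mulrA ger_pMl// -[leRHS]a1 lerDl ltW.
  move: t01; set S := \sum_i _; move: (d%:R : R) a1 => D0 a1 S1 da.
  have : S * (1 - s) <= 1 * (1 - s) by rewrite ler_wpM2r//; lra.
  have : s * (D0 * a + D0 * a ^+ 2) <= s * 1.
    by rewrite ler_pM2l//; lra.
  by lra.
move=> i; have := Cx i; rewrite mxE.
have /andP[b0 b1] := ref_simplex_le1 i (conj t00 t01).
have c1 : `|a - t0 0 i| <= 1 by rewrite ler_norml; apply/andP; split; lra.
move=> h; have -> : x 0 i - t0 0 i = (x 0 i - (t0 0 i + s * (a - t0 0 i))) +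
   s * (a - t0 0 i) by ring.
apply: (le_lt_trans (ler_normD _ _)).
have : `|s * (a - t0 0 i)| <= s.
  by rewrite normrM gtr0_norm// ger_pMr.
have : s * a ^+ 2 <= s * 1 by rewrite ler_pM2l//; lra.
move: h s0 s2; lra.
Qed.

(** A positive value of G at any point, even on the boundary of the simplex, persists on a cube of
    positive measure that lies in the simplex close to that point. *)
Lemma ref_simplex_definite d (G : 'rV[R]_d -> R) : continuous G ->
  bmeas (@ref_simplex R d) G ->
  (forall t, ref_simplex t -> 0 <= G t) ->
  \int[lebesgue d]_(t in @ref_simplex R d) G t = 0 ->
  forall t, ref_simplex t -> G t = 0.
Proof.
move=> cG bG G0 iG t0 Tt0; apply/eqP/negPn/negP => n0.
have Gt0 : 0 < G t0 by rewrite lt_neqAle eq_sym n0 G0.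
have e0 : G t0 / 2 < G t0 by lra.
have /nbhs_ballP [del /= del0 delP] : \forall x \near t0, G t0 / 2 < G x.
  exact: cvgr_gt (cG t0) _ e0.
have [c [rho [rho0 CT Cd]]] := cube_in_ref_simplex Tt0 del0.
have mT := @measurable_ref_simplex d; have fT := @ref_simplex_finite d.
have bI : bmeas (@ref_simplex R d) (\1_(cube c rho) : _ -> R).
  split; first by apply: measurable_indic; exact: measurable_cube.
  by exists 1 => x _; rewrite indicE; case: (_ \in _); rewrite ?normr1 ?normr0.
have : \int[lebesgue d]_(t in @ref_simplex R d) (G t0 / 2 * \1_(cube c rho) t) <=
       \int[lebesgue d]_(t in @ref_simplex R d) G t.
  apply: bmeas_int_le => //; first exact: bmeasZ.
  move=> x Tx; rewrite indicE; have [/set_mem Cx|_] := boolP (x \in cube c rho).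
    rewrite mulr1; apply: ltW; apply: delP; split => // i j.
    by rewrite /ball/= !ord1 distrC; exact: Cd.
  by rewrite mulr0 G0.
rewrite iG RintegralZl//; last exact: bmeas_integrable.
rewrite /Rintegral integral_indic//; last exact: measurable_cube.
rewrite (setIidl CT) lebesgue_cube/=; last exact: ltW.
have h : 0 < G t0 / 2 * (2 * rho) ^+ d by rewrite mulr_gt0 ?exprn_gt0//; lra.
by rewrite leNgt h.
Qed.

End reference_simplex.

(** * Polynomials in several variables: evaluation, lines, degrees *)

Section polynomial_functions.
Context {R : realType} {n : nat}.
Local Notation mp := (mpoly.mpoly n R).
Implicit Types (p q s : mp) (x d : 'rV[R]_n).

Definition pC (c : R) : mp := mpoly.mpolyC n c.
Definition pX (i : 'I_n) : mp := mpoly.mpolyX R (mpoly.mnm1 i).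

Lemma mpoly_ring_ind (P : mp -> Prop) : (forall c, P (pC c)) ->
  (forall i, P (pX i)) -> (forall p q, P p -> P q -> P (p + q)) ->
  (forall p q, P p -> P q -> P (p * q)) -> forall p, P p.
Proof.
move=> PC PX PD PM; apply: mpoly.mpolyind => [|c m p _ _ Pp].
  by rewrite -mpoly.mpolyC0; exact: PC.
apply: (PD) => //; rewrite -mpoly.mul_mpolyC; apply: (PM); first exact: PC.
rewrite mpoly.mpolyXE_id; elim/big_ind: _ => [|//|i _]; last first.
  elim: (m i) => [|k IH]; last by rewrite exprS; exact: PM (PX i) IH.
  by rewrite expr0 -mpoly.mpolyC1; exact: PC.
by rewrite -mpoly.mpolyC1; exact: PC.
Qed.

Lemma pevalD p q x : peval (p + q) x = peval p x + peval q x.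
Proof. exact: mpoly.mevalD. Qed.
Lemma pevalM p q x : peval (p * q) x = peval p x * peval q x.
Proof. exact: mpoly.mevalM. Qed.
Lemma pevalZ c p x : peval (c *: p) x = c * peval p x.
Proof. exact: mpoly.mevalZ. Qed.
Lemma pevalN p x : peval (- p) x = - peval p x.
Proof. exact: mpoly.mevalN. Qed.
Lemma peval0 x : peval 0 x = 0.
Proof. exact: mpoly.meval0. Qed.
Lemma pevalC c x : peval (pC c) x = c.
Proof. exact: mpoly.mevalC. Qed.
Lemma pevalX i x : peval (pX i) x = x 0 i.
Proof. exact: mpoly.mevalXU. Qed.
Lemma peval_sum (I : Type) (r : seq I) (F : I -> mp) x :
  peval (\sum_(i <- r) F i) x = \sum_(i <- r) peval (F i) x.
Proof. exact: (raddf_sum (mpoly.meval _)). Qed.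

(** Restriction to a line; derivatives in several variables are handled throughout as derivatives of
    such one-variable polynomials. *)
Lemma line_poly p x d : exists q : {poly R}, forall t : R,
  q.[t] = peval p (x + t *: d) /\
  q^`().[t] = \sum_i d 0 i * peval (mpoly.mderiv i p) (x + t *: d).
Proof.
elim/mpoly_ring_ind: p => [c|i|p q [P hP] [Q hQ]|p q [P hP] [Q hQ]].
- exists c%:P => t; rewrite hornerC pevalC derivC horner0; split=> //.
  by rewrite big1// => i _; rewrite mpoly.mderivC peval0 mulr0.
- exists ((x 0 i)%:P + d 0 i *: 'X) => t; rewrite pevalX !hornerE !mxE mulrC; split=> //.
  rewrite derivD derivC add0r derivZ derivX hornerZ hornerC mulr1.
  rewrite (bigD1 i)//= big1 ?addr0 => [|j ji].
    rewrite /pX mpoly.mderivX mpoly.mnm1E eqxx scale1r.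
    have -> : (mpoly.mnm_sub (mpoly.mnm1 i) (mpoly.mnm1 i)) = (mpoly.mnm0 : mpoly.multinom n).
      by apply/mpoly.mnmP => k; rewrite mpoly.mnmBE subnn mpoly.mnm0E.
    by rewrite mpoly.mpolyX0 /peval mpoly.meval1 mulr1.
  by rewrite /pX mpoly.mderivX mpoly.mnm1E eq_sym (negbTE ji) scale0r peval0 mulr0.
- exists (P + Q) => t; have [p1 p2] := hP t; have [q1 q2] := hQ t.
  rewrite derivD !hornerD pevalD p1 q1 p2 q2; split=> //.
  by rewrite -big_split/=; apply: eq_bigr => i _; rewrite mpoly.mderivD pevalD mulrDr.
- exists (P * Q) => t; have [p1 p2] := hP t; have [q1 q2] := hQ t.
  rewrite derivM !hornerE pevalM p1 q1 p2 q2; split=> //.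
  rewrite mulr_suml mulr_sumr -big_split/=; apply: eq_bigr => i _.
  by rewrite mpoly.mderivM pevalD !pevalM; ring.
Qed.

Lemma poly_zero_itv (q : {poly R}) : (forall t, 0 <= t <= 1 -> q.[t] = 0) -> q = 0.
Proof.
move=> h; apply/eqP; apply/negPn/negP => q0.
(* As many distinct roots in the unit interval as q has coefficients, one more than a nonzero q can
   have. *)
pose s := [seq i.+1%:R^-1 : R | i <- iota 0 (size q)].
have := max_poly_roots q0 (rs := s).
rewrite size_map size_iota ltnn.
suff [-> ->] : all (root q) s /\ uniq s by move=> /(_ isT isT).
split.
  apply/allP => _ /mapP[i _ ->]; rewrite /root h// invr_ge0 ler0n/=.
  by rewrite invf_le1// ?ler1n// ltr0n.
rewrite map_inj_uniq ?iota_uniq// => i j /invr_inj /eqP.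
by rewrite eqr_nat => /eqP[].
Qed.

(** In characteristic zero the coefficient of a nonconstant monomial is recovered, up to a positive
    integer factor, from the derivative in a variable that occurs in it. *)
Lemma mderiv_eq0 p c x : (forall i, mpoly.mderiv i p = 0) -> peval p x = c ->
  p = pC c.
Proof.
move=> dp px.
have pE : p = pC (mpoly.mcoeff mpoly.mnm0 p).
  apply/mpoly.mpolyP => m; rewrite mpoly.mcoeffC.
  have [->|m0] := eqVneq m mpoly.mnm0; first by rewrite mulr1.
  rewrite mulr0; have [i mi] : exists i, m i != 0%N.
    apply/existsP; apply: contra_neqT m0; rewrite negb_exists => /forallP m0.
    by apply/mpoly.mnmP => i; rewrite mpoly.mnm0E; apply/eqP; move: (m0 i); rewrite negbK.
  have := mpoly.mcoeff_mderiv i p (mpoly.mnm_sub m (mpoly.mnm1 i)).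
  rewrite dp mpoly.mcoeff0.
  have -> : mpoly.mnm_add (mpoly.mnm_sub m (mpoly.mnm1 i)) (mpoly.mnm1 i) = m.
    apply/mpoly.mnmP => j; rewrite mpoly.mnmDE mpoly.mnmBE mpoly.mnm1E.
    by have [<-|_] := eqVneq i j; rewrite ?subn0 ?addn0// subnK// lt0n.
  by move=> /esym/eqP; rewrite mulrn_eq0 /= => /eqP.
by rewrite pE; congr pC; rewrite -px pE pevalC; rewrite -pE.
Qed.

Lemma deg_leD j p q : deg_le j p -> deg_le j q -> deg_le j (p + q).
Proof.
by rewrite /deg_le => hp hq; apply: (leq_trans (mpoly.msizeD_le _ _)); rewrite geq_max hp.
Qed.

Lemma deg_leZ j c p : deg_le j p -> deg_le j (c *: p).
Proof. by move=> hp; apply: leq_trans hp; exact: mpoly.msizeZ_le. Qed.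

Lemma deg_le0 j : deg_le j (0 : mp).
Proof. by rewrite /deg_le mpoly.msize0. Qed.

Lemma deg_leC j c : deg_le j (pC c).
Proof.
by rewrite /deg_le mpoly.msizeC; case: (c != 0).
Qed.

Lemma deg_leX i : deg_le 1 (pX i).
Proof. by rewrite /deg_le mpoly.msizeX mpoly.mdeg1. Qed.

Lemma deg_leM j k p q : deg_le j p -> deg_le k q -> deg_le (j + k) (p * q).
Proof.
have [->|p0] := eqVneq p 0; first by rewrite mul0r => *; exact: deg_le0.
have [->|q0] := eqVneq q 0; first by rewrite mulr0 => *; exact: deg_le0.
rewrite /deg_le mpoly.msizeM// => hp hq.
by have := leq_add hp hq; rewrite addSn addnS; case: (_ + _)%N.
Qed.

Lemma deg_le_sum j (I : Type) (r : seq I) (F : I -> mp) :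
  (forall i, deg_le j (F i)) -> deg_le j (\sum_(i <- r) F i).
Proof.
by move=> h; elim/big_ind: _ => //; [exact: deg_le0|exact: deg_leD].
Qed.

Lemma deg_le_mderiv j i p : deg_le j.+1 p -> deg_le j (mpoly.mderiv i p).
Proof.
rewrite /deg_le => hp; rewrite mpoly.msizeE; apply/bigmax_leqP_seq => m mp' _.
rewrite ltnS; have : mpoly.mcoeff m (mpoly.mderiv i p) != 0 by rewrite -mpoly.mcoeff_msupp.
rewrite mpoly.mcoeff_mderiv => h.
have : mpoly.mnm_add m (mpoly.mnm1 i) \in mpoly.msupp p.
  by rewrite mpoly.mcoeff_msupp; apply: contra_neq h => ->; rewrite mul0rn.
move=> /mpoly.msize_mdeg_lt /leq_trans /(_ hp).
by rewrite mpoly.mdegD mpoly.mdeg1 addn1 !ltnS.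
Qed.

Lemma subspace_deg_le j : subspace (R := R) (fun p : mp => deg_le j p).
Proof.
split; first exact: deg_le0.
by move=> a p q hp hq; apply: deg_leD => //; exact: deg_leZ.
Qed.

Definition monomials (j : nat) : seq (mpoly.multinom n) :=
  map (@mpoly.bmnm n j.+1) (enum {: mpoly.bmultinom n j.+1}).

Lemma coeff_determine j p : deg_le j p ->
  (forall m, m \in monomials j -> mpoly.mcoeff m p = 0) -> p = 0.
Proof.
move=> hp h; apply/mpoly.mpolyP => m; rewrite mpoly.mcoeff0.
have [mj|mj] := ltnP (mpoly.mdeg m) j.+1; last first.
  by apply: mpoly.memN_msupp_eq0; apply: mpoly.msize_mdeg_ge; exact: leq_trans mj.
apply: h; apply/mapP; exists (mpoly.BMultinom mj) => //.
by rewrite mem_enum.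
Qed.

Lemma finite_rank_deg_le j (B : mp -> mp -> R) : (forall p, p = 0 -> B p p = 0) ->
  finite_rank (fun p : mp => deg_le j p) B.
Proof.
move=> B0; exists (size (monomials j)), (fun i => mpoly.mcoeff (nth mpoly.mnm0 (monomials j) i)).
split=> [i a p q _ _|p hp h]; first by rewrite mpoly.mcoeffD mpoly.mcoeffZ.
apply: B0; apply: (coeff_determine hp) => m /(nthP mpoly.mnm0)[i il <-].
exact: h.
Qed.

End polynomial_functions.

(** * Abstract integration functionals, common to cells and faces *)

Section integration_functionals.
Context {R : realType} {n : nat}.
Local Notation pt := 'rV[R]_n.
Local Notation mp := (mpoly.mpoly n R).

(* N is the class of functions that are integrated, D the domain. *)
Record integration (D : set pt) (N : (pt -> R) -> Prop) (I : (pt -> R) -> R) := {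
  adm_ext : forall f g, (forall x, D x -> f x = g x) -> N f -> N g;
  adm_lin : forall c f g, N f -> N g -> N (fun x => c * f x + g x);
  adm_mul : forall f g, N f -> N g -> N (fun x => f x * g x);
  adm_peval : forall p : mp, N (peval p);
  adm_powR : forall f s, 0 <= s -> N f -> (forall x, D x -> 0 <= f x) ->
    N (fun x => f x `^ s);
  adm_sqrt : forall f, N f -> N (fun x => Num.sqrt (f x));
  adm_bound : forall f, N f -> exists B, forall x, D x -> `|f x| <= B;
  int_ext : forall f g, (forall x, D x -> f x = g x) -> N f -> I f = I g;
  int_lin : forall c f g, N f -> N g -> I (fun x => c * f x + g x) = c * I f + I g;
  int_ge0 : forall f, N f -> (forall x, D x -> 0 <= f x) -> 0 <= I f;
  int_def : forall p : mp, (forall x, D x -> 0 <= peval p x) -> I (peval p) = 0 ->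
    forall x, D x -> peval p x = 0 }.

Lemma continuous_sum_fun (T : topologicalType) (J : Type) (r : seq J) (F : J -> T -> R) :
  (forall j, continuous (F j)) -> continuous (fun x => \sum_(j <- r) F j x).
Proof.
move=> cF; elim: r => [|j r IH] x.
  by under eq_fun do rewrite big_nil; exact: cvg_cst.
by under eq_fun do rewrite big_cons; apply: continuousD; [exact: cF|exact: IH].
Qed.

Lemma continuous_peval (T : topologicalType) (f : T -> pt) (p : mp) :
  (forall i, continuous (fun t => f t 0 i)) -> continuous (fun t => peval p (f t)).
Proof.
move=> cf; elim/(@mpoly_ring_ind R n): p => [c|i|p q hp hq|p q hp hq] t.
- by under eq_fun do rewrite pevalC; exact: cvg_cst.
- by under eq_fun do rewrite pevalX; exact: cf.
- by under eq_fun do rewrite pevalD; exact: (continuousD (hp t) (hq t)).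
- by under eq_fun do rewrite pevalM; exact: (continuousM (hp t) (hq t)).
Qed.

Lemma bmeas_peval d (T : measurableType d) (D : set T) (f : T -> pt) (p : mp) :
  (forall i, bmeas D (fun t => f t 0 i)) -> bmeas D (fun t => peval p (f t)).
Proof.
move=> cf; elim/(@mpoly_ring_ind R n): p => [c|i|p q hp hq|p q hp hq].
- by under eq_fun do rewrite pevalC; exact: bmeas_cst.
- by under eq_fun do rewrite pevalX; exact: cf.
- by under eq_fun do rewrite pevalD; exact: bmeasD.
- by under eq_fun do rewrite pevalM; exact: bmeasM.
Qed.

Definition affine_image d (a : pt) (E : 'M[R]_(d, n)) : set pt :=
  [set a + t *m E | t in @ref_simplex R d].

Lemma bmeas_coord d i : bmeas (@ref_simplex R d) (fun t => t 0 i).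
Proof.
split; first by apply: measurable_funTS; exact: measurable_coord.
by exists 1 => t /(ref_simplex_le1 i) /andP[t0 t1]; rewrite ger0_norm.
Qed.

Lemma bmeas_affine d (a : pt) (E : 'M[R]_(d, n)) j :
  bmeas (@ref_simplex R d) (fun t => (a + t *m E) 0 j).
Proof.
under eq_fun do rewrite !mxE; apply: bmeasD; first exact: bmeas_cst.
by apply: bmeas_sum => i; apply: bmeasM; [exact: bmeas_coord|exact: bmeas_cst].
Qed.

(** All the axioms are pulled back to the reference simplex. The dimension d is independent of n, so
    this serves cells as well as faces. *)
Lemma simplex_integration d (a : pt) (E : 'M[R]_(d, n)) (w : R)
    (I : (pt -> R) -> R) : 0 < w ->
  (forall f, bmeas (@ref_simplex R d) (fun t => f (a + t *m E)) ->
     I f = w * \int[lebesgue d]_(t in @ref_simplex R d) f (a + t *m E)) ->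
  integration (affine_image a E)
    (fun f => bmeas (@ref_simplex R d) (fun t => f (a + t *m E))) I.
Proof.
move=> w0 IE.
have Dt t : @ref_simplex R d t -> affine_image a E (a + t *m E) by exists t.
have mT := @measurable_ref_simplex R d; have fT := @ref_simplex_finite R d.
have ext (f g : pt -> R) : (forall x, affine_image a E x -> f x = g x) ->
    bmeas (@ref_simplex R d) (fun t => f (a + t *m E)) ->
    bmeas (@ref_simplex R d) (fun t => g (a + t *m E)).
  by move=> fg; apply: bmeas_ext => t /Dt; exact: fg.
have pe p : bmeas (@ref_simplex R d) (fun t => peval p (a + t *m E)).
  by apply: bmeas_peval => i; exact: bmeas_affine.
split => //.
- by move=> c f g bf bg; apply: bmeasD => //; exact: bmeasZ.
- by move=> f g bf bg; exact: bmeasM.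
- by move=> f s s0 bf f0; apply: bmeas_powR => // t /Dt; exact: f0.
- by move=> f bf; exact: bmeas_sqrt.
- by move=> f [_ [B fB]]; exists B => _ [t Tt <-]; exact: fB.
- move=> f g fg bf; rewrite !IE//; last exact: ext fg bf.
  by congr (_ * _); apply: eq_Rintegral => t /set_mem /Dt; exact: fg.
- move=> c f g bf bg; rewrite !IE//; last by apply: bmeasD => //; exact: bmeasZ.
  by rewrite (bmeas_int_lin mT fT)//; ring.
- move=> f bf f0; rewrite IE//; apply: mulr_ge0; first exact: ltW.
  by apply: Rintegral_ge0 => t /Dt; exact: f0.
- move=> p p0; rewrite IE// => /eqP; rewrite mulf_eq0 gt_eqF//= => /eqP ip _ [t Tt <-].
  apply: (ref_simplex_definite _ (pe p) _ ip Tt); last by move=> u /Dt; exact: p0.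
  apply: continuous_peval => i; under eq_fun do rewrite !mxE.
  move=> u; apply: continuousD; first exact: cst_continuous.
  apply: continuous_sum_fun => j v.
  by apply: continuousM; [exact: coord_continuous|exact: cst_continuous].
Qed.

Section theory.
Variables (D : set pt) (N : (pt -> R) -> Prop) (I : (pt -> R) -> R).
Hypothesis H : integration D N I.
Implicit Types (f g : pt -> R).

Lemma adm_cst c : N (cst c).
Proof. by apply: (adm_ext H _ (adm_peval H (pC c))) => x _; rewrite pevalC. Qed.

Lemma admD f g : N f -> N g -> N (fun x => f x + g x).
Proof.
by move=> Nf Ng; apply: (adm_ext H _ (adm_lin H 1 Nf Ng)) => x _; rewrite mul1r.
Qed.

Lemma admZ c f : N f -> N (fun x => c * f x).
Proof.
by move=> Nf; apply: (adm_ext H _ (adm_lin H c Nf (adm_cst 0))) => x _; rewrite addr0.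
Qed.

Lemma admN f : N f -> N (fun x => - f x).
Proof. by move=> Nf; apply: (adm_ext H _ (admZ (-1) Nf)) => x _; rewrite mulN1r. Qed.

Lemma admB f g : N f -> N g -> N (fun x => f x - g x).
Proof. by move=> Nf Ng; apply: admD => //; exact: admN. Qed.

Lemma adm_sum (J : Type) (r : seq J) (F : J -> pt -> R) :
  (forall j, N (F j)) -> N (fun x => \sum_(j <- r) F j x).
Proof.
move=> NF; elim: r => [|j r IH].
  by apply: (adm_ext H _ (adm_cst 0)) => x _; rewrite big_nil.
by apply: (adm_ext H _ (admD (NF j) IH)) => x _; rewrite big_cons.
Qed.

Lemma int_cst0 : I (cst 0) = 0.
Proof.
have := int_lin H 1 (adm_cst 0) (adm_cst 0); rewrite mul1r.
have -> : (fun x : pt => 1 * cst 0 x + cst 0 x) = cst 0 :> (pt -> R).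
  by apply/funext => x; rewrite mulr0 addr0.
by rewrite -{1}[I _]addr0 => /addrI.
Qed.

Lemma intZ c f : N f -> I (fun x => c * f x) = c * I f.
Proof.
move=> Nf; rewrite -[RHS]addr0 -int_cst0 -(int_lin H)//; last exact: adm_cst.
by congr I; apply/funext => x; rewrite addr0.
Qed.

Lemma intD f g : N f -> N g -> I (fun x => f x + g x) = I f + I g.
Proof.
move=> Nf Ng; rewrite -[I f in RHS]mul1r -(int_lin H)//.
by congr I; apply/funext => x; rewrite mul1r.
Qed.

Lemma intB f g : N f -> N g -> I (fun x => f x - g x) = I f - I g.
Proof.
move=> Nf Ng; rewrite addrC -mulN1r -(int_lin H)//.
by congr I; apply/funext => x; rewrite mulN1r addrC.
Qed.

Lemma int_sum (J : Type) (r : seq J) (F : J -> pt -> R) :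
  (forall j, N (F j)) -> I (fun x => \sum_(j <- r) F j x) = \sum_(j <- r) I (F j).
Proof.
move=> NF; elim: r => [|j r IH].
  transitivity (I (cst 0)); last by rewrite int_cst0 big_nil.
  by congr I; apply/funext => x; rewrite big_nil.
rewrite big_cons -IH -intD//; last exact: adm_sum.
by congr I; apply/funext => x; rewrite big_cons.
Qed.

Lemma int_le f g : N f -> N g -> (forall x, D x -> f x <= g x) -> I f <= I g.
Proof.
move=> Nf Ng fg; rewrite -subr_ge0 -intB//; apply: (int_ge0 H); first exact: admB.
by move=> x Dx; rewrite subr_ge0 fg.
Qed.

Lemma Pol_adm j f : Pol j D f -> N f.
Proof. by move=> [p _ fp]; apply: (adm_ext H _ (adm_peval H p)) => x /fp. Qed.

Lemma Pol_lin j c f g : Pol j D f -> Pol j D g -> Pol j D (fun x => c * f x + g x).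
Proof.
move=> [p dp fp] [q dq gq]; exists (c *: p + q); first exact: deg_leD (deg_leZ c dp) dq.
by move=> x Dx; rewrite pevalD pevalZ fp// gq.
Qed.

Lemma Pol_cst j c : Pol j D (cst c).
Proof. by exists (pC c); [exact: deg_leC|move=> x _; rewrite pevalC]. Qed.

Lemma int_sqr_eq0 j f : Pol j D f -> I (fun x => f x * f x) = 0 ->
  forall x, D x -> f x = 0.
Proof.
move=> Pf If x Dx; have Nf := Pol_adm Pf; have [p dp fp] := Pf.
have := int_def H (p := p * p) _ _ Dx; rewrite pevalM -fp// => h.
apply/eqP; rewrite -sqrf_eq0 expr2; apply/eqP; apply: h.
  by move=> y _; rewrite pevalM -expr2 sqr_ge0.
rewrite -If; apply/esym/(int_ext H); last exact: (adm_mul H Nf Nf).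
by move=> y Dy; rewrite pevalM fp.
Qed.

(** The difference f - g is itself an admissible test polynomial. *)
Lemma Pol_orthogonal j f g : Pol j D f -> Pol j D g ->
  (forall s, deg_le j s -> I (fun x => f x * peval s x) = I (fun x => g x * peval s x)) ->
  forall x, D x -> f x = g x.
Proof.
move=> Pf Pg h x Dx; apply/eqP; rewrite -subr_eq0; apply/eqP.
have Pfg : Pol j D (fun y => f y - g y).
  have [p dp fp] := Pol_lin (-1) Pg Pf; exists p => // y Dy.
  by rewrite -fp// mulN1r addrC.
apply: (int_sqr_eq0 Pfg _ Dx).
have [p dp fp] := Pfg.
have Nf := Pol_adm Pf; have Ng := Pol_adm Pg; have Np := adm_peval H p.
have Nfp := adm_mul H Nf Np; have Ngp := adm_mul H Ng Np.
transitivity (I (fun y => f y * peval p y - g y * peval p y)).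
  apply: (int_ext H) => [y Dy|]; first by rewrite {2}fp// mulrBl.
  by apply: (adm_mul H); exact: admB.
by rewrite intB// h// subrr.
Qed.

(** On a face different polynomials can have the same values, so the L^2 product on polynomials is
    only semidefinite; this is why L must vanish on polynomials that are zero on D. *)
Lemma riesz_Pol j (L : mp -> R) :
  linear_on (fun p : mp => deg_le j p) L ->
  (forall p, deg_le j p -> (forall x, D x -> peval p x = 0) -> L p = 0) ->
  exists2 g, deg_le j g & forall s, deg_le j s -> I (fun x => peval g x * peval s x) = L s.
Proof.
move=> lL L0.
pose B (p q : mp) := I (fun x => peval p x * peval q x).
have Npq p q : N (fun x => peval p x * peval q x).
  exact: (adm_mul H (adm_peval H p) (adm_peval H q)).
have pB : psd_on (fun p : mp => deg_le j p) B.
  split.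
  - by move=> p q _ _; congr I; apply/funext => x; rewrite mulrC.
  - move=> r _ a p q _ _; rewrite /B -(int_lin H)//; congr I; apply/funext => x.
    by rewrite pevalD pevalZ; ring.
  - move=> p _; apply: (int_ge0 H); first exact: Npq.
    by move=> x _; rewrite -expr2 sqr_ge0.
apply: (riesz (subspace_deg_le j) pB _ lL).
  apply: finite_rank_deg_le => p ->; rewrite -int_cst0; congr I; apply/funext => x.
  by rewrite peval0 mulr0.
move=> p dp Bp; apply: L0 => //; apply: (@int_sqr_eq0 j) => //.
by exists p.
Qed.

(** Definiteness of the integral is available for polynomials only, and |f|^r is not one. As f is
    bounded, a high even power of |f|, which is a polynomial, is dominated by a multiple of
    |f|^r. *)
Lemma int_powR_eq0 j (m : nat) (f : 'I_m -> pt -> R) r : 0 < r ->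
  (forall i, Pol j D (f i)) ->
  I (fun x => Num.sqrt (\sum_i f i x * f i x) `^ r) = 0 ->
  forall i x, D x -> f i x = 0.
Proof.
move=> r0 Pf I0 i x Dx.
have exF l : exists p : mp, forall y, D y -> f l y = peval p y.
  by have [p _ pP] := Pf l; exists p.
have [F FP] := choice exF.
have Nf l := Pol_adm (Pf l).
pose S y := \sum_i f i y * f i y.
have NS : N S by apply: adm_sum => l; exact: (adm_mul H (Nf l) (Nf l)).
have S0 y : 0 <= S y by apply: sumr_ge0 => l _; rewrite -expr2 sqr_ge0.
pose e y := Num.sqrt (S y).
have Ne : N e by exact: (adm_sqrt H NS).
have e0 y : 0 <= e y by exact: sqrtr_ge0.
have [B0 B0P] := adm_bound H Ne.
pose B := Num.max 1 B0.
have B_gt0 : 0 < B by rewrite lt_max ltr01.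
have eB y : D y -> e y <= B.
  by move=> Dy; rewrite (le_trans (ler_norm _))// (le_trans (B0P _ Dy))// le_max lexx orbT.
(* Any integer M with r <= 2 M serves; [P] is then the polynomial equal to |f|^(2 M) on D. *)
pose M := (Num.bound r).+1.
have rM : r <= (2 * M)%:R.
  rewrite natrM (le_trans (ltW (archi_boundP (ltW r0))))// /M -natr1.
  have : 0 <= (Num.bound r)%:R :> R by [].
  set b := _%:R; lra.
pose P : mp := (\sum_i F i * F i) ^+ M.
have PE y : D y -> peval P y = e y ^+ (2 * M).
  move=> Dy; rewrite /P exprM sqr_sqrtr//.
  have -> : peval ((\sum_i0 F i0 * F i0) ^+ M) y = (peval (\sum_i0 F i0 * F i0) y) ^+ M.
    exact: (rmorphXn (mpoly.meval _)).
  rewrite peval_sum; congr (_ ^+ _); apply: eq_bigr => l _.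
  by rewrite pevalM !FP.
have NP := adm_peval H P.
have Ner : N (fun y => e y `^ r) by apply: (adm_powR H) => //; exact: ltW.
have IP : I (peval P) = 0.
  apply/eqP; rewrite eq_le; apply/andP; split; last first.
    by apply: (int_ge0 H) => // y Dy; rewrite PE// exprn_ge0.
  (* Since 0 <= e / B <= 1 on D, the power of e / B with exponent 2 M is at most the one with
     exponent r. *)
  have -> : 0 = I (fun y => (B ^+ (2 * M) / B `^ r) * e y `^ r).
    by rewrite intZ// I0 mulr0.
  apply: int_le => //; first exact: admZ.
  move=> y Dy; rewrite PE//.
  have [->|ey0] := eqVneq (e y) 0.
    by rewrite powR0 ?gt_eqF// mulr0 expr0n muln_eq0.
  have eyB : e y / B <= 1 by rewrite ler_pdivrMr// mul1r eB.
  have ey_gt0 : 0 < e y by rewrite lt_neqAle eq_sym ey0 e0.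
  have q0 : 0 < e y / B by rewrite divr_gt0.
  have key : (e y / B) ^+ (2 * M) <= (e y / B) `^ r.
    rewrite -(powR_mulrn _ (ltW q0)) /powR (gt_eqF q0) ler_expR ler_wnM2r//.
    exact: ln_le0.
  have -> : e y ^+ (2 * M) = B ^+ (2 * M) * (e y / B) ^+ (2 * M).
    by rewrite -exprMn mulrC divfK// gt_eqF.
  rewrite -mulrA ler_pM2l ?exprn_gt0// (le_trans key)//.
  have B0' := ltW B_gt0.
  by rewrite powRM ?e0 ?invr_ge0// -(@powR_inv1 _ B)// -powRrM mulN1r powRN mulrC.
have := int_def H _ IP Dx; rewrite PE// => h.
have /eqP : e x ^+ (2 * M) = 0 by apply: h => y Dy; rewrite PE// exprn_ge0.
rewrite expf_eq0 => /andP[_]; rewrite sqrtr_eq0 => Sx0.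
have : \sum_i f i x * f i x == 0 by rewrite eq_le Sx0 S0.
rewrite psumr_eq0 => [/allP /(_ i)|l _]; last by rewrite -expr2 sqr_ge0.
by rewrite mem_index_enum => /(_ isT) /=; rewrite mulf_eq0 orbb => /eqP.
Qed.

End theory.
End integration_functionals.

(** * Geometry of cells and faces *)

Section affine_integrals.
Context {R : realType}.

Lemma Rintegral_affine_nng n (A : 'M[R]_n) (b : 'rV[R]_n) (D : set 'rV[R]_n)
    (G : 'rV[R]_n -> R) : A \in unitmx -> measurable D -> measurable_fun D G ->
  (forall x, D x -> 0 <= G x) ->
  (`|\det A|%:E * \int[lebesgue n]_(x in [set x | D (x *m A + b)%R]) (G (x *m A + b)%R)%:E =
  \int[lebesgue n]_(x in D) (G x)%:E)%E.
Proof.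
move=> uA mD mG G0.
pose F := (fun x => (G x)%:E) \_ D.
have mF : measurable_fun setT F.
  by apply/(measurable_restrictT _ mD); exact/measurable_EFinP.
have F0 x : (0 <= F x)%E.
  by rewrite /F patchE; case: ifPn => // /set_mem Dx; rewrite lee_fin G0.
rewrite [RHS]integral_mkcond -(integral_affine b uA mF F0); congr (_ * _)%E.
rewrite integral_mkcond; apply: eq_integral => x _.
rewrite /F /patch; have -> // : (x \in [set x0 | D (x0 *m A + b)]) = (x *m A + b \in D).
by apply/idP/idP => /set_mem h; apply/mem_set.
Qed.

Lemma measurable_fun_affine_comp n (A : 'M[R]_n) (b : 'rV[R]_n) (D : set 'rV[R]_n)
    (G : 'rV[R]_n -> R) : A \in unitmx -> measurable D ->
  measurable_fun [set x | D (x *m A + b)] (fun x => G (x *m A + b)) ->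
  measurable_fun D G.
Proof.
move=> uA mD mG.
pose phi (x : 'rV[R]_n) := x *m A + b.
pose psi (y : 'rV[R]_n) := y *m invmx A + (- b *m invmx A).
have phiK y : phi (psi y) = y.
  by rewrite /phi /psi -mulmxDl mulmxKV// subrK.
have mphi : measurable_fun setT phi by exact: measurable_mulmx.
have mpsi : measurable_fun setT psi by exact: measurable_mulmx.
have mD' : measurable [set x | D (x *m A + b)].
  by rewrite -[X in measurable X]setTI; exact: mphi.
have -> : G = (fun x => G (phi x)) \o psi by apply/funext => y /=; rewrite phiK.
apply: (measurable_comp mD' _ mG); last exact: measurable_funTS.
by move=> _ [y Dy <-] /=; rewrite -/(phi _) phiK.
Qed.

Lemma Rintegral_affine n (A : 'M[R]_n) (b : 'rV[R]_n) (D D' : set 'rV[R]_n)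
    (G : 'rV[R]_n -> R) : A \in unitmx -> measurable D ->
  (forall x, D' x <-> D (x *m A + b)) -> (lebesgue n D' < +oo)%E ->
  bmeas D' (fun x => G (x *m A + b)) ->
  \int[lebesgue n]_(x in D) G x =
  `|\det A| * \int[lebesgue n]_(x in D') G (x *m A + b).
Proof.
move=> uA mD D'E.
have {D' D'E} -> : D' = [set x | D (x *m A + b)] by apply/seteqP; split => x /D'E.
set D' := [set x | _] => fD' [mG' [B GB]].
have mG : measurable_fun D G by exact: (measurable_fun_affine_comp uA mD mG').
have mD' : measurable D'.
  by rewrite -[X in measurable X]setTI; exact: (measurable_mulmx A b).
have psi y : D y -> exists2 x, D' x & y = x *m A + b.
  move=> Dy; exists ((y - b) *m invmx A); rewrite ?mulmxKV ?subrK//.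
  by rewrite /D' /= mulmxKV// subrK.
have GB' y : D y -> `|G y| <= B by move=> /psi[x D'x ->]; exact: GB.
have fD : (lebesgue n D < +oo)%E.
  have i1 (E : set 'rV[R]_n) : measurable E ->
      (\int[lebesgue n]_(x in E) 1%:E = lebesgue n E)%E.
    by move=> mE; rewrite integral_cst// mul1e.
  (* The constant 1 transfers the finiteness of the measure from [D'] to D. *)
  have := @Rintegral_affine_nng n A b D (cst 1) uA mD (measurable_cst _) (fun _ _ => ler01).
  rewrite /= !i1// => <-.
  by rewrite lte_mul_pinfty// ?lee_fin.
have bG : bmeas D G by split => //; exists B.
have bG' : bmeas D' (fun x => G (x *m A + b)) by split => //; exists B.
have nng (H : 'rV[R]_n -> R) : measurable_fun D H -> (forall x, D x -> 0 <= H x) ->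
    bmeas D' (fun x => H (x *m A + b)) ->
    \int[lebesgue n]_(x in D) H x = `|\det A| * \int[lebesgue n]_(x in D') H (x *m A + b).
  move=> mH H0 bH; rewrite /Rintegral -(Rintegral_affine_nng b uA mD mH H0) fineM//.
  have := bmeas_integrable mD' fD' bH.
  by move/(integrable_fin_num mD').
(* Adding the bound B makes the integrand nonnegative; the contribution of the constant is
   subtracted afterwards. *)
have := nng (fun x => G x + B).
have B1 (E : set 'rV[R]_n) : bmeas E (cst B) by exact: bmeas_cst.
have -> : \int[lebesgue n]_(x in D) (G x + B) =
    \int[lebesgue n]_(x in D) G x + \int[lebesgue n]_(x in D) (cst B x).
  by rewrite -[in RHS](mul1r (\int[_]_(x in D) G x)) -(bmeas_int_lin mD fD)//;
    apply: eq_Rintegral => x _; rewrite mul1r.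
have -> : \int[lebesgue n]_(x in D') (G (x *m A + b)%R + B) =
    \int[lebesgue n]_(x in D') G (x *m A + b) + \int[lebesgue n]_(x in D') (cst B (x *m A + b)).
  by rewrite -[in RHS](mul1r (\int[_]_(x in D') G _)) -(bmeas_int_lin mD' fD')//;
    apply: eq_Rintegral => x _; rewrite mul1r.
rewrite (nng (cst B)) => [h||y Dy|]; last 3 first.
- exact: measurable_cst.
- by rewrite (le_trans _ (GB' _ Dy)).
- exact: B1.
have := h _ _ _; rewrite mulrDr => {}h; apply: (addIr (`|\det A| *
  \int[lebesgue n]_(x in D') (cst B (x *m A + b)))); apply: h.
- by apply: measurable_funD => //; exact: measurable_cst.
- by move=> y /GB'; rewrite ler_norml; lra.
- by apply: bmeasD.
Qed.

End affine_integrals.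

(** * Affine parametrisation of simplexes *)

Section frames.
Context {R : realType} {n : nat} {V : finType} (pos : V -> 'rV[R]_n).
Implicit Types (S : {set V}).

(** An enumeration of the vertex set with a distinguished base b, through which the hull becomes an
    affine image of the reference simplex. *)
Definition frame d S (b : V) (a : 'I_d -> V) :=
  [/\ b \in S, injective a, (forall i, a i \in S :\ b) & #|S| = d.+1].

Definition frame_mx d (b : V) (a : 'I_d -> V) : 'M[R]_(d, n) :=
  \matrix_i (pos (a i) - pos b).

Lemma frame_imset d S b (a : 'I_d -> V) : frame S b a -> S :\ b = [set a i | i : 'I_d].
Proof.
move=> [bS ia aS cS]; apply/esym/eqP; rewrite eqEcard; apply/andP; split.
  by apply/fintype.subsetP => _ /imsetP[i _ ->]; exact: aS.
by rewrite card_imset// card_ord -ltnS -cS (cardsD1 b S) bS.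
Qed.

Lemma big_frame (W : nmodType) d S b (a : 'I_d -> V) (F : V -> W) : frame S b a ->
  \sum_(v in S) F v = F b + \sum_i F (a i).
Proof.
move=> fr; have [bS ia aS cS] := fr.
rewrite (big_setD1 b)//= (frame_imset fr) big_imset//=.
by move=> i j _ _; exact: ia.
Qed.

Lemma frame_point d (b : V) (a : 'I_d -> V) (t : 'rV[R]_d) :
  pos b + t *m frame_mx b a =
  (1 - \sum_i t 0 i) *: pos b + \sum_i t 0 i *: pos (a i).
Proof.
rewrite mulmx_sum_row; under eq_bigr do rewrite rowK scalerBr.
by rewrite sumrB -scaler_suml scalerBl scale1r addrA addrAC.
Qed.

Lemma hull_frame d S b (a : 'I_d -> V) : frame S b a ->
  hull pos S = affine_image (pos b) (frame_mx b a).
Proof.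
move=> fr; have [bS ia aS cS] := fr; apply/seteqP; split => x.
  move=> [t [t0 t1 ->]]; exists (\row_i t (a i)).
    split=> [i|]; rewrite ?mxE.
      by apply: t0; have := aS i; rewrite in_setD1 => /andP[].
    under eq_bigr do rewrite mxE.
    by rewrite -t1 (big_frame _ fr) lerDr t0.
  rewrite frame_point (big_frame _ fr); under eq_bigr do rewrite mxE.
  rewrite -[X in X - _]t1 (big_frame _ fr) addrK; congr (_ + _).
  by apply: eq_bigr => i _; rewrite mxE.
move=> [t [t0 t1] <-]; rewrite frame_point.
(* By injectivity of a the last sum has at most one term; it replaces an explicit inverse of a. *)
pose w v := if v == b then 1 - \sum_i t 0 i else
  \sum_(i | a i == v) t 0 i.
have wb : w b = 1 - \sum_i t 0 i by rewrite /w eqxx.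
have wa i : w (a i) = t 0 i.
  rewrite /w; have := aS i; rewrite in_setD1 => /andP[/negbTE -> _].
  rewrite (bigD1 i)//= big1 ?addr0// => j /andP[/eqP/ia -> /eqP//].
exists w; split.
- move=> v _; rewrite /w; case: ifP => _; first by rewrite subr_ge0.
  by apply: sumr_ge0.
- by rewrite (big_frame _ fr) wb (eq_bigr _ (fun i _ => wa i)) subrK.
- rewrite (big_frame _ fr) wb; congr (_ + _).
  by apply: eq_bigr => i _; rewrite wa.
Qed.

Lemma frame_exists d S b : b \in S -> #|S| = d.+1 -> exists a : 'I_d -> V, frame S b a.
Proof.
move=> bS cS; have cS' : size (enum (S :\ b)) = d.
  by rewrite -cardE; apply/eqP; rewrite -eqSS -cS (cardsD1 b S) bS.
exists (fun i => nth b (enum (S :\ b)) i); split => //.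
- move=> i j /eqP; rewrite nth_uniq ?cS' ?enum_uniq ?ltn_ord// => /eqP ij.
  exact: val_inj.
- by move=> i; rewrite -mem_enum mem_nth// cS'.
Qed.

End frames.

Section nondegenerate.
Context {R : realType} {n : nat} {V : finType} (pos : V -> 'rV[R]_n).

(** A vector in the left kernel of the edge matrix, completed by minus its sum at b, is an affine
    relation between the vertices. *)
Lemma frame_mx_unit S b (a : 'I_n -> V) : nsimplex pos S -> frame S b a ->
  frame_mx pos b a \in unitmx.
Proof.
move=> [cS ind] fr; have [bS ia aS _] := fr.
apply: unitmx_row_inj => x x0; apply/rowP => i; rewrite mxE.
pose w v := if v == b then - \sum_i x 0 i else \sum_(i | a i == v) x 0 i.
have wb : w b = - \sum_i x 0 i by rewrite /w eqxx.
have wa k : w (a k) = x 0 k.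
  rewrite /w; have := aS k; rewrite in_setD1 => /andP[/negbTE -> _].
  rewrite (bigD1 k)//= big1 ?addr0// => j /andP[/eqP/ia -> /eqP//].
rewrite -wa; apply: ind.
- by rewrite (big_frame _ fr) wb (eq_bigr _ (fun i _ => wa i)) addNr.
- rewrite (big_frame _ fr) wb.
  rewrite (eq_bigr (fun k => x 0 k *: pos (a k))) => [|k _]; last by rewrite wa.
  have := frame_point pos b a x; rewrite x0 addr0 scalerBl scale1r -addrA => /eqP.
  by rewrite -subr_eq0 opprD addrA subrr add0r oppr_eq0 scaleNr => /eqP.
- by have := aS i; rewrite in_setD1 => /andP[].
Qed.

(** The i-th entry of (x - pos b) times the inverse edge matrix, that is, the barycentric coordinate
    of the vertex a i. *)
Definition bary_mpoly b (a : 'I_n -> V) (i : 'I_n) : mpoly.mpoly n R :=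
  \sum_k invmx (frame_mx pos b a) k i *: (pX k - pC (pos b 0 k)).

Lemma bary_mpolyE b (a : 'I_n -> V) i t : frame_mx pos b a \in unitmx ->
  peval (bary_mpoly b a i) (pos b + t *m frame_mx pos b a) = t 0 i.
Proof.
move=> uE; rewrite peval_sum.
rewrite -[t in RHS](mulmxK uE) mxE; apply: eq_bigr => k _.
by rewrite pevalZ pevalD pevalN pevalX pevalC !mxE mulrC; congr (_ * _); ring.
Qed.

Lemma deg_le_bary b (a : 'I_n -> V) i : deg_le 1 (bary_mpoly b a i).
Proof.
apply: deg_le_sum => k; apply: deg_leZ; apply: deg_leD; first exact: deg_leX.
by rewrite -scaleN1r; apply: deg_leZ; exact: deg_leC.
Qed.

Lemma measurable_affine_image (c : 'rV[R]_n) (A : 'M[R]_n) : A \in unitmx ->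
  measurable (affine_image c A).
Proof.
move=> uA; have -> : affine_image c A =
    (fun x => x *m invmx A + (- c *m invmx A)) @^-1` @ref_simplex R n.
  apply/seteqP; split => x /=.
    by move=> [t Tt <-]; rewrite -mulmxDl addrAC subrr add0r mulmxK.
  move=> Tx; exists (x *m invmx A - c *m invmx A).
    by move: Tx; rewrite mulNmx.
  by rewrite mulmxBl !mulmxKV// addrC subrK.
rewrite -[X in measurable X]setTI; apply: measurable_mulmx => //.
exact: measurable_ref_simplex.
Qed.

Lemma integral_affine_image (c : 'rV[R]_n) (A : 'M[R]_n) (f : 'rV[R]_n -> R) :
  A \in unitmx -> bmeas (@ref_simplex R n) (fun t => f (c + t *m A)) ->
  \int[lebesgue n]_(x in affine_image c A) f x =
  `|\det A| * \int[lebesgue n]_(t in @ref_simplex R n) f (c + t *m A).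
Proof.
move=> uA bf; rewrite (@Rintegral_affine _ n A c _ (@ref_simplex R n))//.
- by congr (_ * _); apply: eq_Rintegral => t _; rewrite addrC.
- exact: measurable_affine_image.
- move=> t; split=> [Tt|[u Tu]]; first by exists t => //; rewrite addrC.
  by rewrite [RHS]addrC => /addrI /(can_inj (mulmxK uA)) <-.
- exact: ref_simplex_finite.
- by apply: bmeas_ext bf => t _; rewrite addrC.
Qed.

End nondegenerate.

Section simplex_integral.
Context {R : realType} {n : nat}.

Definition simplex_int d (c : 'rV[R]_n) (E : 'M[R]_(d, n)) (g : 'rV[R]_n -> R) : R :=
  Num.sqrt (\det (E *m E^T)) *
  \int[lebesgue d]_(t in @ref_simplex R d) g (c + t *m E).

(* Exchanges the base vertex of the reference simplex with the i0-th one. *)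
Definition swap_mx d (i0 : 'I_d) : 'M[R]_d :=
  \matrix_(i, j) if j == i0 then -1 else (i == j)%:R.

Lemma swap_mx_mul d (i0 : 'I_d) (t : 'rV[R]_d) j :
  (t *m swap_mx i0) 0 j = if j == i0 then - \sum_i t 0 i else t 0 j.
Proof.
rewrite mxE; under eq_bigr do rewrite mxE.
case: ifP => ji; first by under eq_bigr do rewrite mulrN1; rewrite sumrN.
rewrite (bigD1 j)//= eqxx mulr1 big1 ?addr0// => i ij.
by rewrite (negbTE ij) mulr0.
Qed.

Lemma swap_mxK d (i0 : 'I_d) : swap_mx i0 *m swap_mx i0 = 1%:M.
Proof.
apply: row_mulmx_inj => t; rewrite mulmxA mulmx1; apply/rowP => j.
rewrite swap_mx_mul; case: ifP => [/eqP ->|ji]; last by rewrite swap_mx_mul ji.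
under eq_bigr do rewrite swap_mx_mul.
rewrite (bigD1 i0)//= eqxx.
rewrite [X in _ + X](eq_bigr (fun i => t 0 i)) => [|i /negbTE -> //].
by rewrite (bigD1 i0)//=; ring.
Qed.

Lemma det_swap_mx d (i0 : 'I_d) : `|\det (swap_mx i0)| = 1.
Proof.
have /eqP : \det (swap_mx i0) ^+ 2 = 1 by rewrite expr2 -det_mulmx swap_mxK det1.
by rewrite -(real_normK (num_real _)) -[X in _ == X](expr1n _ 2) eqrXn2// => /eqP.
Qed.

Lemma swap_ref_simplex d (i0 : 'I_d) (t : 'rV[R]_d) :
  ref_simplex t -> ref_simplex (t *m swap_mx i0 + delta_mx 0 i0).
Proof.
move=> [t0 t1].
have e j : (t *m swap_mx i0 + delta_mx 0 i0) 0 j =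
    if j == i0 then 1 - \sum_i t 0 i else t 0 j.
  rewrite mxE swap_mx_mul mxE eqxx /=; case: ifP => _; first by rewrite addrC.
  by rewrite addr0.
split=> [i|]; first by rewrite e; case: ifP => // _; rewrite subr_ge0.
under eq_bigr do rewrite e.
rewrite (bigD1 i0)//= eqxx.
rewrite [X in _ + X](eq_bigr (fun i => t 0 i)) => [|i /negbTE -> //].
by rewrite (bigD1 i0)//=; have := t0 i0; lra.
Qed.

(** Changing the base vertex is an affine involution of the reference simplex with determinant of
    modulus 1, so neither the integral nor the Gram determinant is affected. *)
Lemma simplex_int_swap d (c : 'rV[R]_n) (E : 'M[R]_(d, n)) (i0 : 'I_d) g :
  bmeas (@ref_simplex R d) (fun t => g (c + t *m E)) ->
  simplex_int (c + row i0 E) (swap_mx i0 *m E) g = simplex_int c E g.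
Proof.
move=> bg; rewrite /simplex_int trmx_mul mulmxA -(mulmxA (swap_mx i0)) !det_mulmx.
rewrite mulrAC det_tr -expr2 -(real_normK (num_real _)) det_swap_mx expr1n mul1r.
congr (_ * _); set A := swap_mx i0.
have uA : A \in unitmx.
  by rewrite unitmxE unitfE -normr_eq0 det_swap_mx oner_neq0.
have key (t : 'rV[R]_d) : (t *m A + delta_mx 0 i0) *m A + delta_mx 0 i0 = t.
  rewrite mulmxDl -mulmxA swap_mxK mulmx1 -addrA -[RHS]addr0; congr (_ + _).
  apply/rowP => j; rewrite mxE swap_mx_mul !mxE eqxx /=.
  case: ifP => [ji|ji]; rewrite ?ji ?addr0//.
  rewrite (bigD1 i0)//= mxE !eqxx big1 ?addr0 ?addNr// => i ii.
  by rewrite mxE (negbTE ii).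
have bg' : bmeas (@ref_simplex R d) (fun t => g (c + (t *m A + delta_mx 0 i0) *m E)).
  case: bg => mg [B gB]; split; last first.
    by exists B => t Tt; apply: gB; exact: swap_ref_simplex.
  have := @measurable_comp _ _ _ _ _ _ (@ref_simplex R d) (fun t => g (c + t *m E))
    (@ref_simplex R d) (fun t => t *m A + delta_mx 0 i0).
  apply => //; first exact: measurable_ref_simplex.
    by move=> _ [t Tt <-]; exact: swap_ref_simplex.
  by apply: measurable_funTS; exact: measurable_mulmx.
rewrite [RHS](@Rintegral_affine _ d A (delta_mx 0 i0) _ (@ref_simplex R d)
  (fun t => g (c + t *m E)))//.
- rewrite det_swap_mx mul1r; apply: eq_Rintegral => t _; congr g.
  by rewrite mulmxDl -rowE mulmxA -addrA [X in c + X]addrC.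
- exact: measurable_ref_simplex.
- move=> t; split; first exact: swap_ref_simplex.
  by move=> /(swap_ref_simplex i0); rewrite key.
- exact: ref_simplex_finite.
Qed.

End simplex_integral.

(** * Integration of a derivative along the last coordinate of the reference simplex *)

Section fundamental_theorem.
Context {R : realType}.

Lemma poly_ftc (q : {poly R}) (s : R) : 0 <= s ->
  (\int[lebesgue_measure]_(t in `[0%R, s]) (q^`().[t])%:E = (q.[s] - q.[0])%:E)%E.
Proof.
rewrite le_eqVlt => /predU1P[<-|s0].
  by rewrite set_itv1 integral_set1 subrr.
have dq (x : R) : is_derive x 1 (horner q) (q^`().[x]) by exact: is_derive_poly.
rewrite (@continuous_FTC2 _ (horner q^`()) (horner q))//.
- by apply: continuous_subspaceT => x; exact: continuous_horner.
- split.
  + by move=> x _; case: (dq x).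
  + by apply: cvg_at_right_filter; exact: continuous_horner.
  + by apply: cvg_at_left_filter; exact: continuous_horner.
- by move=> x _; rewrite derive1E; case: (dq x).
Qed.

Lemma ref_simplex_snoc n (y : 'rV[R]_n) (t : R) :
  ref_simplex (rV_snoc (y, t)) <->
  ref_simplex y /\ 0 <= t <= 1 - \sum_i y 0 i.
Proof.
rewrite /ref_simplex /= forall_ord_max big_ord_max rV_snoc_max.
have -> : \sum_(i < n) rV_snoc (y, t) 0 (lift ord_max i) = \sum_i y 0 i.
  by apply: eq_bigr => i _; rewrite rV_snoc_lift.
split.
  move=> [[h1 h2] h3]; split; last by rewrite h2 lerBrDl.
  split=> [i|]; first by have := h1 i; rewrite rV_snoc_lift.
  by apply: le_trans h3; rewrite lerDl.
move=> [[h1 h2] /andP[h3 h4]]; split; last by rewrite -lerBrDl.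
by split=> // i; rewrite rV_snoc_lift.
Qed.

Lemma ref_simplex_ftc_nng n (H : 'rV[R]_n.+1 -> R) (q : 'rV[R]_n -> {poly R}) :
  bmeas (@ref_simplex R n.+1) H -> (forall t, ref_simplex t -> 0 <= H t) ->
  (forall y t, H (rV_snoc (y, t)) = (q y)^`().[t]) ->
  \int[lebesgue n.+1]_(t in @ref_simplex R n.+1) H t =
  \int[lebesgue n]_(y in @ref_simplex R n) ((q y).[1 - \sum_i y 0 i] - (q y).[0]).
Proof.
move=> [mH _] H0 Hq; rewrite /Rintegral; congr fine.
have mT := @measurable_ref_simplex R n.+1.
rewrite integral_mkcond tonelli_snoc; last 2 first.
- by apply/(measurable_restrictT _ mT); exact/measurable_EFinP.
- by move=> x; rewrite patchE; case: ifPn => // /set_mem Dx; rewrite lee_fin H0.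
rewrite [RHS]integral_mkcond; apply: eq_integral => y _.
rewrite [RHS]patchE; case: ifPn => [/set_mem Ty|nTy]; last first.
  rewrite integral0_eq// => t _; rewrite patchE ifN//; apply/negP => /set_mem.
  by move=> /ref_simplex_snoc[Ty _]; case/negP: nTy; apply/mem_set.
rewrite -poly_ftc; last by case: Ty => _; rewrite subr_ge0.
rewrite [RHS]integral_mkcond; apply: eq_integral => t _.
rewrite /patch; have -> : (rV_snoc (y, t) \in @ref_simplex R n.+1) =
    (t \in `[0, 1 - \sum_i y 0 i]%classic).
  apply/idP/idP => /set_mem h; apply/mem_set.
    by move/ref_simplex_snoc: h => [_]; rewrite /= in_itv.
  by apply/ref_simplex_snoc; split=> //; move: h; rewrite /= in_itv.
by case: ifP => // _; rewrite Hq.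
Qed.

(** Reduction to a nonnegative integrand: a constant C bounding |H| is added to H and
    correspondingly C X to the antiderivative, and the identity for the constant alone is
    subtracted. *)
Lemma ref_simplex_ftc n (H : 'rV[R]_n.+1 -> R) (q : 'rV[R]_n -> {poly R}) :
  bmeas (@ref_simplex R n.+1) H ->
  bmeas (@ref_simplex R n) (fun y => (q y).[1 - \sum_i y 0 i] - (q y).[0]) ->
  (forall y t, H (rV_snoc (y, t)) = (q y)^`().[t]) ->
  \int[lebesgue n.+1]_(t in @ref_simplex R n.+1) H t =
  \int[lebesgue n]_(y in @ref_simplex R n) ((q y).[1 - \sum_i y 0 i] - (q y).[0]).
Proof.
move=> bH bJ Hq; have [B HB] := bH.2.
have mT := @measurable_ref_simplex R; have fT := @ref_simplex_finite R.
have B0 : 0 <= Num.max 0 B by rewrite le_max lexx.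
set C := Num.max 0 B in B0.
have HC t : ref_simplex t -> `|H t| <= C.
  by move=> /HB h; rewrite (le_trans h)// le_max lexx orbT.
have bC m : bmeas (@ref_simplex R m) (cst C) by exact: bmeas_cst.
have e1 := @ref_simplex_ftc_nng n (fun t => 1 * H t + C) (fun y => q y + C *: 'X).
have e2 := @ref_simplex_ftc_nng n (cst C) (fun y => C *: 'X).
have bs : bmeas (@ref_simplex R n) (fun y => C * (1 - \sum_i y 0 i)).
  apply: bmeasZ; apply: bmeasD; first exact: bmeas_cst.
  have h := bmeasZ (-1) (bmeas_sum (index_enum 'I_n) (@bmeas_coord R n)).
  by apply: bmeas_ext h => y _; rewrite mulN1r.
have {}e1 : 1 * (\int[lebesgue n.+1]_(t in @ref_simplex R n.+1) H t) +
   \int[lebesgue n.+1]_(t in @ref_simplex R n.+1) (cst C t) =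
   1 * (\int[lebesgue n]_(y in @ref_simplex R n) ((q y).[1 - \sum_i y 0 i] - (q y).[0]))
   + \int[lebesgue n]_(y in @ref_simplex R n) (C * (1 - \sum_i y 0 i)).
  rewrite -(bmeas_int_lin (mT n.+1) (fT n.+1))// -(bmeas_int_lin (mT n) (fT n))//.
  rewrite (e1 _ _ _).
  - by apply: eq_Rintegral => y _; rewrite !hornerE; ring.
  - by apply: bmeasD => //; exact: bmeasZ.
  - by move=> t /HC; rewrite mul1r ler_norml; lra.
  - by move=> y t; rewrite mul1r Hq derivD derivZ derivX !hornerE.
move: e1; rewrite (e2 _ _ _)//; last first.
  by move=> y t; rewrite derivZ derivX !hornerE.
rewrite !mul1r.
have -> : \int[lebesgue n]_(y in @ref_simplex R n)
     ((C *: 'X).[1 - \sum_i y 0 i] - (C *: 'X).[0]) =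
   \int[lebesgue n]_(y in @ref_simplex R n) (C * (1 - \sum_i y 0 i)).
  by apply: eq_Rintegral => y _; rewrite !hornerE; ring.
by move/addIr.
Qed.

End fundamental_theorem.

Section euclidean_lemmas.
Context {R : realType} {n : nat}.
Implicit Types (x y z : 'rV[R]_n).

Lemma dotvC x y : dotv x y = dotv y x.
Proof. by apply: eq_bigr => i _; rewrite mulrC. Qed.

Lemma dotvDl x y z : dotv (x + y) z = dotv x z + dotv y z.
Proof. by rewrite -big_split; apply: eq_bigr => i _; rewrite mxE mulrDl. Qed.

Lemma dotvZl a x y : dotv (a *: x) y = a * dotv x y.
Proof. by rewrite mulr_sumr; apply: eq_bigr => i _; rewrite mxE mulrA. Qed.

Lemma dotvDr x y z : dotv x (y + z) = dotv x y + dotv x z.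
Proof. by rewrite dotvC dotvDl !(dotvC x). Qed.

Lemma dotvZr a x y : dotv x (a *: y) = a * dotv x y.
Proof. by rewrite dotvC dotvZl dotvC. Qed.

Lemma dotvNr x y : dotv x (- y) = - dotv x y.
Proof. by rewrite -scaleN1r dotvZr mulN1r. Qed.

Lemma dotvBr x y z : dotv x (y - z) = dotv x y - dotv x z.
Proof. by rewrite dotvDr dotvNr. Qed.

Lemma dotv0r x : dotv x 0 = 0.
Proof. by rewrite -(scale0r x) dotvZr mul0r. Qed.

Lemma dotv0l x : dotv 0 x = 0.
Proof. by rewrite dotvC dotv0r. Qed.

Lemma dotv_ge0 x : 0 <= dotv x x.
Proof. by apply: sumr_ge0 => i _; rewrite -expr2 sqr_ge0. Qed.

Lemma dotv_eq0 x : (dotv x x == 0) = (x == 0).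
Proof.
apply/idP/idP => [|/eqP ->]; last by rewrite dotv0r.
rewrite psumr_eq0 => [/allP h|i _]; last by rewrite -expr2 sqr_ge0.
apply/eqP/rowP => i; rewrite mxE; have := h i; rewrite mem_index_enum => /(_ isT).
by rewrite /= -expr2 sqrf_eq0 => /eqP.
Qed.

Lemma dotv_mulmx m p (A : 'M[R]_(m, n)) (B : 'M[R]_(p, n)) i j :
  (A *m B^T) i j = dotv (row i A) (row j B).
Proof. by rewrite mxE; apply: eq_bigr => k _; rewrite !mxE. Qed.

Lemma enorm_ge0 x : 0 <= enorm x. Proof. exact: sqrtr_ge0. Qed.

Lemma enorm_sqr x : enorm x ^+ 2 = dotv x x.
Proof. by rewrite sqr_sqrtr// dotv_ge0. Qed.

Lemma enorm_eq0 x : (enorm x == 0) = (x == 0).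
Proof. by rewrite -sqrf_eq0 enorm_sqr dotv_eq0. Qed.

Lemma dotv_psd : psd_on (fun _ : 'rV[R]_n => True) (@dotv R n).
Proof.
split; first by move=> x y _ _; exact: dotvC.
  by move=> z _ a x y _ _; rewrite dotvDl dotvZl.
by move=> x _; exact: dotv_ge0.
Qed.

Lemma dotv_cs x y : `|dotv x y| <= enorm x * enorm y.
Proof. by apply: (psd_cs_sqrt _ dotv_psd). Qed.

Lemma enormD x y : enorm (x + y) <= enorm x + enorm y.
Proof.
rewrite -(ler_pXn2r (n := 2))// ?nnegrE ?enorm_ge0 ?addr_ge0 ?enorm_ge0//.
rewrite sqrrD !enorm_sqr dotvDl !dotvDr (dotvC y x).
have := le_trans (ler_norm _) (dotv_cs x y); lra.
Qed.

Lemma enormN x : enorm (- x) = enorm x.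
Proof. by rewrite /enorm dotvNr dotvC dotvNr opprK. Qed.

Lemma enormZ a x : enorm (a *: x) = `|a| * enorm x.
Proof. by rewrite /enorm dotvZr dotvZl mulrA -expr2 sqrtrM ?sqr_ge0// sqrtr_sqr. Qed.

Lemma enorm_dist x y : `|enorm x - enorm y| <= enorm (x - y).
Proof.
have h1 : enorm x <= enorm (x - y) + enorm y by rewrite -{1}(subrK y x) enormD.
have h2 : enorm y <= enorm (x - y) + enorm x.
  by rewrite -[enorm (x - y)]enormN opprB -{1}(subrK x y) enormD.
by rewrite ler_norml; apply/andP; split; lra.
Qed.

End euclidean_lemmas.

Section height.
Context {R : realType} {n : nat}.

(** Volume as base area times height: the area element is the root of the Gram determinant of the
    face edges, the height is the component of the last edge along the unit normal. *)
Lemma gram_height (E : 'M[R]_n.+1) (nu : 'rV[R]_n.+1) : E \in unitmx ->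
  (forall i, dotv nu (row (lift ord_max i) E) = 0) -> dotv nu nu = 1 ->
  let E' := \matrix_(i < n) row (lift ord_max i) E in
  0 < \det (E' *m E'^T) /\
  `|\det E| = Num.sqrt (\det (E' *m E'^T)) * `|dotv nu (row ord_max E)|.
Proof.
move=> uE nuE nu1 E'.
have rE' i : row i E' = row (lift ord_max i) E by rewrite rowK.
(* E with its last row replaced by the normal. The product of M with its transpose is the Gram
   matrix bordered by 1, and that of E with the transpose of M is block triangular; the two
   determinants give the formula. *)
pose M : 'M[R]_n.+1 := \matrix_i (if unlift ord_max i is Some j then row j E' else nu).
have rM i : row (lift ord_max i) M = row i E' by rewrite rowK liftK.
have rMm : row ord_max M = nu by rewrite rowK unlift_none.
have MM : M *m M^T = blk (E' *m E'^T) 0 0 1.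
  apply/matrixP => i j; rewrite dotv_mulmx [RHS]mxE.
  case: (unliftP ord_max i) => [i' ->|->]; case: (unliftP ord_max j) => [j' ->|->];
    rewrite ?rM ?rMm ?rE'.
  - by rewrite dotv_mulmx !rE'.
  - by rewrite mxE dotvC nuE.
  - by rewrite mxE nuE.
  - exact: nu1.
have EM : E *m M^T = blk (E' *m E'^T) 0 (\row_j dotv (row ord_max E) (row j E'))
    (dotv (row ord_max E) nu).
  apply/matrixP => i j; rewrite dotv_mulmx [RHS]mxE.
  case: (unliftP ord_max i) => [i' ->|->]; case: (unliftP ord_max j) => [j' ->|->];
    rewrite ?rM ?rMm ?rE'.
  - by rewrite dotv_mulmx !rE'.
  - by rewrite mxE dotvC nuE.
  - by rewrite mxE rE'.
  - by [].
have detM2 : \det M ^+ 2 = \det (E' *m E'^T).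
  by rewrite expr2 -[X in _ * X]det_tr -det_mulmx MM det_blk_up mulr1.
have detEM : \det E * \det M = \det (E' *m E'^T) * dotv (row ord_max E) nu.
  by rewrite -[X in _ * X]det_tr -det_mulmx EM det_blk_low.
have uM : M \in unitmx.
  apply: unitmx_row_inj => x; rewrite (rV_snoc_inv x).
  set y := \row_i _; set t := x 0 _ => xM.
  have sM : rV_snoc (y, t) *m M = y *m E' + t *: nu.
    apply/rowP => j; rewrite !mxE big_ord_max rV_snoc_max.
    rewrite [X in _ + t * X]mxE unlift_none; congr (_ + _).
    by apply: eq_bigr => i _; rewrite rV_snoc_lift; congr (_ * _); rewrite mxE liftK mxE.
  rewrite sM in xM.
  have dE' : dotv nu (y *m E') = 0.
    rewrite mulmx_sum_row /dotv.
    under eq_bigr do rewrite summxE mulr_sumr.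
    rewrite exchange_big big1// => i _.
    transitivity (y 0 i * dotv nu (row i E')); last by rewrite rE' nuE mulr0.
    by rewrite mulr_sumr; apply: eq_bigr => j _; rewrite mxE; ring.
  have t0 : t = 0.
    by have := congr1 (dotv nu) xM; rewrite dotvDr dE' dotvZr nu1 mulr1 dotv0r add0r.
  have yE : rV_snoc (y, 0) *m E = 0.
    rewrite -[RHS]xM t0 scale0r addr0; apply/rowP => j.
    rewrite !mxE big_ord_max rV_snoc_max mul0r addr0.
    by apply: eq_bigr => i _; rewrite rV_snoc_lift !mxE.
  rewrite t0; move: yE => /(congr1 (mulmx^~ (invmx E))).
  by rewrite mulmxK// mul0mx.
have dM : \det M != 0 by move: uM; rewrite unitmxE unitfE.
have G0 : 0 < \det (E' *m E'^T) by rewrite -detM2 exprn_even_gt0.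
split => //; rewrite -detM2 sqrtr_sqr (dotvC nu).
apply: (mulIf (x := `|\det M|)); first by rewrite normr_eq0.
by rewrite -normrM detEM -detM2 normrM normrX; ring.
Qed.

End height.

Section simplex_geometry.
Context {R : realType} {n : nat}.

Lemma snoc_mulmx p (y : 'rV[R]_n) t (E : 'M[R]_(n.+1, p)) :
  rV_snoc (y, t) *m E =
  y *m (\matrix_(i < n) row (lift ord_max i) E) + t *: row ord_max E.
Proof.
apply/rowP => j; rewrite !mxE big_ord_max rV_snoc_max; congr (_ + _).
by apply: eq_bigr => i _; rewrite rV_snoc_lift; congr (_ * _); rewrite !mxE.
Qed.

Lemma bmeas_affine_image p (c : 'rV[R]_p) (A : 'M[R]_p) (f : 'rV[R]_p -> R) :
  A \in unitmx ->
  bmeas (affine_image c A) f <-> bmeas (@ref_simplex R p) (fun t => f (c + t *m A)).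
Proof.
move=> uA; have mD := measurable_affine_image c uA.
have imE t : @ref_simplex R p t <-> affine_image c A (t *m A + c).
  split=> [Tt|[u Tu]]; first by exists t => //; rewrite addrC.
  by rewrite [RHS]addrC => /addrI /(can_inj (mulmxK uA)) <-.
split=> -[mf [B fB]]; split.
- apply: (measurable_comp mD _ mf).
    by move=> _ [t Tt <-]; rewrite addrC; apply/imE.
  apply: measurable_funTS; have := measurable_mulmx A c.
  by under eq_fun do rewrite addrC.
- by exists B => t Tt; apply: fB; exists t.
- apply: (measurable_fun_affine_comp (A := A) (b := c) uA mD).
  have -> : [set x | affine_image c A (x *m A + c)] = @ref_simplex R p.
    by apply/seteqP; split => x /imE.
  by under eq_fun do rewrite addrC.
- by exists B => _ [t Tt <-]; exact: fB.
Qed.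

Context {V : finType} (pos : V -> 'rV[R]_n.+1).
Implicit Types (K : {set V}).

Lemma frame_extend K v b (a' : 'I_n -> V) : v \in K -> frame (K :\ v) b a' ->
  frame K b (fun i => oapp a' v (unlift ord_max i)).
Proof.
move=> vK [bK ia aS cS]; have [bv bK'] := setD1P bK; split=> //.
- move=> i j; case: (unliftP ord_max i) => [i' ->|->];
    case: (unliftP ord_max j) => [j' ->|->]; rewrite ?liftK ?unlift_none //=.
  + by move/ia ->.
  + by move=> e; have := aS i'; rewrite e !inE eqxx andbF.
  + by move=> e; have := aS j'; rewrite -e !inE eqxx andbF.
- move=> i; case: unliftP => [i' _|_] /=.
    by have := aS i'; rewrite !inE => /and3P[-> _ ->].
  by rewrite !inE eq_sym bv.
- by rewrite (cardsD1 v K) vK cS.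
Qed.

Lemma frame_mx_extend v b (a' : 'I_n -> V) :
  let E := frame_mx pos b (fun i => oapp a' v (unlift ord_max i)) in
  \matrix_(i < n) row (lift ord_max i) E = frame_mx pos b a' /\
  row ord_max E = pos v - pos b.
Proof.
split; first by apply/row_matrixP => i; rewrite !rowK liftK.
by rewrite rowK unlift_none.
Qed.

Lemma outward_normal K v b (a' : 'I_n -> V) : nsimplex pos K -> v \in K ->
  frame (K :\ v) b a' ->
  exists nu, [/\ enorm nu = 1, (forall i, dotv nu (pos (a' i) - pos b) = 0) &
    dotv nu (pos v - pos b) < 0].
Proof.
move=> nK vK fr; have fr' := frame_extend vK fr.
have uE := frame_mx_unit nK fr'; have [E1 E2] := frame_mx_extend v b a'.
set E := frame_mx pos b _ in uE E1 E2.
(* The dual vector of the last edge: orthogonal to the edges of the face and with product 1 with the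
   edge to v, so its opposite, normalised, points outward. *)
pose z : 'rV[R]_n.+1 := (col ord_max (invmx E))^T.
have zE i : dotv z (row i E) = (i == ord_max)%:R.
  transitivity ((E *m invmx E) i ord_max); last by rewrite mulmxV// mxE.
  by rewrite mxE; apply: eq_bigr => k _; rewrite !mxE mulrC.
have z0 : 0 < enorm z.
  rewrite lt_neqAle eq_sym enorm_ge0 andbT enorm_eq0; apply/eqP => z0.
  by have := zE ord_max; rewrite z0 dotv0l eqxx => /eqP; rewrite eq_sym oner_eq0.
exists (- (enorm z)^-1 *: z); split.
- by rewrite enormZ normrN gtr0_norm ?invr_gt0// mulVf// gt_eqF.
- move=> i; rewrite dotvZl.
  have -> : pos (a' i) - pos b = row (lift ord_max i) E by rewrite rowK liftK.
  by rewrite zE -(inj_eq val_inj) /= /bump leqNgt ltn_ord add0n ltn_eqF// mulr0.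
- by rewrite dotvZl -E2 zE eqxx mulr1 oppr_lt0 invr_gt0.
Qed.

Lemma card_face K v : nsimplex pos K -> v \in K -> #|K :\ v| = n.+1.
Proof. by move=> [cK _] vK; apply/eqP; rewrite -eqSS -cK (cardsD1 v K) vK. Qed.

Lemma barycentric_exists K : nsimplex pos K ->
  exists lam : V -> mpoly.mpoly n.+1 R, (forall u, deg_le 1 (lam u)) /\
    forall t : V -> R, \sum_(u in K) t u = 1 ->
      forall u, u \in K -> peval (lam u) (\sum_(w in K) t w *: pos w) = t u.
Proof.
move=> nK; have [cK _] := nK.
have [b bK] : exists b, b \in K by apply/card_gt0P; rewrite cK.
have [a fr] := frame_exists bK cK; have uE := frame_mx_unit nK fr.
exists (fun u => if u == b then pC 1 - \sum_i bary_mpoly pos b a i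
                 else \sum_(i | a i == u) bary_mpoly pos b a i); split.
  move=> u; case: ifP => _; last first.
    rewrite big_mkcond; apply: deg_le_sum => i; case: ifP => _.
      exact: deg_le_bary.
    exact: deg_le0.
  apply: deg_leD; first exact: deg_leC.
  rewrite -scaleN1r; apply: deg_leZ; apply: deg_le_sum => i; exact: deg_le_bary.
move=> t t1 u uK.
pose tau : 'rV[R]_n.+1 := \row_i t (a i).
have -> : \sum_(w in K) t w *: pos w = pos b + tau *m frame_mx pos b a.
  rewrite frame_point (big_frame _ fr); congr (_ + _).
    congr (_ *: _); rewrite -t1 (big_frame _ fr).
    under [X in _ = _ - X]eq_bigr do rewrite mxE.
    by rewrite addrK.
  by apply: eq_bigr => i _; rewrite mxE.
have [_ ia aS _] := fr.
case: eqP => [->|/eqP ub].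
  rewrite pevalD pevalN pevalC peval_sum.
  under eq_bigr do rewrite bary_mpolyE// mxE.
  by rewrite -t1 (big_frame _ fr) addrK.
have : u \in K :\ b by rewrite !inE ub.
rewrite (frame_imset fr) => /imsetP[i _ ->].
rewrite (bigD1 i)//= big1 ?addr0 => [|j /andP[/eqP/ia -> /eqP//]].
by rewrite bary_mpolyE// mxE.
Qed.

End simplex_geometry.

(** * Integrals over cells and faces, and the divergence theorem *)

Section mesh_integrals.
Context {R : realType} {n : nat} (M : mesh R n.+1).
Local Notation pos := (@pos R n.+1 M).
Implicit Types (K e : {set vtx M}) (v b : vtx M).

Lemma cell_frame K b (a : 'I_n.+1 -> vtx M) : frame K b a ->
  cell K = affine_image (pos b) (frame_mx pos b a).
Proof. exact: hull_frame. Qed.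

Lemma int_cell_frame K b (a : 'I_n.+1 -> vtx M) f : nsimplex pos K -> frame K b a ->
  bmeas (cell K) f ->
  int_cell K f = `|\det (frame_mx pos b a)| *
    \int[lebesgue n.+1]_(t in @ref_simplex R n.+1) f (pos b + t *m frame_mx pos b a).
Proof.
move=> nK fr; have uE := frame_mx_unit nK fr.
rewrite /int_cell (cell_frame fr) => /(bmeas_affine_image _ _ uE) bf.
by rewrite integral_affine_image.
Qed.

Lemma cell_integration K : nsimplex pos K ->
  integration (cell K) (bmeas (cell K)) (@int_cell R n.+1 M K).
Proof.
move=> nK; have [cK _] := nK.
have [b bK] : exists b, b \in K by apply/card_gt0P; rewrite cK.
have [a fr] := frame_exists bK cK; have uE := frame_mx_unit nK fr.
have -> : bmeas (cell K) =
    (fun f : 'rV[R]_n.+1 -> R => bmeas (@ref_simplex R n.+1) (fun t => f (pos b + t *m frame_mx pos b a))).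
  apply/funext => f; apply/propext; rewrite (cell_frame fr).
  exact: bmeas_affine_image.
rewrite {1}(cell_frame fr).
apply: (@simplex_integration _ _ _ _ _ `|\det (frame_mx pos b a)|).
  by rewrite normr_gt0; move: uE; rewrite unitmxE unitfE.
move=> f bf; rewrite (int_cell_frame nK fr)//.
by rewrite (cell_frame fr); apply/(bmeas_affine_image _ _ uE).
Qed.

(** Measurability is asked of the pullback only, through the parametrisation used by [int_face]. *)
Definition face_adm e (g : 'rV[R]_n.+1 -> R) :=
  bmeas (@ref_simplex R n) (fun t => g (face_pt e 0 + t *m face_dir e)).

Lemma face_enum_frame e b0 : b0 \in e -> #|e| = n.+1 ->
  let vt i := nth b0 (enum e) i in
  [/\ frame e (vt 0%N) (fun i : 'I_n => vt i.+1), face_pt e 0 = pos (vt 0%N) &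
      face_dir e = frame_mx pos (vt 0%N) (fun i : 'I_n => vt i.+1)].
Proof.
move=> b0e ce vt; have sz : size (enum e) = n.+1 by rewrite -cardE.
have fp i : (i < n.+1)%N -> face_pt e i = pos (vt i).
  by move=> ni; rewrite /face_pt (nth_map b0)// sz.
have inj i j : (i < n.+1)%N -> (j < n.+1)%N -> vt i = vt j -> i = j.
  by move=> ni nj /eqP; rewrite nth_uniq ?sz ?enum_uniq// => /eqP.
have vte i : (i < n.+1)%N -> vt i \in e by move=> ni; rewrite -mem_enum mem_nth// sz.
split; [split=> //|exact: fp|].
- exact: vte.
- by move=> i j /inj; rewrite !ltnS => /(_ (ltn_ord i) (ltn_ord j)) [] /val_inj.
- move=> i; rewrite in_setD1 vte ?ltnS ?ltn_ord// andbT; apply/eqP => /inj.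
  by rewrite !ltnS ltn_ord => /(_ isT isT).
- apply/matrixP => i j; rewrite /face_dir !mxE !fp//.
  by rewrite ltnS; exact: (ltn_ord i).
Qed.

(** [int_face] takes the vertices in the order of [enum]; after at most one exchange of base vertex,
    any prescribed b can be the origin of the parametrisation. *)
Lemma face_frame e b : b \in e -> #|e| = n.+1 ->
  exists2 a : 'I_n -> vtx M, frame e b a &
    forall g, face_adm e g -> int_face e g = simplex_int (pos b) (frame_mx pos b a) g.
Proof.
move=> be ce; have [fr f0 fd] := face_enum_frame be ce.
pose vt i := nth b (enum e) i.
have {}fr : frame e (vt 0%N) (fun i : 'I_n => vt i.+1) := fr.
have canon g : int_face e g =
    simplex_int (pos (vt 0%N)) (frame_mx pos (vt 0%N) (fun i : 'I_n => vt i.+1)) g.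
  by rewrite /int_face /simplex_int f0 fd.
have ltb : (index b (enum e) < n.+1)%N.
  by have := be; rewrite -mem_enum -index_mem -cardE ce.
have vtb : vt (index b (enum e)) = b by rewrite /vt nth_index// mem_enum.
case: (index b (enum e)) ltb vtb => [_ vt0|i0' lti0 vti].
  by exists (fun i => vt i.+1); rewrite -vt0// => g _; exact: canon.
pose i0 : 'I_n := Ordinal (lti0 : (i0' < n)%N).
have {}vti : vt i0.+1 = b by [].
have [vt0e ia aS _] := fr.
exists (fun i : 'I_n => if i == i0 then vt 0%N else vt i.+1).
  split => //.
  - move=> i j; case: eqP => [->|ii]; case: eqP => [->|jj] //; last exact: ia.
      by move=> h; have := aS j; rewrite -h !inE eqxx.
    by move=> h; have := aS i; rewrite h !inE eqxx.
  - move=> i; case: eqP => [_|/eqP ii]; rewrite !inE.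
      by rewrite vt0e andbT; apply/eqP => h; have := aS i0; rewrite vti -h !inE eqxx.
    have := aS i; rewrite !inE => /andP[_ ->]; rewrite andbT -vti.
    by apply: contra ii => /eqP/ia ->.
move=> g bg.
pose E0 := frame_mx pos (vt 0%N) (fun i : 'I_n => vt i.+1).
have e1 : pos (vt 0%N) + row i0 E0 = pos b by rewrite rowK vti addrC subrK.
have e2 : swap_mx i0 *m E0 =
    frame_mx pos b (fun i : 'I_n => if i == i0 then vt 0%N else vt i.+1).
  apply/row_matrixP => i; rewrite row_mul !rowK.
  rewrite mulmx_sum_row (bigD1 i0)//= !mxE !eqxx rowK vti.
  case: eqP => [->|/eqP ii].
    rewrite big1 => [|k ki]; last by rewrite !mxE (negbTE ki) eq_sym (negbTE ki) scale0r.
    by rewrite addr0 scaleN1r opprB.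
  rewrite (bigD1 i)//= !mxE (negbTE ii) eqxx scale1r rowK big1 ?addr0 => [|k /andP[ki ki']].
    by rewrite scaleN1r opprB addrC addrA subrK.
  by rewrite !mxE (negbTE ki) eq_sym (negbTE ki') scale0r.
rewrite -e1 -e2 simplex_int_swap; first exact: canon.
by move: bg; rewrite /face_adm f0 fd.
Qed.

(** The set from which [normal] is chosen is not empty, so its default value 0 is never taken. *)
Lemma normal_spec K v : nsimplex pos K -> v \in K ->
  [/\ enorm (normal K v) = 1,
      (forall w w', w \in K :\ v -> w' \in K :\ v ->
         dotv (normal K v) (pos w - pos w') = 0) &
      forall w, w \in K :\ v -> dotv (normal K v) (pos v - pos w) < 0].
Proof.
move=> nK vK; have cF := card_face nK vK.
have [b bK] : exists b, b \in K :\ v by apply/card_gt0P; rewrite cF.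
have [a fr] := frame_exists bK cF.
have [nu [nu1 nu2 nu3]] := outward_normal nK vK fr.
pose P := [set d | [/\ enorm d = 1,
    (forall w w', w \in K :\ v -> w' \in K :\ v -> dotv d (pos w - pos w') = 0) &
    forall w, w \in K :\ v -> dotv d (pos v - pos w) < 0]].
have nub w : w \in K :\ v -> dotv nu (pos w - pos b) = 0.
  have [wb|wb] := eqVneq w b; first by rewrite wb subrr dotv0r.
  move=> wK; have : w \in K :\ v :\ b by rewrite in_setD1 wb.
  by rewrite (frame_imset fr) => /imsetP[i _ ->].
apply: (xgetPex 0 (P := P)); exists nu; split => //.
  move=> w w' wK wK'; have -> : pos w - pos w' = (pos w - pos b) - (pos w' - pos b).
    by rewrite opprB addrA subrK.
  by rewrite dotvBr !nub// subrr.
move=> w wK; have -> : pos v - pos w = (pos v - pos b) - (pos w - pos b).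
  by rewrite opprB addrA subrK.
by rewrite dotvBr (nub _ wK) subr0.
Qed.

Lemma face_gram K v b (a : 'I_n -> vtx M) : nsimplex pos K -> v \in K ->
  frame (K :\ v) b a ->
  0 < \det (frame_mx pos b a *m (frame_mx pos b a)^T) /\
  `|\det (frame_mx pos b (fun i => oapp a v (unlift ord_max i)))| =
    Num.sqrt (\det (frame_mx pos b a *m (frame_mx pos b a)^T)) *
    - dotv (pos v - pos b) (normal K v).
Proof.
move=> nK vK fr; have [nu1 nu2 nu3] := normal_spec nK vK.
have fr' := frame_extend vK fr; have uE := frame_mx_unit nK fr'.
have [E1 E2] := frame_mx_extend pos v b a.
have [bK _ aS _] := fr.
have [||] := gram_height (nu := normal K v) uE.
- move=> i; rewrite rowK liftK /=; apply: nu2 => //.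
  by have := aS i; rewrite in_setD1 => /andP[].
- by rewrite -enorm_sqr nu1 expr1n.
rewrite E1 E2 => G0 g; split => //; rewrite g ltr0_norm; last exact: nu3.
by rewrite dotvC.
Qed.

Lemma face_integration K v : nsimplex pos K -> v \in K ->
  integration (cell (K :\ v)) (face_adm (K :\ v)) (@int_face R n.+1 M (K :\ v)).
Proof.
move=> nK vK; have cF := card_face nK vK.
have [b bK] : exists b, b \in K :\ v by apply/card_gt0P; rewrite cF.
have [fr f0 fd] := face_enum_frame bK cF.
have [G0 _] := face_gram nK vK fr.
have -> : cell (K :\ v) = affine_image (face_pt (K :\ v) 0) (face_dir (K :\ v)).
  by rewrite f0 fd; exact: hull_frame.
apply: (@simplex_integration _ _ _ _ _
  (Num.sqrt (\det (face_dir (K :\ v) *m (face_dir (K :\ v))^T)))) => //.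
by rewrite fd sqrtr_gt0.
Qed.

(* Divergence theorem for the field [G d], d an edge vector from b to v: only
   the face opposite to v contributes, since G vanishes on the face opposite to
   b and all other faces are parallel to d. *)
Lemma cell_divergence K v b (G : mpoly.mpoly n.+1 R) : nsimplex pos K -> v \in K ->
  b \in K :\ v -> (forall x, cell (K :\ b) x -> peval G x = 0) ->
  int_cell K (fun x => \sum_i (pos v - pos b) 0 i * peval (mpoly.mderiv i G) x) =
  dotv (pos v - pos b) (normal K v) * int_face (K :\ v) (peval G).
Proof.
move=> nK vK bK G0; have cF := card_face nK vK.
have [a fr aE] := face_frame bK cF.
have fr' := frame_extend vK fr; have uE := frame_mx_unit nK fr'.
have [E1 E2] := frame_mx_extend pos v b a.
have [Gr gr] := face_gram nK vK fr.
have Hc := cell_integration nK; have Hf := face_integration nK vK.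
set d := pos v - pos b in E2 gr *.
set E := frame_mx pos b _ in uE E1 E2 gr.
set E' := frame_mx pos b a in E1 Gr gr aE.
have bF : bmeas (cell K) (fun x => \sum_i d 0 i * peval (mpoly.mderiv i G) x).
  by apply: bmeas_sum => i; apply: bmeasZ; exact: (adm_peval Hc).
rewrite (int_cell_frame nK fr' bF) -/E aE; last exact: (adm_peval Hf).
have [q qP] := choice (fun y : 'rV[R]_n => line_poly G (pos b + y *m E') d).
have pt y t : pos b + rV_snoc (y, t) *m E = (pos b + y *m E') + t *: d.
  by rewrite snoc_mulmx E1 E2 addrA.
have bT : bmeas (@ref_simplex R n.+1)
    (fun t => \sum_i d 0 i * peval (mpoly.mderiv i G) (pos b + t *m E)).
  by apply/(bmeas_affine_image _ (fun x => \sum_i d 0 i * peval (mpoly.mderiv i G) x) uE);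
    rewrite -(cell_frame fr').
have bG (c : 'rV[R]_n.+1) (A : 'M[R]_(n, n.+1)) :
    bmeas (@ref_simplex R n) (fun y => peval G (c + y *m A)).
  by apply: bmeas_peval => i; exact: bmeas_affine.
(* The segment in direction d from a point of the face opposite to v ends on the face opposite to b,
   at the same parameter y but with base v. There G vanishes, so only the starting point
   contributes. *)
have apex (y : 'rV[R]_n) : pos b + y *m E' + (1 - \sum_i y 0 i) *: d =
    pos v + y *m frame_mx pos v a.
  rewrite !frame_point /d scalerBr.
  by rewrite [X in X + _]addrC -addrA [X in _ + X]addrCA subrr addr0 addrC.
have J0 y : ref_simplex y -> (q y).[1 - \sum_i y 0 i] = 0.
  move=> Ty; have [-> _] := qP y (1 - \sum_i y 0 i); rewrite apex; apply: G0.
  have vb : v != b by have := bK; rewrite !inE eq_sym => /andP[].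
  have frv : frame (K :\ b) v a.
    have [_ ia aS _] := fr; split => //; first by rewrite !inE vb.
      by move=> i; have := aS i; rewrite !inE => /and3P[-> -> ->].
    by apply: (card_face nK); have := bK; rewrite !inE => /andP[].
  by rewrite /cell (hull_frame _ frv); exists y.
rewrite (@ref_simplex_ftc _ _ _ q) //; last 2 first.
- apply: (@bmeas_ext _ _ _ _ (fun y => -1 * peval G (pos b + y *m E'))); last first.
    by apply: bmeasZ; exact: bG.
  move=> y Ty; rewrite (J0 _ Ty); have [-> _] := qP y 0.
  by rewrite scale0r addr0 mulN1r sub0r.
- by move=> y t; have [_ ->] := qP y t; rewrite pt.
have -> : \int[lebesgue n]_(y in @ref_simplex R n) ((q y).[1 - \sum_i y 0 i] - (q y).[0]) =
    \int[lebesgue n]_(y in @ref_simplex R n) (-1 * peval G (pos b + y *m E') + 0).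
  apply: eq_Rintegral => y /set_mem Ty; rewrite (J0 _ Ty); have [-> _] := qP y 0.
  by rewrite scale0r addr0 mulN1r sub0r addr0.
rewrite bmeas_int_lin//; last 3 first.
- exact: measurable_ref_simplex.
- exact: ref_simplex_finite.
- exact: bmeas_cst.
rewrite gr /simplex_int Rintegral_cst ?mul0r; last exact: measurable_ref_simplex.
ring.
Qed.

End mesh_integrals.

(** * Weak differential operators *)

Section more_integration.
Context {R : realType} {n : nat} (D : set 'rV[R]_n) (N : ('rV[R]_n -> R) -> Prop).
Context (I : ('rV[R]_n -> R) -> R) (H : integration D N I).

Lemma int_lin_ext c f f1 f2 : (forall x, D x -> f x = c * f1 x + f2 x) ->
  N f1 -> N f2 -> I f = c * I f1 + I f2.
Proof.
move=> fE N1 N2; rewrite -(int_lin H)//; apply: (int_ext H fE).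
by apply: (adm_ext H _ (adm_lin H c N1 N2)) => x /fE ->.
Qed.

Lemma Pol_mul i j f g : Pol i D f -> Pol j D g -> Pol (i + j) D (fun x => f x * g x).
Proof.
move=> [p dp fp] [q dq gq]; exists (p * q); first exact: deg_leM.
by move=> x Dx; rewrite pevalM fp// gq.
Qed.

End more_integration.

(** * Polynomials that vanish on a cell *)

Section vanishing.
Context {R : realType} {n : nat} (M : mesh R n.+1).
Local Notation pos := (@pos R n.+1 M).
Local Notation mp := (mpoly.mpoly n.+1 R).
Implicit Types (K e : {set vtx M}) (v b : vtx M).

Lemma cell_sub K e : e \subset K -> cell e `<=` cell K.
Proof.
move=> eK x [t [t0 t1 ->]]; exists (fun v => if v \in e then t v else 0).
have big (W : nmodType) (F : vtx M -> W) :
    \sum_(v in K) (if v \in e then F v else 0) = \sum_(v in e) F v.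
  rewrite -big_mkcondr; apply: eq_bigl => v.
  by rewrite andb_idl// => /(fintype.subsetP eK).
split=> [v _||]; first by case: ifP => // /t0.
  by rewrite big.
rewrite -big; apply: eq_bigr => v _; case: ifP => // _.
by rewrite scale0r.
Qed.

Lemma cell_convex K x y (s : R) : 0 <= s <= 1 -> cell K x -> cell K y ->
  cell K (x + s *: (y - x)).
Proof.
move=> /andP[s0 s1] [t [t0 t1 ->]] [u [u0 u1 ->]].
exists (fun v => t v + s * (u v - t v)); split.
- move=> v vK; have -> : t v + s * (u v - t v) = (1 - s) * t v + s * u v by ring.
  by rewrite addr_ge0// mulr_ge0 ?subr_ge0 ?t0 ?u0.
- by rewrite big_split/= -mulr_sumr sumrB t1 u1 subrr mulr0 addr0.
- rewrite -sumrB scaler_sumr -big_split; apply: eq_bigr => v _ /=.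
  by rewrite scalerDl -scalerA scalerBl.
Qed.

Lemma vertex_in_cell K v : v \in K -> cell K (pos v).
Proof.
move=> vK; exists (fun u => (u == v)%:R); split.
- by move=> u _; exact: ler0n.
- by rewrite (bigD1 v)//= eqxx big1 ?addr0// => u /andP[_ /negbTE ->].
- rewrite (bigD1 v)//= eqxx scale1r big1 ?addr0// => u /andP[_ /negbTE ->].
  by rewrite scale0r.
Qed.

(** By convexity p vanishes along the segment from x to any point of the cell, hence so does its
    derivative in that direction; differences of such directions are the edges, which span the
    space. *)
Lemma mderiv_vanish K (p : mp) : nsimplex pos K ->
  (forall x, cell K x -> peval p x = 0) ->
  forall i x, cell K x -> peval (mpoly.mderiv i p) x = 0.
Proof.
move=> nK p0 i x Kx; have [cK _] := nK.
have [b bK] : exists b, b \in K by apply/card_gt0P; rewrite cK.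
have [a fr] := frame_exists bK cK; have uE := frame_mx_unit nK fr.
pose g : 'cV[R]_n.+1 := \col_i peval (mpoly.mderiv i p) x.
have dir y : cell K y -> (y - x) *m g = 0.
  move=> Ky; have [q qP] := line_poly p x (y - x).
  have q0 : q = 0.
    apply: poly_zero_itv => t t01; have [-> _] := qP t; apply: p0.
    exact: cell_convex.
  have [_] := qP 0; rewrite q0 deriv0 horner0 scale0r addr0 => /esym e.
  apply/rowP => j; rewrite !mxE -[RHS]e; apply: eq_bigr => l _.
  by rewrite !mxE.
have Eg : frame_mx pos b a *m g = 0.
  apply/row_matrixP => j; rewrite row_mul rowK row0.
  have -> : pos (a j) - pos b = (pos (a j) - x) - (pos b - x) by rewrite opprB addrA subrK.
  rewrite mulmxBl !dir ?subrr//; first exact: vertex_in_cell.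
  by apply: vertex_in_cell; have [_ _ /(_ j)] := fr; rewrite in_setD1 => /andP[].
have g0 : g = 0 by rewrite -(mulKmx uE g) Eg mulmx0.
by have := congr1 (fun A : 'cV[R]_n.+1 => A i 0) g0; rewrite !mxE.
Qed.

(** Induction on the degree: the derivatives also vanish on the cell, so they are zero and p is
    constant. *)
Lemma mpoly_vanish K (p : mp) : nsimplex pos K ->
  (forall x, cell K x -> peval p x = 0) -> p = 0.
Proof.
move=> nK; have [cK _] := nK.
have [b bK] : exists b, b \in K by apply/card_gt0P; rewrite cK.
have [N] : exists N, deg_le N p by exists (mpoly.mmeasure mpoly.mdeg p); rewrite /deg_le.
elim: N p => [|N IH] p dp p0.
  have pE := mpoly.msize1_polyC dp.
  by move: (p0 _ (vertex_in_cell bK)); rewrite pE [peval _ _]pevalC => ->;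
    rewrite mpoly.mpolyC0.
have dp0 i : mpoly.mderiv i p = 0.
  by apply: IH; [exact: deg_le_mderiv|exact: mderiv_vanish].
rewrite (mderiv_eq0 dp0 (p0 _ (vertex_in_cell bK))).
exact: mpoly.mpolyC0.
Qed.

End vanishing.

Section weak_operators.
Context {R : realType} {n : nat} {M : mesh R n.+1}.
Local Notation pos := (@pos R n.+1 M).
Local Notation pt := 'rV[R]_n.+1.
Local Notation mp := (mpoly.mpoly n.+1 R).
Variables (K : {set vtx M}) (nK : nsimplex pos K).

Let HK := cell_integration nK.
Let HF v (vK : v \in K) := face_integration nK vK.

Definition wregular (q : wfun M R) :=
  bmeas (cell K) (q.1 K) /\ forall v, v \in K -> face_adm (K :\ v) (q.2 (K :\ v)).

(** Linearity is a relation between values on the cell and its faces, the only values on which the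
    weak operators depend; off these sets q is arbitrary. *)
Definition wcombination (c : R) (q q1 q2 : wfun M R) :=
  (forall x, cell K x -> q.1 K x = c * q1.1 K x + q2.1 K x) /\
  forall v, v \in K -> forall x, cell (K :\ v) x ->
    q.2 (K :\ v) x = c * q1.2 (K :\ v) x + q2.2 (K :\ v) x.

Lemma peval_adm_cell (p : mp) : bmeas (cell K) (peval p).
Proof. exact: (adm_peval HK). Qed.

Lemma peval_adm_face v (p : mp) : v \in K -> face_adm (K :\ v) (peval p).
Proof. by move=> vK; exact: (adm_peval (HF vK)). Qed.

Definition wgrad_rhs (q : wfun M R) (s : 'I_n.+1 -> mp) : R :=
  - int_cell K (fun x => q.1 K x * Defs.pdiv s x) +
  \sum_(v in K) int_face (K :\ v)
    (fun x => q.2 (K :\ v) x * dotv (pvec s x) (normal K v)).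

Lemma pdiv_adm (s : 'I_n.+1 -> mp) : bmeas (cell K) (Defs.pdiv s).
Proof. by apply: (adm_sum HK) => i; exact: peval_adm_cell. Qed.

Lemma pvec_adm v (s : 'I_n.+1 -> mp) : v \in K ->
  face_adm (K :\ v) (fun x => dotv (pvec s x) (normal K v)).
Proof.
move=> vK; apply: (adm_ext (HF vK) (f := fun x => \sum_i normal K v 0 i * peval (s i) x)).
  by move=> x _; apply: eq_bigr => i _; rewrite mxE mulrC.
by apply: (adm_sum (HF vK)) => i; apply: (admZ (HF vK)); exact: peval_adm_face.
Qed.

Lemma wgrad_rhs_lin c q q1 q2 s : wregular q1 -> wregular q2 ->
  wcombination c q q1 q2 ->
  wgrad_rhs q s = c * wgrad_rhs q1 s + wgrad_rhs q2 s.
Proof.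
move=> [b1 f1] [b2 f2] [e1 e2]; rewrite /wgrad_rhs.
rewrite (int_lin_ext HK (c := c) (f1 := fun x => q1.1 K x * Defs.pdiv s x)
   (f2 := fun x => q2.1 K x * Defs.pdiv s x)); last 3 first.
- by move=> x /e1 ->; rewrite mulrDl mulrA.
- exact: (adm_mul HK b1 (pdiv_adm s)).
- exact: (adm_mul HK b2 (pdiv_adm s)).
rewrite (eq_bigr (fun v => c * int_face (K :\ v)
     (fun x => q1.2 (K :\ v) x * dotv (pvec s x) (normal K v)) + int_face (K :\ v)
     (fun x => q2.2 (K :\ v) x * dotv (pvec s x) (normal K v)))) => [|v vK].
  by rewrite big_split/= -mulr_sumr; ring.
apply: (int_lin_ext (HF vK)) => [x /(e2 _ vK) ->||].
- by rewrite mulrDl mulrA.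
- exact: (adm_mul (HF vK) (f1 _ vK) (pvec_adm s vK)).
- exact: (adm_mul (HF vK) (f2 _ vK) (pvec_adm s vK)).
Qed.

(** Splits a test field into fields with a single component, so that the weak gradient can be built
    componentwise by the scalar Riesz lemma. *)
Lemma wgrad_rhs_sum q (s : 'I_n.+1 -> mp) : wregular q ->
  wgrad_rhs q s = \sum_i wgrad_rhs q (fun k => if k == i then s i else 0).
Proof.
move=> [b f]; rewrite /wgrad_rhs big_split/= sumrN exchange_big/=; congr (- _ + _).
  have e i x : Defs.pdiv (fun k => if k == i then s i else 0) x = peval (mpoly.mderiv i (s i)) x.
    rewrite /Defs.pdiv (bigD1 i)//= eqxx big1 ?addr0// => k /negbTE ->.
    by rewrite mpoly.mderiv0 peval0.
  rewrite -(int_sum HK); last by move=> i; exact: (adm_mul HK b (pdiv_adm _)).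
  apply: (int_ext HK) => [x _|]; last exact: (adm_mul HK b (pdiv_adm _)).
  by rewrite /Defs.pdiv mulr_sumr; apply: eq_bigr => i _; rewrite -e.
apply: eq_bigr => v vK.
have e i x : dotv (pvec (fun k => if k == i then s i else 0) x) (normal K v) =
    peval (s i) x * normal K v 0 i.
  rewrite /dotv (bigD1 i)//= mxE eqxx big1 ?addr0// => k /negbTE ki.
  by rewrite mxE ki peval0 mul0r.
rewrite -(int_sum (HF vK)); last by move=> i; exact: (adm_mul (HF vK) (f _ vK) (pvec_adm _ vK)).
apply: (int_ext (HF vK)) => [x _|]; last exact: (adm_mul (HF vK) (f _ vK) (pvec_adm _ vK)).
rewrite [X in _ * X]/dotv mulr_sumr; apply: eq_bigr => i _.
by rewrite e mxE.
Qed.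

Lemma wgrad_rhs_lins q i c (p1 p2 : mp) : wregular q ->
  wgrad_rhs q (fun k => if k == i then c *: p1 + p2 else 0) =
  c * wgrad_rhs q (fun k => if k == i then p1 else 0) +
  wgrad_rhs q (fun k => if k == i then p2 else 0).
Proof.
move=> [b f]; rewrite /wgrad_rhs.
rewrite (int_lin_ext HK (c := c)
   (f1 := fun x => q.1 K x * Defs.pdiv (fun k => if k == i then p1 else 0) x)
   (f2 := fun x => q.1 K x * Defs.pdiv (fun k => if k == i then p2 else 0) x)); last 3 first.
- move=> x _; rewrite mulrCA -mulrDr; congr (_ * _).
  rewrite /Defs.pdiv mulr_sumr -big_split/=; apply: eq_bigr => k _.
  by case: ifP => _; rewrite ?mpoly.mderiv0 ?peval0 ?mulr0 ?addr0// mpoly.mderivD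
    mpoly.mderivZ pevalD pevalZ.
- exact: (adm_mul HK b (pdiv_adm _)).
- exact: (adm_mul HK b (pdiv_adm _)).
rewrite (eq_bigr (fun v => c * int_face (K :\ v)
     (fun x => q.2 (K :\ v) x * dotv (pvec (fun k => if k == i then p1 else 0) x) (normal K v)) +
   int_face (K :\ v)
     (fun x => q.2 (K :\ v) x * dotv (pvec (fun k => if k == i then p2 else 0) x) (normal K v))))
  => [|v vK].
  by rewrite big_split/= -mulr_sumr; ring.
apply: (int_lin_ext (HF vK)) => [x _||].
- rewrite mulrCA -mulrDr; congr (_ * _).
  rewrite /dotv mulr_sumr -big_split/=; apply: eq_bigr => k _; rewrite !mxE.
  by case: ifP => _; rewrite ?peval0 ?mul0r ?mulr0 ?addr0// pevalD pevalZ; ring.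
- exact: (adm_mul (HF vK) (f _ vK) (pvec_adm _ vK)).
- exact: (adm_mul (HF vK) (f _ vK) (pvec_adm _ vK)).
Qed.

(** Existence is what is at stake, so that the choice made by [wgrad] is not its default. Each
    component is the Riesz representer of a functional on polynomials; the side condition holds
    because a polynomial vanishing on a nondegenerate cell is zero. *)
Lemma wgrad_spec j q : wregular q ->
  (forall i, Pol j (cell K) (fun x => wgrad j q K x 0 i)) /\
  forall s, (forall i, deg_le j (s i)) ->
    int_cell K (fun x => dotv (wgrad j q K x) (pvec s x)) = wgrad_rhs q s.
Proof.
move=> rq.
pose P := [set g : pt -> pt | (forall i, Pol j (cell K) (fun x => g x 0 i)) /\
    forall s : 'I_n.+1 -> mp, (forall i, deg_le j (s i)) ->
      int_cell K (fun x => dotv (g x) (pvec s x)) = wgrad_rhs q s].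
suff [g Pg] : exists g, P g by exact: (xgetPex (cst 0) (ex_intro P g Pg)).
pose L i (p : mp) := wgrad_rhs q (fun k => if k == i then p else 0).
have exG i : exists g, deg_le j g /\
    forall s, deg_le j s -> int_cell K (fun x => peval g x * peval s x) = L i s.
  have [||g dg gP] := @riesz_Pol _ _ _ _ _ HK j (L i); last by exists g.
  - by move=> c p1 p2 _ _; exact: wgrad_rhs_lins.
  - move=> p _ p0; have -> : p = 0 :> mp by exact: (mpoly_vanish nK).
    have := wgrad_rhs_lins i 0 0 0 rq; rewrite scale0r addr0 mul0r add0r.
    have := wgrad_rhs_lins i 1 0 0 rq; rewrite scale1r addr0 mul1r.
    by rewrite /L; set w := wgrad_rhs _ _; lra.
have [G GP] := choice exG.
exists (fun x => \row_i peval (G i) x); split.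
  by move=> i; exists (G i); [case: (GP i)|move=> x _; rewrite mxE].
move=> s ds; rewrite wgrad_rhs_sum//.
have Ns i : bmeas (cell K) (fun x => peval (G i) x * peval (s i) x).
  by apply: (adm_mul HK); exact: peval_adm_cell.
rewrite (eq_bigr (fun i => int_cell K (fun x => peval (G i) x * peval (s i) x))) => [|i _].
  rewrite -(int_sum HK)//; congr int_cell; apply/funext => x.
  by apply: eq_bigr => i _; rewrite !mxE.
by have [_ ->] := GP i.
Qed.

Lemma wgrad_unique j q (g : pt -> pt) : wregular q ->
  (forall i, Pol j (cell K) (fun x => g x 0 i)) ->
  (forall s, (forall i, deg_le j (s i)) ->
    int_cell K (fun x => dotv (g x) (pvec s x)) = wgrad_rhs q s) ->
  forall x, cell K x -> wgrad j q K x = g x.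
Proof.
move=> rq Pg gP x Kx; have [Pw wP] := wgrad_spec j rq; apply/rowP => i.
apply: (Pol_orthogonal HK (Pw i) (Pg i) _ Kx) => s ds.
have e (u : pt -> pt) : (fun x => u x 0 i * peval s x) =
    (fun x => dotv (u x) (pvec (fun k => if k == i then s else 0) x)).
  apply/funext => y; rewrite /dotv (bigD1 i)//= mxE eqxx big1 ?addr0// => k /negbTE ki.
  by rewrite mxE ki peval0 mulr0.
have dk k : deg_le j (if k == i then s else 0) by case: ifP => // _; exact: deg_le0.
by rewrite !e wP// gP.
Qed.

Lemma wgrad_lin j c q q1 q2 : wregular q -> wregular q1 -> wregular q2 ->
  wcombination c q q1 q2 ->
  forall x, cell K x -> wgrad j q K x = c *: wgrad j q1 K x + wgrad j q2 K x.
Proof.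
move=> rq r1 r2 eq; have [P1 S1] := wgrad_spec j r1; have [P2 S2] := wgrad_spec j r2.
apply: wgrad_unique => //.
  move=> i; have [p dp pP] := Pol_lin c (P1 i) (P2 i); exists p => // x /pP <-.
  by rewrite !mxE.
have dN (u : pt -> pt) s : (forall i, Pol j (cell K) (fun x => u x 0 i)) ->
    bmeas (cell K) (fun x => dotv (u x) (pvec s x)).
  move=> Pu; apply: (adm_sum HK) => i; apply: (adm_mul HK); first exact: (Pol_adm HK (Pu i)).
  by apply: (adm_ext HK _ (peval_adm_cell (s i))) => x _; rewrite mxE.
move=> s ds; rewrite (wgrad_rhs_lin s r1 r2 eq) -S1// -S2//.
apply: (int_lin_ext HK) => [x _||]; [|exact: dN|exact: dN].
by rewrite dotvDl dotvZl.
Qed.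

Definition wdiv_rhs (w : wfun M pt) (s : mp) : R :=
  - int_cell K (fun x => dotv (w.1 K x) (pgrad s x)) +
  \sum_(v in K) int_face (K :\ v)
    (fun x => dotv (w.2 (K :\ v) x) (normal K v) * peval s x).

Definition vregular (w : wfun M pt) := forall i, wregular (wcomp w i).

Definition vcombination (c : R) (w w1 w2 : wfun M pt) :=
  forall i, wcombination c (wcomp w i) (wcomp w1 i) (wcomp w2 i).

Lemma dotv_pgrad_adm w s : vregular w -> bmeas (cell K) (fun x => dotv (w.1 K x) (pgrad s x)).
Proof.
move=> rw; apply: (adm_sum HK) => i; apply: (adm_mul HK); first by case: (rw i).
by apply: (adm_ext HK _ (peval_adm_cell (mpoly.mderiv i s))) => x _; rewrite mxE.
Qed.

Lemma dotv_normal_adm w v s : vregular w -> v \in K ->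
  face_adm (K :\ v) (fun x => dotv (w.2 (K :\ v) x) (normal K v) * peval s x).
Proof.
move=> rw vK; apply: (adm_mul (HF vK)); last exact: peval_adm_face.
apply: (adm_ext (HF vK) (f := fun x => \sum_i normal K v 0 i * w.2 (K :\ v) x 0 i)).
  by move=> x _; apply: eq_bigr => i _; rewrite mulrC.
apply: (adm_sum (HF vK)) => i; apply: (admZ (HF vK)).
by case: (rw i) => _; exact.
Qed.

Lemma vcombinationE c w w1 w2 : vcombination c w w1 w2 ->
  (forall x, cell K x -> w.1 K x = c *: w1.1 K x + w2.1 K x) /\
  forall v, v \in K -> forall x, cell (K :\ v) x ->
    w.2 (K :\ v) x = c *: w1.2 (K :\ v) x + w2.2 (K :\ v) x.
Proof.
move=> h; split=> [x Kx|v vK x Kx]; apply/rowP => i; rewrite !mxE.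
  by case: (h i) => /(_ x Kx).
by case: (h i) => _ /(_ v vK x Kx).
Qed.

Lemma wdiv_rhs_lin c w w1 w2 s : vregular w1 -> vregular w2 -> vcombination c w w1 w2 ->
  wdiv_rhs w s = c * wdiv_rhs w1 s + wdiv_rhs w2 s.
Proof.
move=> r1 r2 /vcombinationE[e1 e2]; rewrite /wdiv_rhs.
rewrite (int_lin_ext HK (c := c) (f1 := fun x => dotv (w1.1 K x) (pgrad s x))
   (f2 := fun x => dotv (w2.1 K x) (pgrad s x))); last 3 first.
- by move=> x /e1 ->; rewrite dotvDl dotvZl.
- exact: dotv_pgrad_adm.
- exact: dotv_pgrad_adm.
rewrite (eq_bigr (fun v => c * int_face (K :\ v)
     (fun x => dotv (w1.2 (K :\ v) x) (normal K v) * peval s x) + int_face (K :\ v)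
     (fun x => dotv (w2.2 (K :\ v) x) (normal K v) * peval s x))) => [|v vK].
  by rewrite big_split/= -mulr_sumr; ring.
apply: (int_lin_ext (HF vK)) => [x /(e2 _ vK) ->||].
- by rewrite dotvDl dotvZl; ring.
- exact: dotv_normal_adm.
- exact: dotv_normal_adm.
Qed.

Lemma wdiv_rhs_lins w : vregular w ->
  linear_on (fun p : mp => True) (wdiv_rhs w).
Proof.
move=> rw c p1 p2 _ _; rewrite /wdiv_rhs.
rewrite (int_lin_ext HK (c := c) (f1 := fun x => dotv (w.1 K x) (pgrad p1 x))
   (f2 := fun x => dotv (w.1 K x) (pgrad p2 x))); last 3 first.
- move=> x _; rewrite -dotvZr -dotvDr; congr dotv; apply/rowP => i; rewrite !mxE.
  by rewrite mpoly.mderivD mpoly.mderivZ pevalD pevalZ.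
- exact: dotv_pgrad_adm.
- exact: dotv_pgrad_adm.
rewrite (eq_bigr (fun v => c * int_face (K :\ v)
     (fun x => dotv (w.2 (K :\ v) x) (normal K v) * peval p1 x) + int_face (K :\ v)
     (fun x => dotv (w.2 (K :\ v) x) (normal K v) * peval p2 x))) => [|v vK].
  by rewrite big_split/= -mulr_sumr; ring.
apply: (int_lin_ext (HF vK)) => [x _||].
- by rewrite pevalD pevalZ; ring.
- exact: dotv_normal_adm.
- exact: dotv_normal_adm.
Qed.

Lemma wdiv_spec j w : vregular w ->
  Pol j (cell K) (wdiv j w K) /\
  forall s, deg_le j s ->
    int_cell K (fun x => wdiv j w K x * peval s x) = wdiv_rhs w s.
Proof.
move=> rw.
pose P := [set g : pt -> R | Pol j (cell K) g /\
    forall s : mp, deg_le j s ->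
      int_cell K (fun x => g x * peval s x) = wdiv_rhs w s].
suff [g Pg] : exists g, P g by exact: (xgetPex (cst 0) (ex_intro P g Pg)).
have lw := wdiv_rhs_lins rw.
have [||g dg gP] := @riesz_Pol _ _ _ _ _ HK j (wdiv_rhs w).
- by move=> c p1 p2 _ _; exact: lw.
- move=> p _ p0; have -> : p = 0 :> mp by exact: (mpoly_vanish nK).
  by apply: (linear_on0 _ lw); split.
- by exists (peval g); split=> //; exists g.
Qed.

Lemma wdiv_lin j c w w1 w2 : vregular w -> vregular w1 -> vregular w2 ->
  vcombination c w w1 w2 ->
  forall x, cell K x -> wdiv j w K x = c * wdiv j w1 K x + wdiv j w2 K x.
Proof.
move=> rw r1 r2 eq; have [P1 S1] := wdiv_spec j r1; have [P2 S2] := wdiv_spec j r2.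
have [P0 S0] := wdiv_spec j rw.
apply: (Pol_orthogonal HK P0 (Pol_lin c P1 P2)) => s ds.
rewrite S0// (wdiv_rhs_lin s r1 r2 eq) -S1// -S2//; apply/esym.
have Ns g : Pol j (cell K) g -> bmeas (cell K) (fun x => g x * peval s x).
  by move=> Pg; apply: (adm_mul HK (Pol_adm HK Pg)); exact: peval_adm_cell.
apply: (int_lin_ext HK) => [x _||]; [by ring|exact: Ns|exact: Ns].
Qed.

Lemma face_proj_spec k v (g : pt -> R) : v \in K -> face_adm (K :\ v) g ->
  Pol k (cell (K :\ v)) (face_proj k (K :\ v) g) /\
  forall s : mp, deg_le k s ->
    int_face (K :\ v) (fun x => face_proj k (K :\ v) g x * peval s x) =
    int_face (K :\ v) (fun x => g x * peval s x).
Proof.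
move=> vK ag; have H := HF vK.
pose P := [set p : pt -> R | Pol k (cell (K :\ v)) p /\
    forall s : mp, deg_le k s ->
      int_face (K :\ v) (fun x => p x * peval s x) =
      int_face (K :\ v) (fun x => g x * peval s x)].
suff [p Pp] : exists p, P p by exact: (xgetPex (cst 0) (ex_intro P p Pp)).
have Ns s : face_adm (K :\ v) (fun x => g x * peval s x).
  by apply: (adm_mul H ag); exact: peval_adm_face.
have [||p dp pP] := @riesz_Pol _ _ _ _ _ H k
    (fun s => int_face (K :\ v) (fun x => g x * peval s x)).
- move=> c p1 p2 _ _; apply: (int_lin_ext H) => [x _||]; [|exact: Ns|exact: Ns].
  by rewrite pevalD pevalZ; ring.
- move=> p _ p0; rewrite -[RHS](int_cst0 H); apply: (int_ext H); last exact: Ns.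
  by move=> x /p0 ->; rewrite mulr0.
- by exists (peval p); split=> //; exists p.
Qed.

Lemma face_proj_lin k v c (g g1 g2 : pt -> R) : v \in K ->
  face_adm (K :\ v) g1 -> face_adm (K :\ v) g2 ->
  (forall x, cell (K :\ v) x -> g x = c * g1 x + g2 x) ->
  forall x, cell (K :\ v) x ->
    face_proj k (K :\ v) g x = c * face_proj k (K :\ v) g1 x + face_proj k (K :\ v) g2 x.
Proof.
move=> vK a1 a2 gE; have H := HF vK.
have ag : face_adm (K :\ v) g.
  by apply: (adm_ext H _ (adm_lin H c a1 a2)) => x /gE ->.
have [P0 S0] := face_proj_spec k vK ag.
have [P1 S1] := face_proj_spec k vK a1; have [P2 S2] := face_proj_spec k vK a2.
apply: (Pol_orthogonal H P0 (Pol_lin c P1 P2)) => s ds; rewrite S0//.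
have Np := peval_adm_face s vK.
rewrite (int_lin_ext H (c := c) (f1 := fun x => g1 x * peval s x)
  (f2 := fun x => g2 x * peval s x)); last 3 first.
- by move=> x /gE ->; ring.
- exact: (adm_mul H a1 Np).
- exact: (adm_mul H a2 Np).
rewrite -S1// -S2//; apply/esym.
apply: (int_lin_ext H) => [x _||]; first by ring.
- exact: (adm_mul H (Pol_adm H P1) Np).
- exact: (adm_mul H (Pol_adm H P2) Np).
Qed.

End weak_operators.

Section barycentric.
Context {R : realType} {n : nat} {M : mesh R n.+1}.
Local Notation pos := (@pos R n.+1 M).
Local Notation mp := (mpoly.mpoly n.+1 R).
Implicit Types (K e : {set vtx M}) (u v b : vtx M).

Record barycentric K (lam : vtx M -> mp) : Prop := {
  bary_deg : forall u, deg_le 1 (lam u);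
  bary_sum : forall x, \sum_(u in K) peval (lam u) x = 1;
  bary_point : forall x, \sum_(u in K) peval (lam u) x *: pos u = x;
  bary_coef : forall t : vtx M -> R, \sum_(u in K) t u = 1 ->
    forall u, u \in K -> peval (lam u) (\sum_(w in K) t w *: pos w) = t u }.

Lemma barycentricP K : nsimplex pos K -> exists lam, barycentric K lam.
Proof.
move=> nK; have [lam [dl lamE]] := barycentric_exists nK; exists lam.
have [cK _] := nK.
have [b bK] : exists b, b \in K by apply/card_gt0P; rewrite cK.
have [a fr] := frame_exists bK cK; have uE := frame_mx_unit nK fr.
have coef x : exists t : vtx M -> R, \sum_(u in K) t u = 1 /\
    \sum_(w in K) t w *: pos w = x.
  pose s : 'rV[R]_n.+1 := (x - pos b) *m invmx (frame_mx pos b a).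
  have xE : x = pos b + s *m frame_mx pos b a by rewrite mulmxKV// addrC subrK.
  pose t v := if v == b then 1 - \sum_i s 0 i else \sum_(i | a i == v) s 0 i.
  have [_ ia aS _] := fr.
  have tb : t b = 1 - \sum_i s 0 i by rewrite /t eqxx.
  have ta k : t (a k) = s 0 k.
    rewrite /t; have := aS k; rewrite in_setD1 => /andP[/negbTE -> _].
    by rewrite (bigD1 k)//= big1 ?addr0// => j /andP[/eqP/ia -> /eqP//].
  exists t; split; first by rewrite (big_frame _ fr) tb (eq_bigr _ (fun i _ => ta i)) subrK.
  rewrite xE frame_point (big_frame _ fr) tb; congr (_ + _).
  by apply: eq_bigr => i _; rewrite ta.
split=> // x; have [t [t1 tx]] := coef x.
  by rewrite -t1; apply: eq_bigr => u uK; rewrite -tx lamE.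
by rewrite -[RHS]tx; apply: eq_bigr => u uK; rewrite -{1}tx lamE.
Qed.

Section properties.
Variables (K : {set vtx M}) (lam : vtx M -> mp) (bl : barycentric K lam).

Lemma bary_vertex u : u \in K -> peval (lam u) (pos u) = 1.
Proof.
move=> uK; have -> : pos u = \sum_(w in K) (w == u)%:R *: pos w.
  rewrite (bigD1 u)//= eqxx scale1r big1 ?addr0// => w /andP[_ /negbTE ->].
  by rewrite scale0r.
rewrite (bary_coef bl) ?eqxx// (bigD1 u)//= eqxx big1 ?addr0// => w /andP[_ /negbTE ->//].
Qed.

Lemma cellE x : cell K x <-> forall u, u \in K -> 0 <= peval (lam u) x.
Proof.
split=> [[t [t0 t1 ->]] u uK|h]; first by rewrite (bary_coef bl)// t0.
by exists (fun u => peval (lam u) x); split; rewrite ?(bary_sum bl) ?(bary_point bl).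
Qed.

Lemma bary_face u x : u \in K -> cell (K :\ u) x -> peval (lam u) x = 0.
Proof.
move=> uK [t [t0 t1 ->]].
pose t' w := if w == u then 0 else t w.
have e (W : nmodType) (F : vtx M -> W) : F u = 0 ->
    \sum_(w in K) F w = \sum_(w in K :\ u) F w.
  by move=> Fu; rewrite (big_setD1 u)//= Fu add0r.
have -> : \sum_(v in K :\ u) t v *: pos v = \sum_(v in K) t' v *: pos v.
  rewrite e; last by rewrite /t' eqxx scale0r.
  by apply: eq_bigr => w; rewrite !inE /t' => /andP[/negbTE -> _].
rewrite (bary_coef bl)// ?/t' ?eqxx//.
rewrite -t1 e ?eqxx//; apply: eq_bigr => w; rewrite !inE => /andP[/negbTE -> //].
Qed.

Lemma bary_face_sum u x : u \in K -> cell (K :\ u) x ->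
  \sum_(w in K :\ u) peval (lam w) x = 1 /\
  \sum_(w in K :\ u) peval (lam w) x *: pos w = x.
Proof.
move=> uK Fx; have l0 := bary_face uK Fx.
have := bary_sum bl x; rewrite (big_setD1 u uK) /= l0 add0r => s1.
by have := bary_point bl x; rewrite (big_setD1 u uK) /= l0 scale0r add0r.
Qed.

Lemma bary_neq0 u : u \in K -> lam u != 0.
Proof.
by move=> uK; apply/eqP => l0; have := bary_vertex uK; rewrite l0 peval0 => /eqP;
  rewrite eq_sym oner_eq0.
Qed.

End properties.

Lemma closed_cell K : nsimplex pos K -> closed (cell K).
Proof.
move=> nK; have [lam bl] := barycentricP nK.
have -> : cell K = \bigcap_(u in [set` K]) (peval (lam u) @^-1` [set y | 0 <= y]).
  by apply/seteqP; split => x /(cellE bl).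
apply: closed_bigI => u _; apply: closed_comp; last exact: closed_ge.
move=> x _; apply: (continuous_peval (f := id)) => i; exact: coord_continuous.
Qed.

End barycentric.

(** * Kernel of the weak gradient *)

Section weak_gradient_kernel.
Context {R : realType} {n : nat} {M : mesh R n.+1}.
Local Notation pos := (@pos R n.+1 M).
Local Notation pt := 'rV[R]_n.+1.
Local Notation mp := (mpoly.mpoly n.+1 R).
Variables (K : {set vtx M}) (nK : nsimplex pos K).
Variables (m : nat) (m0 : (0 < m)%N) (q : wfun M R).
Hypothesis (Pq : Pol m.-1 (cell K) (q.1 K)).
Hypothesis (Pqf : forall v, v \in K -> Pol m (cell (K :\ v)) (q.2 (K :\ v))).
Hypothesis (q0 : forall x, cell K x -> wgrad m q K x = 0).

Let HK := cell_integration nK.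
Let HF v (vK : v \in K) := face_integration nK vK.

Let rq : wregular K q.
Proof.
by split=> [|v vK]; [exact: (Pol_adm HK Pq)|exact: (Pol_adm (HF vK) (Pqf vK))].
Qed.

Let rhs0 (s : 'I_n.+1 -> mp) : (forall i, deg_le m (s i)) -> wgrad_rhs K q s = 0.
Proof.
move=> ds; have [_ <-//] := wgrad_spec nK m rq; rewrite -[RHS](int_cst0 HK).
apply/esym/(int_ext HK); last exact: (adm_cst HK).
by move=> x Kx; rewrite q0// dotv0l.
Qed.

(* The test field [G (pos v - pos b)], G vanishing on the face opposite to b. *)
Let edge_field (v b : vtx M) (G : mp) i := (pos v - pos b) 0 i *: G.

(** Only the face opposite to v survives: on the face opposite to b the factor G is zero, and every
    other face contains both v and b, so its normal is orthogonal to the edge. *)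
Let edge_test v b (G : mp) : v \in K -> b \in K :\ v -> deg_le m G ->
  (forall x, cell (K :\ b) x -> peval G x = 0) ->
  int_cell K (fun x => q.1 K x * Defs.pdiv (edge_field v b G) x) =
  dotv (pos v - pos b) (normal K v) *
    int_face (K :\ v) (fun x => q.2 (K :\ v) x * peval G x).
Proof.
move=> vK bK dG G0; have [bv bK'] := setD1P bK.
have := rhs0 (s := edge_field v b G); rewrite /wgrad_rhs => /(_ _) h.
have {}h := h (fun i => deg_leZ _ dG).
have dE u x : dotv (pvec (edge_field v b G) x) (normal K u) =
    dotv (pos v - pos b) (normal K u) * peval G x.
  by rewrite mulr_suml; apply: eq_bigr => i _; rewrite mxE pevalZ; ring.
have NG u (uK : u \in K) : face_adm (K :\ u) (fun x => q.2 (K :\ u) x * peval G x).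
  by apply: (adm_mul (HF uK)); [exact: rq.2|exact: peval_adm_face].
have fE u : u \in K -> int_face (K :\ u)
    (fun x => q.2 (K :\ u) x * dotv (pvec (edge_field v b G) x) (normal K u)) =
    dotv (pos v - pos b) (normal K u) *
      int_face (K :\ u) (fun x => q.2 (K :\ u) x * peval G x).
  move=> uK; rewrite -(intZ (HF uK))//; last exact: NG.
  by congr int_face; apply/funext => x; rewrite dE; ring.
move: h; rewrite (bigD1 v)//= fE// big1 => [|u /andP[uK uv]].
  by rewrite addr0 addrC => /eqP; rewrite subr_eq0 => /eqP.
rewrite fE//; have [ub|ub] := eqVneq u b.
  suff -> : int_face (K :\ u) (fun x => q.2 (K :\ u) x * peval G x) = 0 by rewrite mulr0.
  rewrite -[RHS](int_cst0 (HF uK)); apply/esym/(int_ext (HF uK)); last exact: (adm_cst (HF uK)).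
  by move=> x; rewrite ub => /G0 ->; rewrite mulr0.
have [_ n2 _] := normal_spec nK uK.
by rewrite dotvC n2 ?mul0r// !inE eq_sym ?uv ?ub.
Qed.

(** Weights vanishing on two faces remove all boundary terms and show that every edge derivative of
    q_i is zero. With q_i = c known, weights [lam b'] show that q_b - c is orthogonal on each face
    to enough polynomials to fill degree m. *)
Lemma wgrad_zero_const : exists c, (forall x, cell K x -> q.1 K x = c) /\
  forall v, v \in K -> forall x, cell (K :\ v) x -> q.2 (K :\ v) x = c.
Proof.
have [lam bl] := barycentricP nK.
have [p dp qp] := Pq.
pose D v b : mp := \sum_i (pos v - pos b) 0 i *: mpoly.mderiv i p.
have D0 v b : v \in K -> b \in K :\ v -> D v b = 0.
  move=> vK bK; have [bv bK'] := setD1P bK.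
  have [m1|m1] := leqP m 1.
    have mE : m.-1 = 0%N by apply/eqP; rewrite -subn1 subn_eq0.
    apply: big1 => i _; have := mpoly.msize1_polyC (p := p).
    by rewrite mE in dp => /(_ dp) ->; rewrite mpoly.mderivC scaler0.
  have m2 : m = m.-2.+2 by case: (m) m1 => [|[|]].
  have dD : deg_le m.-2 (D v b).
    apply: deg_le_sum => i; apply: deg_leZ; apply: deg_le_mderiv.
    by rewrite m2 in dp.
  (* It vanishes on the faces opposite to b and to v, so the boundary terms disappear both in the
     weak gradient and in the divergence theorem; its degree 2 + (m - 2) is just admissible. *)
  pose G0 := lam b * lam v * D v b.
  have dG0 : deg_le m G0.
    rewrite m2; apply: (deg_leM (j := 2)) => //.
    by apply: (deg_leM (j := 1) (k := 1)); exact: (bary_deg bl).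
  have G0b x : cell (K :\ b) x -> peval G0 x = 0.
    by move=> /(bary_face bl bK') l0; rewrite !pevalM l0 !mul0r.
  have G0v x : cell (K :\ v) x -> peval G0 x = 0.
    by move=> /(bary_face bl vK) l0; rewrite !pevalM l0 mulr0 mul0r.
  have e1 := edge_test vK bK dG0 G0b.
  have fz (f : pt -> R) : (forall x, cell (K :\ v) x -> f x = 0) -> int_face (K :\ v) f = 0.
    move=> f0; rewrite -[RHS](int_cst0 (HF vK)); apply/esym/(int_ext (HF vK)).
      by move=> x /f0 ->.
    exact: (adm_cst (HF vK)).
  rewrite fz ?mulr0 in e1; last by move=> x /G0v ->; rewrite mulr0.
  have pGb x : cell (K :\ b) x -> peval (p * G0) x = 0.
    by move=> /G0b h; rewrite pevalM h mulr0.
  have := cell_divergence nK vK bK pGb.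
  rewrite fz ?mulr0; last by move=> x /G0v h; rewrite pevalM h mulr0.
  have NK s : bmeas (cell K) (peval s) by exact: peval_adm_cell.
  have dvE : forall x, cell K x ->
     \sum_i (pos v - pos b) 0 i * peval (mpoly.mderiv i (p * G0)) x =
     1 * peval (D v b * G0) x + q.1 K x * Defs.pdiv (edge_field v b G0) x.
    move=> x Kx; rewrite qp// mul1r pevalM peval_sum mulr_suml mulr_sumr -big_split/=.
    apply: eq_bigr => i _; rewrite mpoly.mderivM pevalD !pevalM mpoly.mderivZ !pevalZ; ring.
  rewrite (int_lin_ext HK dvE) => [|//|]; last first.
    by apply: (adm_mul HK); [exact: rq.1|exact: pdiv_adm].
  rewrite e1 mul1r addr0 => i0.
  (* The integrand is the square of the edge derivative times two barycentric coordinates, which are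
     nonnegative on the cell. *)
  have DG0 : D v b * G0 = 0.
    apply: (mpoly_vanish nK); apply: (int_def HK _ i0) => x Kx.
    have -> : peval (D v b * G0) x =
        peval (D v b) x ^+ 2 * (peval (lam b) x * peval (lam v) x).
      by rewrite !pevalM; ring.
    rewrite mulr_ge0 ?sqr_ge0// mulr_ge0//.
      by move/(cellE bl): Kx; exact.
    by move/(cellE bl): Kx; exact.
  have lb := bary_neq0 bl bK'; have lv := bary_neq0 bl vK.
  by move/eqP: DG0; rewrite !mulf_eq0 (negbTE lb) (negbTE lv) /= orbb => /eqP.
have [cK _] := nK.
have [b bK] : exists b, b \in K by apply/card_gt0P; rewrite cK.
have [a fr] := frame_exists bK cK; have uE := frame_mx_unit nK fr.
have [_ _ aS _] := fr.
have dp0 i : mpoly.mderiv i p = 0.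
  apply: (mpoly_vanish nK) => x _.
  pose g : 'cV[R]_n.+1 := \col_i peval (mpoly.mderiv i p) x.
  have Eg : frame_mx pos b a *m g = 0.
    apply/row_matrixP => j; rewrite row_mul rowK row0.
    have := aS j; rewrite !inE => /andP[ajb ajK].
    have := D0 (a j) b ajK; rewrite !inE eq_sym ajb => /(_ bK) /(congr1 (peval^~ x)).
    rewrite peval0 peval_sum => e; apply/rowP => l; rewrite !mxE -[RHS]e.
    by apply: eq_bigr => k _; rewrite pevalZ; congr (_ * _); rewrite mxE.
  have g0 : g = 0 by rewrite -(mulKmx uE g) Eg mulmx0.
  by have := congr1 (fun A : 'cV[R]_n.+1 => A i 0) g0; rewrite !mxE.
pose c := peval p (pos b).
have pc := mderiv_eq0 dp0 (erefl c).
have qc x : cell K x -> q.1 K x = c by move=> Kx; rewrite qp// pc pevalC.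
exists c; split=> // v vK.
have HFv := HF vK.
have Nq := rq.2 v vK.
have Ns s : face_adm (K :\ v) (peval s) by exact: peval_adm_face.
have Nr : face_adm (K :\ v) (fun x => q.2 (K :\ v) x - c).
  by apply: (admB HFv Nq); exact: (adm_cst HFv).
(* The weak gradient gives the face integral of q_b times the weight; the divergence theorem gives
   the same with c instead of q_b. The nonzero factor from the normal cancels. *)
have testF b' (g : mp) : b' \in K :\ v -> deg_le m.-1 g ->
    int_face (K :\ v) (fun x => (q.2 (K :\ v) x - c) * peval (lam b' * g) x) = 0.
  move=> bF dg; have [b'v b'K] := setD1P bF.
  have dG : deg_le m (lam b' * g).
    by rewrite -(prednK m0); apply: (deg_leM (j := 1)) => //; exact: (bary_deg bl).
  have G0 x : cell (K :\ b') x -> peval (lam b' * g) x = 0.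
    by move=> /(bary_face bl b'K) l0; rewrite !pevalM l0 mul0r.
  have := edge_test vK bF dG G0.
  have -> : int_cell K (fun x => q.1 K x * Defs.pdiv (edge_field v b' (lam b' * g)) x) =
      c * int_cell K (fun x => \sum_i (pos v - pos b') 0 i *
            peval (mpoly.mderiv i (lam b' * g)) x).
    have N1 : bmeas (cell K) (fun x => \sum_i (pos v - pos b') 0 i *
            peval (mpoly.mderiv i (lam b' * g)) x).
      by apply: (adm_sum HK) => i; apply: (admZ HK); exact: peval_adm_cell.
    rewrite -(intZ HK)//; apply: (int_ext HK) => [x Kx|].
      rewrite qc//; congr (_ * _); apply: eq_bigr => i _.
      by rewrite mpoly.mderivZ pevalZ.
    by apply: (adm_mul HK); [exact: rq.1|exact: pdiv_adm].
  rewrite (cell_divergence nK vK bF G0).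
  have [_ _ /(_ _ bF) n3] := normal_spec nK vK.
  rewrite dotvC mulrCA => /(mulfI (ltr0_neq0 n3)) e.
  have -> : (fun x => (q.2 (K :\ v) x - c) * peval (lam b' * g) x) =
      (fun x => q.2 (K :\ v) x * peval (lam b' * g) x - c * peval (lam b' * g) x).
    by apply/funext => x; rewrite mulrBl.
  rewrite (intB HFv).
  - by rewrite -e (intZ HFv)// subrr.
  - exact: (adm_mul HFv).
  - exact: (admZ HFv).
(* On the face the coefficients w = 1 produce the constant 1, and the coefficients [pos u 0 i] the
   i-th coordinate function. *)
have testsum (g : mp) (w : vtx M -> R) : deg_le m.-1 g ->
    int_face (K :\ v) (fun x => (q.2 (K :\ v) x - c) *
      ((\sum_(u in K :\ v) w u * peval (lam u) x) * peval g x)) = 0.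
  move=> dg.
  have -> : (fun x => (q.2 (K :\ v) x - c) *
      ((\sum_(u in K :\ v) w u * peval (lam u) x) * peval g x)) =
    (fun x => \sum_u (if u \in K :\ v then
       w u * ((q.2 (K :\ v) x - c) * peval (lam u * g) x) else 0)).
    apply/funext => x; rewrite -big_mkcond/= mulr_suml mulr_sumr.
    by apply: eq_bigr => u _; rewrite pevalM; ring.
  have Nl u : face_adm (K :\ v) (fun x => (q.2 (K :\ v) x - c) * peval (lam u * g) x).
    exact: (adm_mul HFv).
  rewrite (int_sum HFv) => [|u].
    apply: big1 => u _; have [uF|uF] := boolP (u \in K :\ v).
      by rewrite (intZ HFv)// testF// mulr0.
    exact: (int_cst0 HFv).
  have [uF|uF] := boolP (u \in K :\ v); first exact: (admZ HFv).
  exact: (adm_cst HFv).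
have test1 (g : mp) : deg_le m.-1 g ->
    int_face (K :\ v) (fun x => (q.2 (K :\ v) x - c) * peval g x) = 0.
  move=> dg; rewrite -(testsum g (fun=> 1) dg); apply: (int_ext HFv) => [x Fx|].
    have [s1 _] := bary_face_sum bl vK Fx.
    by under eq_bigr do rewrite mul1r; rewrite s1 mul1r.
  exact: (adm_mul HFv).
have testX i (g : mp) : deg_le m.-1 g ->
    int_face (K :\ v) (fun x => (q.2 (K :\ v) x - c) * peval (pX i * g) x) = 0.
  move=> dg; rewrite -(testsum g (fun u => pos u 0 i) dg); apply: (int_ext HFv) => [x Fx|].
    have [_ s2] := bary_face_sum bl vK Fx.
    rewrite pevalM pevalX -{2}s2 summxE; congr (_ * (_ * _)).
    by apply: eq_bigr => u _; rewrite mxE mulrC.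
  exact: (adm_mul HFv).
(* A monomial of degree less than m is covered by [test1]; one of degree m is a coordinate times a
   monomial of degree m - 1, covered by [testX]. The latter uses 0 < m. *)
have testmon (mo : mpoly.multinom n.+1) : (mpoly.mdeg mo <= m)%N ->
    int_face (K :\ v) (fun x => (q.2 (K :\ v) x - c) * peval (mpoly.mpolyX R mo) x) = 0.
  rewrite leq_eqVlt => /predU1P[dm|dm]; last first.
    by apply: test1; rewrite /deg_le mpoly.msizeX -ltnS prednK.
  have [i mi] : exists i, mo i != 0%N.
    apply/existsP; apply: contraTT m0; rewrite negb_exists -dm => /forallP h.
    rewrite -leqNgt leqn0 mpoly.mdeg_eq0; apply/eqP/mpoly.mnmP => i.
    by rewrite mpoly.mnm0E; apply/eqP; move: (h i); rewrite negbK.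
  pose mo' := mpoly.mnm_sub mo (mpoly.mnm1 i).
  have moE : mo = mpoly.mnm_add (mpoly.mnm1 i) mo'.
    apply/mpoly.mnmP => j; rewrite mpoly.mnmDE mpoly.mnmBE mpoly.mnm1E.
    by have [<-|_] := eqVneq i j; rewrite ?subn0 ?add0n// subnKC// lt0n.
  rewrite moE mpoly.mpolyXD; apply: testX.
  by rewrite /deg_le mpoly.msizeX prednK// -dm moE mpoly.mdegD mpoly.mdeg1 add1n.
apply: (Pol_orthogonal HFv (Pqf vK) (Pol_cst _ m c)) => s ds.
apply/eqP; rewrite -subr_eq0 -(intB HFv); last 2 first.
- exact: (adm_mul HFv).
- by apply: (adm_mul HFv) => //; exact: (adm_cst HFv).
rewrite [s]mpoly.mpolyE.
have -> : (fun x => q.2 (K :\ v) x * peval (\sum_(mo <- mpoly.msupp s)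
      mpoly.mcoeff mo s *: mpoly.mpolyX R mo) x -
    cst c x * peval (\sum_(mo <- mpoly.msupp s) mpoly.mcoeff mo s *: mpoly.mpolyX R mo) x) =
  (fun x => \sum_(mo <- mpoly.msupp s) mpoly.mcoeff mo s *
      ((q.2 (K :\ v) x - c) * peval (mpoly.mpolyX R mo) x)).
  apply/funext => x; rewrite -mulrBl peval_sum mulr_sumr; apply: eq_bigr => mo _.
  by rewrite pevalZ /=; ring.
rewrite (int_sum HFv) => [|mo]; last by apply: (admZ HFv); exact: (adm_mul HFv).
apply/eqP; rewrite big_seq; apply: big1 => mo mos.
rewrite (intZ HFv); last exact: (adm_mul HFv).
rewrite testmon ?mulr0// -ltnS; apply: (leq_trans _ ds).
exact: mpoly.msize_mdeg_lt.
Qed.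

End weak_gradient_kernel.

(** * Connectivity of the mesh *)

Section general_position.
Context {R : realType}.

Definition absum n p (A : 'M[R]_(n, p)) := \sum_i \sum_j `|A i j|.

Lemma absum_ge0 n p (A : 'M[R]_(n, p)) : 0 <= absum A.
Proof. by apply: sumr_ge0 => i _; apply: sumr_ge0. Qed.

Lemma mulmx_bound n p (x : 'rV[R]_n) (A : 'M[R]_(n, p)) r j :
  (forall i, `|x 0 i| <= r) -> `|(x *m A) 0 j| <= r * absum A.
Proof.
move=> xr; rewrite mxE; apply: (le_trans (ler_norm_sum _ _ _)).
rewrite mulr_sumr; apply: ler_sum => i _; rewrite normrM.
apply: ler_pM => //; rewrite (bigD1 j)//= lerDl.
by apply: sumr_ge0.
Qed.

Lemma dotv_bound n (l x : 'rV[R]_n) r : (forall i, `|x 0 i| <= r) ->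
  `|dotv l x| <= r * absum l.
Proof.
move=> xr; rewrite dotvC; have := @mulmx_bound _ _ x l^T r 0 xr.
rewrite /absum exchange_big /=; congr (_ <= _ * _).
  by congr `|_|; rewrite mxE; apply: eq_bigr => i _; rewrite mxE.
by apply: eq_bigr => i _; apply: eq_bigr => j _; rewrite mxE.
Qed.

Lemma absum_gt0 n (l : 'rV[R]_n) : l != 0 -> 0 < absum l.
Proof.
move=> /rV0Pn[i li]; rewrite /absum big_ord1 (bigD1 i)//=.
by apply: ltr_pwDl; rewrite ?normr_gt0// sumr_ge0.
Qed.

Lemma cube_sub n (c c' : 'rV[R]_n) r r' :
  (forall i, `|c' 0 i - c 0 i| <= r - r') -> cube c' r' `<=` cube c r.
Proof.
move=> h x Cx i; have := Cx i; have := h i.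
have := ler_normD (x 0 i - c' 0 i) (c' 0 i - c 0 i).
by rewrite addrA subrK; lra.
Qed.

(** A whole smaller cube is kept, not just a point, so that finitely many hyperplanes can be avoided
    one after another. *)
Lemma avoid_hyperplane n (c : 'rV[R]_n) r (l : 'rV[R]_n) k : 0 < r -> l != 0 ->
  exists c' r', [/\ 0 < r', cube c' r' `<=` cube c r &
    forall x, cube c' r' x -> dotv l x != k].
Proof.
move=> r0 l0; have S0 := absum_gt0 l0; set S := absum l in S0.
have ll : 0 < dotv l l by rewrite lt_neqAle eq_sym dotv_eq0 l0 dotv_ge0.
have [x0 x0c x0k] : exists2 x0 : 'rV[R]_n,
    forall i, `|x0 0 i - c 0 i| <= r / 2 & dotv l x0 != k.
  have [ck|ck] := eqVneq (dotv l c) k; last first.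
    by exists c => // i; rewrite subrr normr0 divr_ge0// ltW.
  (* S bounds every entry of l, so each coordinate moves by at most r / 2, while the product with l
     changes by a positive multiple of its square norm. *)
  exists (c + (r / 2 / S) *: l) => [i|].
    rewrite !mxE addrAC subrr add0r normrM gtr0_norm; last by rewrite !divr_gt0.
    rewrite mulrAC ler_pdivrMr// ler_pM2l ?divr_gt0//.
    by rewrite /S /absum big_ord1 (bigD1 i)//= lerDl sumr_ge0.
  rewrite dotvDr ck dotvZr -subr_eq0 addrAC subrr add0r mulf_neq0//.
    by rewrite gt_eqF// !divr_gt0.
  by rewrite gt_eqF.
pose g := `|dotv l x0 - k|.
have g0 : 0 < g by rewrite normr_gt0 subr_eq0.
(* Within this radius the product with l varies by at most g / 2, less than the distance g of its
   value at [x0] from k. *)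
pose r' := Num.min (r / 2) (g / (2 * S)).
have r'r : r' <= r / 2 by rewrite ge_min lexx.
have r'g : r' <= g / (2 * S) by rewrite ge_min lexx orbT.
exists x0, r'; split.
- by rewrite lt_min !divr_gt0// mulr_gt0.
- by apply: cube_sub => i; apply: (le_trans (x0c i)); lra.
- move=> x Cx; apply/eqP => lx.
  have := @dotv_bound _ l (x - x0) r'.
  have -> : dotv l (x - x0) = k - dotv l x0 by rewrite dotvBr lx.
  rewrite distrC -/g => /(_ _) h.
  have {}h := h (fun i => _ : `|(x - x0) 0 i| <= r').
  have : g <= r' * S by apply: h => i; have := Cx i; rewrite !mxE.
  have : r' * S <= g / (2 * S) * S by rewrite ler_pM2r.
  have -> : g / (2 * S) * S = g / 2 by field; rewrite gt_eqF.
  by move: g0; lra.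
Qed.

Lemma avoid_hyperplanes n (I : eqType) (s : seq I) (l : I -> 'rV[R]_n) (k : I -> R)
    (c : 'rV[R]_n) r : 0 < r -> (forall i, i \in s -> l i != 0) ->
  exists2 x, cube c r x & forall i, i \in s -> dotv (l i) x != k i.
Proof.
elim: s c r => [|i s IH] c r r0 l0.
  by exists c => // i; rewrite subrr normr0 ltW.
have [c' [r' [r'0 sub av]]] := avoid_hyperplane c (k i) r0 (l0 i (mem_head _ _)).
have [|x Cx xs] := IH c' r' r'0.
  by move=> j js; apply: l0; rewrite in_cons js orbT.
exists x; first exact: sub.
by move=> j; rewrite in_cons => /predU1P[->|]; [exact: av|exact: xs].
Qed.

Lemma common_normal n (V : finType) (S : {set V}) (w : V -> 'rV[R]_n) :
  (#|S| < n)%N -> exists2 l : 'rV[R]_n, l != 0 & forall v, v \in S -> dotv l (w v) = 0.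
Proof.
move=> Sn; pose A : 'M[R]_(n, #|S|) := \matrix_(i, j) w (enum_val j) 0 i.
have : kermx A != 0.
  rewrite -mxrank_eq0 mxrank_ker subn_eq0 -ltnNge.
  exact: leq_ltn_trans (rank_leq_col A) Sn.
move=> /rowV0Pn[l /sub_kermxP lA l0]; exists l => // v vS.
have := congr1 (fun B : 'rV[R]__ => B 0 (enum_rank_in vS v)) lA.
rewrite !mxE => <-; apply: eq_bigr => i _; rewrite mxE enum_rankK_in//.
Qed.

End general_position.

Section mesh_connectivity.
Context {R : realType} {n : nat} {M : mesh R n.+1}.
Local Notation pos := (@pos R n.+1 M).
Implicit Types (K e S : {set vtx M}) (z : 'rV[R]_n.+1).

(** A cell has interior arbitrarily close to each of its points: the cube found in the reference
    simplex near the preimage of z is transported by the affine map. *)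
Lemma cell_inner_cube K z eps : nsimplex pos K -> cell K z -> 0 < eps ->
  exists c r, [/\ 0 < r, cube c r `<=` cell K & cube c r `<=` cube z eps].
Proof.
move=> nK Kz e0; have [cK _] := nK.
have [b bK] : exists b, b \in K by apply/card_gt0P; rewrite cK.
have [a fr] := frame_exists bK cK; have uE := frame_mx_unit nK fr.
set E := frame_mx pos b a in uE.
move: Kz; rewrite (cell_frame fr) -/E => -[t0 Tt0 zE].
(* Bounds on how far E and its inverse stretch coordinates; the added 1 makes positivity
   immediate. *)
pose SE := absum E + 1; pose SI := absum (invmx E) + 1.
have SE0 : 0 < SE by rewrite ltr_wpDl// absum_ge0.
have SI0 : 0 < SI by rewrite ltr_wpDl// absum_ge0.
have [c [rho [rho0 CT Cd]]] := cube_in_ref_simplex Tt0 (divr_gt0 e0 SE0).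
have key y : cube (pos b + c *m E) (rho / SI) y ->
    exists2 t, cube c rho t & y = pos b + t *m E.
  move=> Cy; exists ((y - pos b) *m invmx E); last by rewrite mulmxKV// addrC subrK.
  move=> i; have -> : ((y - pos b) *m invmx E) 0 i - c 0 i =
      ((y - (pos b + c *m E)) *m invmx E) 0 i.
    by rewrite opprD addrA [in RHS]mulmxBl mulmxK// [in RHS]mxE [X in _ = _ + X]mxE.
  apply: (le_trans (@mulmx_bound _ _ _ _ _ (rho / SI) i _)).
    by move=> j; have := Cy j; rewrite !mxE.
  by rewrite mulrAC ler_pdivrMr// ler_pM2l// /SI lerDl.
exists (pos b + c *m E), (rho / SI); split; first exact: divr_gt0.
  by move=> y /key[t Ct ->]; exists t => //; exact: CT.
move=> y /key[t Ct ->] i; rewrite -zE.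
have -> : (pos b + t *m E) 0 i - (pos b + t0 *m E) 0 i = ((t - t0) *m E) 0 i.
  by rewrite mulmxBl !mxE; ring.
apply: (le_trans (@mulmx_bound _ _ _ _ _ (eps / SE) i _)).
  by move=> j; rewrite !mxE; apply: ltW; exact: Cd.
by rewrite mulrAC ler_pdivrMr// ler_pM2l// /SE lerDl.
Qed.

Lemma nbhs_cube z (A : set 'rV[R]_n.+1) : nbhs z A ->
  exists2 eps, 0 < eps & cube z eps `<=` A.
Proof.
move=> /nbhs_ballP[e /= e0 eA]; exists (e / 2); first exact: divr_gt0.
move=> x Cx; apply: eA; split=> // i j; rewrite /ball/= !ord1 distrC.
by apply: le_lt_trans (Cx j) _; lra.
Qed.

Lemma cube_nbhs z eps : 0 < eps -> nbhs z (cube z eps).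
Proof.
move=> e0; apply/nbhs_ballP; exists eps => // x [_ zx] i.
by have := zx 0 i; rewrite /ball/= distrC => /ltW.
Qed.

Lemma cube_segment z eps a b (s : R) : 0 <= s <= 1 -> cube z eps a -> cube z eps b ->
  cube z eps (a + s *: (b - a)).
Proof.
move=> /andP[s0 s1] Ca Cb i; rewrite !mxE.
have -> : a 0 i + s * (b 0 i - a 0 i) - z 0 i =
    (1 - s) * (a 0 i - z 0 i) + s * (b 0 i - z 0 i) by ring.
apply: (le_trans (ler_normD _ _)); rewrite !normrM (ger0_norm s0) ger0_norm ?subr_ge0//.
have := Ca i; have := Cb i => hb ha.
have : s * `|b 0 i - z 0 i| <= s * eps by apply: ler_wpM2l.
have : (1 - s) * `|a 0 i - z 0 i| <= (1 - s) * eps by apply: ler_wpM2l; rewrite ?subr_ge0.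
lra.
Qed.

Lemma segment_preimage_closed K a b : nsimplex pos K ->
  closed [set s : R | cell K (a + s *: (b - a))].
Proof.
move=> nK; have [lam bl] := barycentricP nK.
have [q qP] := choice (fun u => line_poly (lam u) a (b - a)).
have -> : [set s : R | cell K (a + s *: (b - a))] =
    \bigcap_(u in [set` K]) (horner (q u) @^-1` [set y | 0 <= y]).
  apply/seteqP; split => s /=.
    by move=> /(cellE bl) h u uK /=; have [-> _] := qP u s; exact: h.
  by move=> h; apply/(cellE bl) => u uK; have [<- _] := qP u s; exact: h.
apply: closed_bigI => u _; apply: closed_comp; last exact: closed_ge.
by move=> x _; exact: continuous_horner.
Qed.

(* A set S of at most n vertices (in dimension n+1) lies with any point in a
   hyperplane, which a segment starting at that point can avoid. *)
Lemma avoiding_segment (Ss : seq {set vtx M}) (ca cb : 'rV[R]_n.+1) ra rb :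
  0 < ra -> 0 < rb -> (forall S, S \in Ss -> (#|S| <= n)%N) ->
  exists a b, [/\ cube ca ra a, cube cb rb b &
    forall S s, S \in Ss -> ~ cell S (a + s *: (b - a))].
Proof.
move=> ra0 rb0 hS.
(* A hyperplane through the vertices of each S; the starting point a is chosen off all of them. An
   empty S has an empty hull, so any nonzero l serves. *)
have N1 S : exists l : 'rV[R]_n.+1 * R, S \in Ss -> l.1 != 0 /\
    forall x, cell S x -> dotv l.1 x = l.2.
  have [SS|SS] := boolP (S \in Ss); last by exists (0, 0).
  have [S0|[v0 v0S]] := set_0Vmem S.
    exists (delta_mx 0 0, 0) => _; split; last first.
      move=> x [t [_ + _]]; rewrite S0 big_set0 => /esym/eqP.
      by rewrite oner_eq0.
    by apply/eqP => /rowP /(_ 0); rewrite !mxE !eqxx => /eqP; rewrite oner_eq0.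
  have [l l0 lP] := @common_normal R _ _ S (fun v => pos v - pos v0) (hS _ SS).
  exists (l, dotv l (pos v0)) => _; split=> // x [t [t0 t1 ->]] /=.
  apply/eqP; rewrite -subr_eq0 -dotvBr.
  have -> : \sum_(v in S) t v *: pos v - pos v0 = \sum_(v in S) t v *: (pos v - pos v0).
    under [RHS]eq_bigr do rewrite scalerBr.
    by rewrite sumrB -scaler_suml t1 scale1r.
  apply/eqP; rewrite -(mul1mx (\sum_(v in S) _)) mul1mx.
  apply: (big_ind (fun y => dotv l y = 0)); first exact: dotv0r.
    by move=> x' y' ex ey; rewrite dotvDr ex ey addr0.
  by move=> v vS; rewrite dotvZr lP// mulr0.
have [l1 l1P] := choice N1.
have [|a Ca aS] := @avoid_hyperplanes _ _ _ Ss (fun S => (l1 S).1) (fun S => (l1 S).2) ca ra ra0.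
  by move=> S /l1P[].
have aN S : S \in Ss -> ~ cell S a.
  by move=> SS Sa; have /eqP := aS _ SS; apply; apply: (l1P S SS).2.
(* A hyperplane through S and a. With b off it, the line from a to b meets it only at a, which does
   not belong to the hull of S. *)
have N2 S : exists l : 'rV[R]_n.+1, S \in Ss -> l != 0 /\
    forall v, v \in S -> dotv l (pos v - a) = 0.
  have [SS|SS] := boolP (S \in Ss); last by exists 0.
  by have [l l0 lP] := @common_normal R _ _ S (fun v => pos v - a) (hS _ SS); exists l.
have [l2 l2P] := choice N2.
have [|b Cb bS] := @avoid_hyperplanes _ _ _ Ss l2 (fun S => dotv (l2 S) a) cb rb rb0.
  by move=> S /l2P[].
exists a, b; split=> // S s SS [t [t0 t1 e]].
have [_ lP] := l2P S SS.
have : dotv (l2 S) (s *: (b - a)) = 0.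
  have -> : s *: (b - a) = \sum_(v in S) t v *: (pos v - a).
    under eq_bigr do rewrite scalerBr.
    by rewrite sumrB -scaler_suml t1 scale1r -e addrAC subrr add0r.
  apply: (big_ind (fun y => dotv (l2 S) y = 0)); first exact: dotv0r.
    by move=> x' y' ex ey; rewrite dotvDr ex ey addr0.
  by move=> v vS; rewrite dotvZr lP// mulr0.
rewrite dotvZr dotvBr => /eqP; rewrite mulf_eq0 subr_eq0 (negbTE (bS _ SS)) orbF => /eqP s0.
by apply: (aN _ SS); exists t; split=> //; rewrite -e s0 scale0r addr0.
Qed.

(** If c took two values, the unions [XA] and [XB] of the cells with c = c K0 and of the others
    would be closed and cover Omega, hence meet at some z in Omega. Near z a segment in general
    position joins the interiors of two cells of different kind inside Omega and can pass from [XA]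
    to [XB] only across a face of n + 1 vertices, where c does not jump. *)
Lemma mesh_connected (Omega : set 'rV[R]_n.+1) (c : {set vtx M} -> R) :
  open Omega -> connected Omega -> conforming_partition M Omega ->
  (forall K K', K \in elts M -> K' \in elts M -> #|K :&: K'| = n.+1 -> c K = c K') ->
  forall K K', K \in elts M -> K' \in elts M -> c K = c K'.
Proof.
move=> oO cO [nK cover conf] adj K0 K1 K0M K1M; apply: contrapT => c01.
pose XA := \bigcup_(K in [set K | K \in elts M /\ c K = c K0]) cell K.
pose XB := \bigcup_(K in [set K | K \in elts M /\ c K <> c K0]) cell K.
have fin (P : set {set vtx M}) : finite_set P by exact: finite_finset.
have clXA : closed XA by apply: closed_bigcup => // K [KM _]; exact: closed_cell (nK _ KM).
have clXB : closed XB by apply: closed_bigcup => // K [KM _]; exact: closed_cell (nK _ KM).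
have cov x : Omega x -> XA x \/ XB x.
  move=> Ox; have : closure Omega x by exact: subset_closure.
  rewrite cover => -[K KM Kx].
  by have [cK|cK] := pselect (c K = c K0); [left|right]; exists K.
(* Cells are only known to lie in the closure of Omega, but a cell contains a cube, and that cube
   meets Omega. *)
have inter K : K \in elts M -> exists2 x, Omega x & cell K x.
  move=> KM; have [cK _] := nK _ KM.
  have [v vK] : exists v, v \in K by apply/card_gt0P; rewrite cK.
  have [y [r [r0 yK _]]] := cell_inner_cube (nK _ KM) (vertex_in_cell vK) ltr01.
  have : closure Omega y.
    rewrite cover; exists K => //; apply: yK => i.
    by rewrite subrr normr0 ltW.
  move=> /(_ _ (cube_nbhs y r0)) [x [Ox Cx]].
  by exists x => //; exact: yK.
have [z Oz [XAz XBz]] : exists2 z, Omega z & XA z /\ XB z.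
  apply: contrapT => nex.
  have [xB OxB KxB] := inter _ K1M.
  have XBx : XB xB by exists K1 => //; split=> // h; apply: c01.
  have [xA OxA KxA] := inter _ K0M.
  have XAx : XA xA by exists K0.
  have e : Omega `&` XA = Omega.
    apply: cO; first by exists xA.
      exists (~` XB); first exact: closed_openC.
      apply/seteqP; split => x [Ox Xx]; split=> //.
        by move=> Bx; apply: nex; exists x.
      by case: (cov x Ox).
    by exists XA.
  apply: nex; exists xB => //; split=> //.
  by have : Omega xB by []; rewrite -{1}e => -[].
have [eps e0 eO] := nbhs_cube (open_nbhs_nbhs (conj oO Oz)).
case: XAz => KA [KAM cA] KAz; case: XBz => KB [KBM cB] KBz.
have [ca [ra [ra0 raK raz]]] := cell_inner_cube (nK _ KAM) KAz e0.
have [cb [rb [rb0 rbK rbz]]] := cell_inner_cube (nK _ KBM) KBz e0.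
(* All vertex sets too small to span a face: the intersections of cells that the segment must
   avoid. *)
pose Ss : seq {set vtx M} := seq.filter (fun S : {set vtx M} => #|S| <= n)%N (enum predT).
have [|a [b [Ca Cb ab]]] := @avoiding_segment Ss ca cb ra rb ra0 rb0.
  by move=> S; rewrite mem_filter => /andP[].
pose A := [set s : R | XA (a + s *: (b - a))].
pose B := [set s : R | XB (a + s *: (b - a))].
have clA : closed A.
  have -> : A = \bigcup_(K in [set K | K \in elts M /\ c K = c K0])
      [set s : R | cell K (a + s *: (b - a))].
    by apply/seteqP; split => s [K hK Ks]; exists K.
  by apply: closed_bigcup => // K [KM _]; exact: segment_preimage_closed (nK _ KM).
have clB : closed B.
  have -> : B = \bigcup_(K in [set K | K \in elts M /\ c K <> c K0])
      [set s : R | cell K (a + s *: (b - a))].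
    by apply/seteqP; split => s [K hK Ks]; exists K.
  by apply: closed_bigcup => // K [KM _]; exact: segment_preimage_closed (nK _ KM).
(* By conformity a common point lies in the hull of [K :&: K']; the segment avoids this hull if it
   has at most n vertices, and with n + 1 vertices [adj] contradicts the difference of c. *)
have AB s : ~ (A s /\ B s).
  move=> [[K [KM cK] Ks] [K' [K'M cK'] K's]].
  have : cell (K :&: K') (a + s *: (b - a)).
    by have := conf _ _ KM K'M; rewrite eqEsubset => -[h _]; apply: h; split.
  have KK' : K != K' by apply/eqP => h; apply: cK'; rewrite -h.
  apply: ab; rewrite mem_filter mem_enum andbT -ltnS ltn_neqAle.
  have c1 : (#|K :&: K'| <= n.+1)%N.
    rewrite -ltnS -(nK _ KM).1; apply: proper_card.
    rewrite properE finset.subsetIl /=; apply: contra KK'; rewrite finset.subsetI fintype.subxx /=.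
    by move=> sub; rewrite eqEcard sub (nK _ KM).1 (nK _ K'M).1 leqnn.
  rewrite c1 andbT; apply/eqP => h; apply: cK'.
  by rewrite -cK; apply/esym; apply: adj.
have cov01 s : `[0, 1]%classic s -> A s \/ B s.
  rewrite /= in_itv/= => s01; apply: cov; apply: eO; apply: cube_segment => //.
    exact: raz.
  exact: rbz.
have A0 : A 0 by rewrite /A /= scale0r addr0; exists KA => //; exact: raK.
have B1 : B 1 by rewrite /B /= scale1r addrC subrK; exists KB => //; exact: rbK.
have c1 : connected `[0 : R, 1]%classic by exact: segment_connected.
have e : `[0, 1]%classic `&` A = `[0, 1]%classic.
  apply: c1; first by exists 0; split=> //=; rewrite in_itv/= lexx ler01.
    exists (~` B); first exact: closed_openC.
    apply/seteqP; split => x [Ox Xx]; split=> //.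
      by move=> Bx; apply: (AB x).
    by case: (cov01 x Ox).
  by exists A.
apply: (AB 1); split=> //.
have : `[0, 1]%classic (1 : R) by rewrite /= in_itv/= lexx ler01.
by rewrite -{1}e => -[].
Qed.

End mesh_connectivity.

(** * Discrete forms and spaces *)

(** Linearity up to values off the mesh: [comb] relates u to u1 and u2 on cells and faces only.
    Compared with plain linearity it also encodes that L depends on nothing else. *)
Definition form_linear (R : realType) (T : Type) (reg : T -> Prop)
    (comb : R -> T -> T -> T -> Prop) (L : T -> R) :=
  forall c u u1 u2, reg u -> reg u1 -> reg u2 -> comb c u u1 u2 ->
    L u = c * L u1 + L u2.

Lemma combine_add (R : comPzRingType) (c a a1 a2 b b1 b2 : R) :
  a = c * a1 + a2 -> b = c * b1 + b2 -> a + b = c * (a1 + b1) + (a2 + b2).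
Proof. by move=> -> ->; ring. Qed.

Lemma combine_sub (R : comPzRingType) (c d a a1 a2 b b1 b2 : R) :
  a = c * a1 + a2 -> b = c * b1 + b2 ->
  d * a - d * b = c * (d * a1 - d * b1) + (d * a2 - d * b2).
Proof. by move=> -> ->; ring. Qed.

Lemma combine_scale (R : comPzRingType) (c d a a1 a2 : R) :
  a = c * a1 + a2 -> d * a = c * (d * a1) + d * a2.
Proof. by move=> ->; ring. Qed.

Section discrete_forms.
Context {R : realType} {n : nat} {M : mesh R n.+1}.
Local Notation pos := (@pos R n.+1 M).
Local Notation pt := 'rV[R]_n.+1.
Local Notation mp := (mpoly.mpoly n.+1 R).
Local Notation scalar := (wfun M R).
Local Notation vector := (wfun M pt).
Hypothesis nM : forall K, K \in elts M -> nsimplex pos K.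
Implicit Types (K : {set vtx M}) (u v w : vector) (q : scalar).

(** The degrees are left free, so that the class contains both discrete spaces and the products in
    the convection term. *)
Definition spoly q := forall K, K \in elts M ->
  (exists j, Pol j (cell K) (q.1 K)) /\
  forall z, z \in K -> exists j, Pol j (cell (K :\ z)) (q.2 (K :\ z)).
Definition vpoly u := forall i, spoly (wcomp u i).
Definition scomb c q q1 q2 :=
  forall K, K \in elts M -> wcombination K c q q1 q2.
Definition vcomb c u u1 u2 :=
  forall K, K \in elts M -> vcombination K c u u1 u2.
Definition szero q := forall K, K \in elts M ->
  (forall x, cell K x -> q.1 K x = 0) /\
  forall z, z \in K -> forall x, cell (K :\ z) x -> q.2 (K :\ z) x = 0.
Definition vzero u := forall i, szero (wcomp u i).

Lemma Pol_ext j (D : set pt) (f g : pt -> R) : (forall x, D x -> f x = g x) ->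
  Pol j D f -> Pol j D g.
Proof. by move=> e [p dp pP]; exists p => // x Dx; rewrite -e// pP. Qed.

(** Where q vanishes it agrees with 1 q + q, so L q = 2 L q. *)
Lemma form_linear_szero L q : form_linear spoly scomb L -> spoly q -> szero q -> L q = 0.
Proof.
move=> lL rq zq; have : scomb 1 q q q.
  by move=> K /zq[z1 z2]; split=> [x /z1 ->|z zK x /(z2 z zK) ->]; rewrite mulr0 addr0.
by move=> /(lL 1 q q q rq rq rq); lra.
Qed.

Lemma form_linear_vzero L u : form_linear vpoly vcomb L -> vpoly u -> vzero u -> L u = 0.
Proof.
move=> lL ru zu; have : vcomb 1 u u u.
  move=> K KM i; have [z1 z2] := zu i K KM.
  by split=> [x /z1 ->|z zK x /(z2 z zK) ->]; rewrite mulr0 addr0.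
by move=> /(lL 1 u u u ru ru ru); lra.
Qed.

Section one_cell.
Variables (K : {set vtx M}) (KM : K \in elts M).
Let HK := cell_integration (nM KM).
Let HF z (zK : z \in K) := face_integration (nM KM) zK.

Lemma spoly_regular q : spoly q -> wregular K q.
Proof.
move=> /(_ K KM)[[j P1] P2]; split; first exact: (Pol_adm HK P1).
by move=> z zK; have [i Pi] := P2 z zK; exact: (Pol_adm (HF zK) Pi).
Qed.

Lemma vpoly_regular u : vpoly u -> vregular K u.
Proof. by move=> ru i; exact: spoly_regular. Qed.

Lemma vpoly_cell u i : vpoly u -> bmeas (cell K) (fun x => u.1 K x 0 i).
Proof. by move=> ru; have [] := spoly_regular (ru i). Qed.

Lemma vpoly_cell_face u i z : vpoly u -> z \in K ->
  face_adm (K :\ z) (fun x => u.1 K x 0 i).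
Proof.
move=> ru zK; have [[j [p dp pP]] _] := ru i K KM.
apply: (adm_ext (HF zK) _ (peval_adm_face (nM KM) p zK)) => x Kx.
by rewrite -pP//; exact: (cell_sub (finset.subD1set K z)).
Qed.

Lemma vpoly_face u i z : vpoly u -> z \in K ->
  face_adm (K :\ z) (fun x => u.2 (K :\ z) x 0 i).
Proof. by move=> ru zK; have [_] := spoly_regular (ru i); exact. Qed.

Lemma adm_dotv (D : set pt) N I (f g : pt -> pt) : integration D N I ->
  (forall i, N (fun x => f x 0 i)) -> (forall i, N (fun x => g x 0 i)) ->
  N (fun x => dotv (f x) (g x)).
Proof. by move=> H Nf Ng; apply: (adm_sum H) => i; apply: (adm_mul H). Qed.

Lemma wgrad_adm j q i : spoly q -> bmeas (cell K) (fun x => wgrad j q K x 0 i).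
Proof.
by move=> rq; have [P _] := wgrad_spec (nM KM) j (spoly_regular rq); exact: (Pol_adm HK (P i)).
Qed.

Lemma wdiv_adm j u : vpoly u -> bmeas (cell K) (wdiv j u K).
Proof.
by move=> ru; have [P _] := wdiv_spec (nM KM) j (vpoly_regular ru); exact: (Pol_adm HK P).
Qed.

Lemma jump_adm k u z i : vpoly u -> z \in K ->
  face_adm (K :\ z) (fun x => jump k u K z x 0 i).
Proof.
move=> ru zK; have [P _] := face_proj_spec (nM KM) k zK (vpoly_cell_face i ru zK).
apply: (adm_ext (HF zK) _ (admB (HF zK) (Pol_adm (HF zK) P) (vpoly_face i ru zK))).
by move=> x _; rewrite mxE.
Qed.

Lemma jump_lin k c u u1 u2 z x : vpoly u1 -> vpoly u2 -> vcombination K c u u1 u2 ->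
  z \in K -> cell (K :\ z) x ->
  jump k u K z x = c *: jump k u1 K z x + jump k u2 K z x.
Proof.
move=> r1 r2 eq zK Kx; apply/rowP => i; rewrite !mxE.
have [e1 e2] := eq i.
rewrite (@face_proj_lin _ _ _ K (nM KM) k z c _ (fun y => u1.1 K y 0 i) (fun y => u2.1 K y 0 i))//.
- by have /= -> := e2 z zK x Kx; ring.
- exact: vpoly_cell_face.
- exact: vpoly_cell_face.
- by move=> y Ky; apply: e1; exact: (cell_sub (finset.subD1set K z)).
Qed.

End one_cell.

Lemma vpoly_tensor u w i : vpoly u -> vpoly w -> vpoly (wtensor u w i).
Proof.
move=> ru rw j K KM; have [[a Pu] Fu] := ru i K KM; have [[b Pw] Fw] := rw j K KM.
split; first by exists (a + b)%N; apply: (Pol_ext _ (Pol_mul Pu Pw)) => x _; rewrite /= mxE.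
move=> z zK; have [a' Pu'] := Fu z zK; have [b' Pw'] := Fw z zK.
by exists (a' + b')%N; apply: (Pol_ext _ (Pol_mul Pu' Pw')) => x _; rewrite /= mxE.
Qed.

Lemma sum_cell_lin c (f f1 f2 : {set vtx M} -> pt -> R) :
  (forall K, K \in elts M -> [/\ bmeas (cell K) (f1 K), bmeas (cell K) (f2 K) &
     forall x, cell K x -> f K x = c * f1 K x + f2 K x]) ->
  \sum_(K in elts M) int_cell K (f K) =
  c * \sum_(K in elts M) int_cell K (f1 K) + \sum_(K in elts M) int_cell K (f2 K).
Proof.
move=> h; rewrite mulr_sumr -big_split/=; apply: eq_bigr => K KM.
by have [b1 b2 e] := h K KM; exact: (int_lin_ext (cell_integration (nM KM)) e b1 b2).
Qed.

Lemma sum_face_lin c (f f1 f2 : {set vtx M} -> vtx M -> pt -> R) :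
  (forall K z, K \in elts M -> z \in K ->
     [/\ face_adm (K :\ z) (f1 K z), face_adm (K :\ z) (f2 K z) &
     forall x, cell (K :\ z) x -> f K z x = c * f1 K z x + f2 K z x]) ->
  \sum_(K in elts M) \sum_(z in K) int_face (K :\ z) (f K z) =
  c * (\sum_(K in elts M) \sum_(z in K) int_face (K :\ z) (f1 K z)) +
  \sum_(K in elts M) \sum_(z in K) int_face (K :\ z) (f2 K z).
Proof.
move=> h; rewrite mulr_sumr -big_split/=; apply: eq_bigr => K KM.
rewrite mulr_sumr -big_split/=; apply: eq_bigr => z zK.
by have [b1 b2 e] := h K z KM zK; exact: (int_lin_ext (face_integration (nM KM) zK) e b1 b2).
Qed.

Lemma grad_formC m u v : grad_form m u v = grad_form m v u.
Proof.
apply: eq_bigr => K _; congr int_cell; apply/funext => x.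
by apply: eq_bigr => i _; rewrite dotvC.
Qed.

Lemma jump_formC k u v : jump_form k u v = jump_form k v u.
Proof.
apply: eq_bigr => K _; apply: eq_bigr => z _; congr int_face; apply/funext => x.
by rewrite dotvC.
Qed.

Lemma grad_integrand_adm m u v K : K \in elts M -> vpoly u -> vpoly v ->
  bmeas (cell K) (fun x => \sum_i dotv (wgrad m (wcomp u i) K x) (wgrad m (wcomp v i) K x)).
Proof.
move=> KM ru rv; apply: (adm_sum (cell_integration (nM KM))) => i.
by apply: (adm_dotv (cell_integration (nM KM))) => j; apply: wgrad_adm.
Qed.

Lemma jump_integrand_adm k u v K z : K \in elts M -> z \in K -> vpoly u -> vpoly v ->
  face_adm (K :\ z) (fun x => (diam (cell K))^-1 * dotv (jump k u K z x) (jump k v K z x)).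
Proof.
move=> KM zK ru rv; apply: (admZ (face_integration (nM KM) zK)).
by apply: (adm_dotv (face_integration (nM KM) zK)) => j; apply: jump_adm.
Qed.

Lemma grad_form_lin m v : vpoly v ->
  form_linear vpoly vcomb (fun u => grad_form m u v).
Proof.
move=> rv c u u1 u2 ru r1 r2 eq; apply: sum_cell_lin => K KM; split.
- exact: grad_integrand_adm.
- exact: grad_integrand_adm.
- move=> x Kx; rewrite mulr_sumr -big_split/=; apply: eq_bigr => i _.
  rewrite (wgrad_lin (nM KM) m.-1 _ _ _ (eq K KM i) Kx) ?dotvDl ?dotvZl//;
  exact: spoly_regular.
Qed.

Lemma jump_form_lin k v : vpoly v ->
  form_linear vpoly vcomb (fun u => jump_form k u v).
Proof.
move=> rv c u u1 u2 ru r1 r2 eq; apply: sum_face_lin => K z KM zK; split.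
- exact: jump_integrand_adm.
- exact: jump_integrand_adm.
- move=> x Kx; rewrite (jump_lin KM k r1 r2 (eq K KM) zK Kx) dotvDl dotvZl; ring.
Qed.

Definition energy m k u v := grad_form m u v + jump_form k u v.

Lemma energyC m k u v : energy m k u v = energy m k v u.
Proof. by rewrite /energy grad_formC jump_formC. Qed.

Lemma energy_lin m k v : vpoly v ->
  form_linear vpoly vcomb (fun u => energy m k u v).
Proof.
move=> rv c u u1 u2 ru r1 r2 eq; rewrite /energy.
have e1 : grad_form m u v = c * grad_form m u1 v + grad_form m u2 v.
  exact: (grad_form_lin m rv ru r1 r2 eq).
have e2 : jump_form k u v = c * jump_form k u1 v + jump_form k u2 v.
  exact: (jump_form_lin k rv ru r1 r2 eq).
exact: (combine_add e1 e2).
Qed.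

Lemma conv_integrand_adm m w u v K : K \in elts M -> vpoly w -> vpoly u -> vpoly v ->
  bmeas (cell K) (fun x => \sum_i wdiv m (wtensor u w i) K x * v.1 K x 0 i).
Proof.
move=> KM rw ru rv; apply: (adm_sum (cell_integration (nM KM))) => i.
apply: (adm_mul (cell_integration (nM KM))); last exact: vpoly_cell.
by apply: wdiv_adm => //; exact: vpoly_tensor.
Qed.

Lemma conv_form_lin_test m w u : vpoly w -> vpoly u ->
  form_linear vpoly vcomb (conv_form m w u).
Proof.
move=> rw ru c v v1 v2 rv r1 r2 eq; apply: sum_cell_lin => K KM; split.
- exact: conv_integrand_adm.
- exact: conv_integrand_adm.
- move=> x Kx; rewrite mulr_sumr -big_split/=; apply: eq_bigr => i _.
  by have [/(_ x Kx) /= -> _] := eq K KM i; ring.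
Qed.

Lemma conv_form_lin_arg m w v : vpoly w -> vpoly v ->
  form_linear vpoly vcomb (fun u => conv_form m w u v).
Proof.
move=> rw rv c u u1 u2 ru r1 r2 eq; apply: sum_cell_lin => K KM; split.
- exact: conv_integrand_adm.
- exact: conv_integrand_adm.
- move=> x Kx; rewrite mulr_sumr -big_split/=; apply: eq_bigr => i _.
  rewrite (@wdiv_lin _ _ _ K (nM KM) m c _ (wtensor u1 w i) (wtensor u2 w i))//.
  + by rewrite mulrDl mulrA.
  + exact/vpoly_regular/vpoly_tensor.
  + exact/vpoly_regular/vpoly_tensor.
  + exact/vpoly_regular/vpoly_tensor.
  + have [e1 e2] := eq K KM i.
    move=> j; split=> [y Ky|z zK y Ky] /=; rewrite !mxE.
      by have /= -> := e1 y Ky; ring.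
    by have /= -> := e2 z zK y Ky; ring.
Qed.

Lemma conv_form_lin_field m u v : vpoly u -> vpoly v ->
  form_linear vpoly vcomb (fun w => conv_form m w u v).
Proof.
move=> ru rv c w w1 w2 rw r1 r2 eq; apply: sum_cell_lin => K KM; split.
- exact: conv_integrand_adm.
- exact: conv_integrand_adm.
- move=> x Kx; rewrite mulr_sumr -big_split/=; apply: eq_bigr => i _.
  rewrite (@wdiv_lin _ _ _ K (nM KM) m c _ (wtensor u w1 i) (wtensor u w2 i))//.
  + by rewrite mulrDl mulrA.
  + exact/vpoly_regular/vpoly_tensor.
  + exact/vpoly_regular/vpoly_tensor.
  + exact/vpoly_regular/vpoly_tensor.
  + move=> j; have [e1 e2] := eq K KM j.
    split=> [y Ky|z zK y Ky] /=; rewrite !mxE.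
      by have /= -> := e1 y Ky; ring.
    by have /= -> := e2 z zK y Ky; ring.
Qed.

Lemma dh_lin_test m w u : vpoly w -> vpoly u -> form_linear vpoly vcomb (dh m w u).
Proof.
move=> rw ru c v v1 v2 rv r1 r2 eq; rewrite /dh.
have e1 : conv_form m w u v = c * conv_form m w u v1 + conv_form m w u v2.
  exact: (conv_form_lin_test m rw ru rv r1 r2 eq).
have e2 : conv_form m w v u = c * conv_form m w v1 u + conv_form m w v2 u.
  exact: (conv_form_lin_arg m rw ru rv r1 r2 eq).
exact: (combine_sub _ e1 e2).
Qed.

Lemma dhC m w u v : dh m w u v = - dh m w v u.
Proof. by apply/esym; exact: opprB. Qed.

Lemma dh_lin_arg m w v : vpoly w -> vpoly v ->
  form_linear vpoly vcomb (fun u => dh m w u v).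
Proof.
move=> rw rv c u u1 u2 ru r1 r2 eq; rewrite /dh.
have e1 : conv_form m w u v = c * conv_form m w u1 v + conv_form m w u2 v.
  exact: (conv_form_lin_arg m rw rv ru r1 r2 eq).
have e2 : conv_form m w v u = c * conv_form m w v u1 + conv_form m w v u2.
  exact: (conv_form_lin_test m rw rv ru r1 r2 eq).
exact: (combine_sub _ e1 e2).
Qed.

Lemma dh_lin_field m u v : vpoly u -> vpoly v ->
  form_linear vpoly vcomb (fun w => dh m w u v).
Proof.
move=> ru rv c w w1 w2 rw r1 r2 eq; rewrite /dh.
have e1 : conv_form m w u v = c * conv_form m w1 u v + conv_form m w2 u v.
  exact: (conv_form_lin_field m ru rv rw r1 r2 eq).
have e2 : conv_form m w v u = c * conv_form m w1 v u + conv_form m w2 v u.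
  exact: (conv_form_lin_field m rv ru rw r1 r2 eq).
exact: (combine_sub _ e1 e2).
Qed.

Lemma bh_integrand_adm m v q K : K \in elts M -> vpoly v -> spoly q ->
  bmeas (cell K) (fun x => dotv (wgrad m q K x) (v.1 K x)).
Proof.
move=> KM rv rq; apply: (adm_dotv (cell_integration (nM KM))) => i.
  exact: wgrad_adm.
exact: vpoly_cell.
Qed.

Lemma bh_lin_vector m q : spoly q -> form_linear vpoly vcomb (bh m ^~ q).
Proof.
move=> rq c v v1 v2 rv r1 r2 eq; apply: sum_cell_lin => K KM; split.
- exact: bh_integrand_adm.
- exact: bh_integrand_adm.
- by move=> x Kx; have [/(_ x Kx) -> _] := vcombinationE (eq K KM); rewrite dotvDr dotvZr.
Qed.

Lemma bh_lin_scalar m v : vpoly v -> form_linear spoly scomb (bh m v).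
Proof.
move=> rv c q q1 q2 rq r1 r2 eq; apply: sum_cell_lin => K KM; split.
- exact: bh_integrand_adm.
- exact: bh_integrand_adm.
- move=> x Kx; rewrite (wgrad_lin (nM KM) m _ _ _ (eq K KM) Kx) ?dotvDl ?dotvZl//;
  exact: spoly_regular.
Qed.

Lemma enorm_adm u K : K \in elts M -> vpoly u -> bmeas (cell K) (fun x => enorm (u.1 K x)).
Proof.
move=> KM ru; apply: (adm_sqrt (cell_integration (nM KM))).
by apply: (adm_dotv (cell_integration (nM KM))) => i; exact: vpoly_cell.
Qed.

Lemma ch_integrand_adm r w u v K : 2 <= r -> K \in elts M -> vpoly w -> vpoly u -> vpoly v ->
  bmeas (cell K) (fun x => enorm (w.1 K x) `^ (r - 2) * dotv (u.1 K x) (v.1 K x)).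
Proof.
move=> r2 KM rw ru rv; apply: (adm_mul (cell_integration (nM KM))).
  apply: (adm_powR (cell_integration (nM KM))); rewrite ?subr_ge0//.
    exact: enorm_adm.
  by move=> x _; exact: enorm_ge0.
by apply: (adm_dotv (cell_integration (nM KM))) => i; exact: vpoly_cell.
Qed.

Lemma chC alpha r w u v : ch alpha r w u v = ch alpha r w v u.
Proof.
rewrite /ch; congr (_ * _); apply: eq_bigr => K _; congr int_cell; apply/funext => x.
by rewrite dotvC.
Qed.

Lemma ch_lin_test alpha r w u : 2 <= r -> vpoly w -> vpoly u ->
  form_linear vpoly vcomb (ch alpha r w u).
Proof.
move=> hr rw ru c v v1 v2 rv r1 r2 eq; apply: combine_scale.
apply: (@sum_cell_lin c _
  (fun K x => enorm (w.1 K x) `^ (r - 2) * dotv (u.1 K x) (v1.1 K x))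
  (fun K x => enorm (w.1 K x) `^ (r - 2) * dotv (u.1 K x) (v2.1 K x))).
move=> K KM; split.
- exact: ch_integrand_adm.
- exact: ch_integrand_adm.
- move=> x Kx; have [/(_ x Kx) -> _] := vcombinationE (eq K KM).
  by rewrite dotvDr dotvZr; ring.
Qed.

Lemma ch_lin_arg alpha r w v : 2 <= r -> vpoly w -> vpoly v ->
  form_linear vpoly vcomb (fun u => ch alpha r w u v).
Proof.
move=> hr rw rv c u u1 u2 ru r1 r2 eq.
rewrite !(chC _ _ _ _ v); exact: (ch_lin_test alpha hr rw rv ru r1 r2 eq).
Qed.

End discrete_forms.

Section open_sets.
Context {R : realType} {n : nat}.
Implicit Types (O : set 'rV[R]_n.+1).

(** The sigma-algebra is generated by the coordinates, so an open set is written as a countable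
    union of cubes with rational data. Needed because the load integrates over cells intersected
    with Omega. *)
Lemma open_measurable_rV O : open O -> measurable O.
Proof.
move=> oO.
pose F (q : 'rV[rat]_n.+1 * rat) : set 'rV[R]_n.+1 :=
  [set x | cube (\row_i ratr (q.1 0 i)) (ratr q.2) x /\
           cube (\row_i ratr (q.1 0 i)) (ratr q.2) `<=` O].
have -> : O = \bigcup_q F q.
  apply/seteqP; split=> [x Ox|x [q _ [Cx sub]]]; last exact: sub.
  have [eps e0 eO] := nbhs_cube (open_nbhs_nbhs (conj oO Ox)).
  have [|rho] := @rat_in_itvoo R (eps / 4) (eps / 2); first by lra.
  rewrite in_itv/= => /andP[r1 r2]; have r0 : 0 < ratr rho :> R by lra.
  have ex i : exists q : rat, `|x 0 i - ratr q| <= ratr rho.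
    have [|q] := @rat_in_itvoo R (x 0 i - ratr rho) (x 0 i + ratr rho); first by lra.
    by rewrite in_itv/= => /andP[q1 q2]; exists q; rewrite ler_norml; apply/andP; split; lra.
  have [q qP] := choice ex.
  have Cx : cube (\row_i ratr ((\row_i q i : 'rV[rat]_n.+1) 0 i)) (ratr rho) x.
    by move=> i; rewrite !mxE.
  exists (\row_i q i, rho) => //; split=> // y Cy; apply: eO => i.
  have := Cx i; have := Cy i; rewrite /= !ler_norml => /andP[a1 a2] /andP[b1 b2].
  by apply/andP; split; lra.
apply: countable_bigcupT_measurable; first exact: countableP.
move=> q; have [sub|nsub] := pselect (cube (\row_i ratr (q.1 0 i)) (ratr q.2) `<=` O).
  rewrite (_ : F q = cube (\row_i ratr (q.1 0 i)) (ratr q.2)); first exact: measurable_cube.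
  by apply/seteqP; split=> [x []|x Cx].
rewrite (_ : F q = set0); first exact: measurable0.
by apply/seteqP; split=> [x []|x].
Qed.

End open_sets.

Section moments.
Context {R : realType} {n : nat}.
Local Notation pt := 'rV[R]_n.

Lemma moments_zero (D : set pt) N I j (f : pt -> R) : integration D N I -> Pol j D f ->
  (forall mo : mpoly.bmultinom n j.+1,
     I (fun x => f x * peval (mpoly.mpolyX R mo) x) = 0) ->
  forall x, D x -> f x = 0.
Proof.
move=> H Pf f0; apply: (Pol_orthogonal H Pf (Pol_cst D j 0)) => s ds.
have Nf := Pol_adm H Pf.
have -> : (fun x => cst 0 x * peval s x) = cst 0 :> (pt -> R).
  by apply/funext => x; rewrite mul0r.
rewrite (int_cst0 H) (mpoly.mpolywE ds).
have e x : f x * peval (\sum_(mo : mpoly.bmultinom n j.+1)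
     (mpoly.mcoeff mo s *: mpoly.mpolyX R mo)) x =
   \sum_(mo : mpoly.bmultinom n j.+1) mpoly.mcoeff mo s * (f x * peval (mpoly.mpolyX R mo) x).
  by rewrite peval_sum mulr_sumr; apply: eq_bigr => mo _; rewrite pevalZ mulrCA.
have Nm (mo : mpoly.bmultinom n j.+1) : N (fun x => f x * peval (mpoly.mpolyX R mo) x).
  exact: (adm_mul H Nf (adm_peval H _)).
rewrite (_ : (fun x => _) = (fun x => \sum_(mo : mpoly.bmultinom n j.+1)
   mpoly.mcoeff mo s * (f x * peval (mpoly.mpolyX R mo) x))); last exact/funext.
rewrite (int_sum H) => [|mo]; last exact: (admZ H).
by apply: big1 => mo _; rewrite (intZ H)// f0 mulr0.
Qed.

(** Functionals indexed by a finite type are renumbered by naturals, with the zero functional out of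
    range. *)
Lemma finite_rank_fin (W : lmodType R) (S : W -> Prop) (B : W -> W -> R) (I : finType)
    (l : I -> W -> R) : (forall i, linear_on S (l i)) ->
  (forall x, S x -> (forall i, l i x = 0) -> B x x = 0) -> finite_rank S B.
Proof.
move=> lin sep.
exists #|I|, (fun j => if insub j is Some i then l (@enum_val I I i) else fun=> 0); split.
  by move=> j; case: insubP => // _ a x y _ _; rewrite mulr0 addr0.
move=> x Sx h; apply: sep => // i.
have := h (enum_rank i) (ltn_ord _).
by rewrite valK /= enum_rankK.
Qed.

End moments.

Section cells.
Context {R : realType} {n : nat} {M : mesh R n.+1}.
Local Notation pos := (@pos R n.+1 M).
Local Notation pt := 'rV[R]_n.+1.
Variables (K : {set vtx M}) (nK : nsimplex pos K).

Lemma cell_enorm_bound : exists B, forall x, cell K x -> enorm x <= B.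
Proof.
have HK := cell_integration nK.
have : bmeas (cell K) (fun x : pt => enorm x).
  apply: (adm_sqrt HK); apply: (adm_sum HK) => i.
  by apply: (adm_mul HK); apply: (adm_ext HK _ (adm_peval HK (pX i))) => x _;
    rewrite pevalX.
move=> /(adm_bound HK)[B bB]; exists B => x Kx.
by apply: le_trans (ler_norm _) (bB x Kx).
Qed.

Lemma cell_measurable : measurable (cell K).
Proof.
have [cK _] := nK; have [b bK] : exists b, b \in K by apply/card_gt0P; rewrite cK.
have [a fr] := frame_exists bK cK.
by rewrite (cell_frame fr); apply: measurable_affine_image; exact: frame_mx_unit nK fr.
Qed.

Lemma coord_le_enorm p (x : 'rV[R]_p) i : `|x 0 i| <= enorm x.
Proof.
rewrite -sqrtr_sqr; apply: ler_wsqrtr; rewrite /dotv (bigD1 i)//= -expr2 lerDl.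
by apply: sumr_ge0 => j _; rewrite -expr2 sqr_ge0.
Qed.

Lemma cell_finite : (lebesgue n.+1 (cell K) < +oo)%E.
Proof.
have [B bB] := cell_enorm_bound.
have B0 : 0 <= B.
  have [cK _] := nK; have [b bK] : exists b, b \in K by apply/card_gt0P; rewrite cK.
  exact: le_trans (enorm_ge0 _) (bB _ (vertex_in_cell bK)).
apply: (@le_lt_trans _ _ (lebesgue n.+1 (cube (0 : pt) B))).
  apply: le_measure; rewrite ?inE; [exact: cell_measurable|exact: measurable_cube|].
  move=> x Kx i; rewrite mxE subr0.
  exact: le_trans (coord_le_enorm _ _) (bB _ Kx).
by rewrite lebesgue_cube// ltry.
Qed.

Lemma diam_cell_gt0 : 0 < diam (cell K).
Proof.
have [cK aK] := nK.
have /card_gt1P[a [b [aK' bK ab]]] : (1 < #|K|)%N by rewrite cK.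
have neq : pos a != pos b.
  apply/eqP => e.
  (* If two vertices had the same position, weights 1 and -1 on them would be a nontrivial affine
     relation. *)
  have := aK (fun v => (v == a)%:R - (v == b)%:R); rewrite sumrB.
  have s1 c : c \in K -> \sum_(v in K) (v == c)%:R = 1 :> R.
    by move=> cK'; rewrite (bigD1 c)//= eqxx big1 ?addr0// => v /andP[_ /negbTE ->].
  have s2 c : c \in K -> \sum_(v in K) (v == c)%:R *: pos v = pos c.
    move=> cK'; rewrite (bigD1 c)//= eqxx scale1r big1 ?addr0// => v /andP[_ /negbTE ->].
    by rewrite scale0r.
  rewrite !s1// subrr => /(_ erefl).
  under eq_bigr do rewrite scalerBl.
  rewrite sumrB !s2// e subrr => /(_ erefl a aK') /eqP.
  by rewrite eqxx (negbTE ab) subr0 oner_eq0.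
have [B bB] := cell_enorm_bound.
have d0 : 0 < enorm (pos a - pos b).
  by rewrite lt_neqAle enorm_ge0 andbT eq_sym enorm_eq0 subr_eq0.
apply: (lt_le_trans d0); apply: ub_le_sup.
  exists (B + B) => d [x [y [Kx Ky ->]]].
  apply: (le_trans (enormD _ _)); rewrite enormN.
  by apply: lerD; exact: bB.
by exists (pos a), (pos b); split=> //; exact: vertex_in_cell.
Qed.

End cells.

Section load_functional.
Context {R : realType} {n : nat} {M : mesh R n.+1}.
Local Notation pos := (@pos R n.+1 M).
Local Notation pt := 'rV[R]_n.+1.
Hypothesis nM : forall K, K \in elts M -> nsimplex pos K.

(** In each component |f_i v_i| <= f_i^2 + B^2 with B a bound for v_i, and the cell has finite
    measure. *)
Lemma load_integrable (Omega : set pt) (f : pt -> pt) (v : wfun M pt) K :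
  open Omega -> L2_vector Omega f -> K \in elts M -> vpoly v ->
  (lebesgue n.+1).-integrable (cell K `&` Omega)
    (EFin \o (fun x => dotv (f x) (v.1 K x))).
Proof.
move=> oO hf KM rv.
have mO := open_measurable_rV oO.
have mK := cell_measurable (nM KM).
have mD : measurable (cell K `&` Omega) by exact: measurableI.
have fD : (lebesgue n.+1 (cell K `&` Omega) < +oo)%E.
  apply: le_lt_trans (cell_finite (nM KM)); apply: le_measure; rewrite ?inE//.
rewrite (_ : _ \o _ = (fun x => \sum_i (f x 0 i * v.1 K x 0 i)%:E)%E); last first.
  by apply/funext => x; rewrite sumEFin.
apply: integrable_sum => // i _.
have [mf If] := hf i.
have [mv [B bB]] := vpoly_cell nM KM i rv.
have mfD : measurable_fun (cell K `&` Omega) (fun x => f x 0 i).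
  by apply: measurable_funS mf => //; exact: subIsetr.
have mvD : measurable_fun (cell K `&` Omega) (fun x => v.1 K x 0 i).
  by apply: measurable_funS mv => //; exact: subIsetl.
have If2 : (lebesgue n.+1).-integrable (cell K `&` Omega) (fun x => ((f x 0 i) ^+ 2)%:E).
  by apply: integrableS If => //; exact: subIsetr.
have Ic : (lebesgue n.+1).-integrable (cell K `&` Omega) (EFin \o cst (B ^+ 2)).
  by apply: bmeas_integrable => //; exact: bmeas_cst.
apply: (le_integrable mD _ _ (integrableD mD If2 Ic)).
  by apply/measurable_EFinP; exact: measurable_funM.
move=> x [Kx Ox] /=; rewrite lee_fin normrM.
rewrite [leRHS]ger0_norm ?addr_ge0 ?sqr_ge0//.
have := bB x Kx; rewrite -(real_normK (num_real (f x 0 i))).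
move: (normr_ge0 (v.1 K x 0 i)) (normr_ge0 (f x 0 i)).
move: `|v.1 K x 0 i| `|f x 0 i| => a b a0 b0 aB.
have : a ^+ 2 <= B ^+ 2 by rewrite lerXn2r ?nnegrE//; exact: le_trans aB.
have := sqr_ge0 (a - b); nra.
Qed.

Lemma load_lin (Omega : set pt) (f : pt -> pt) : open Omega -> L2_vector Omega f ->
  form_linear (@vpoly R n M) vcomb (load M Omega f).
Proof.
move=> oO hf c v v1 v2 rv r1 r2 eq; rewrite mulr_sumr -big_split/=.
apply: eq_bigr => K KM.
have I1 := load_integrable oO hf KM r1; have I2 := load_integrable oO hf KM r2.
have mD : measurable (cell K `&` Omega).
  by apply: measurableI; [exact: cell_measurable (nM KM)|exact: open_measurable_rV].
have Ic := integrableZl mD c I1.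
rewrite -RintegralZl// -RintegralD//; apply: eq_Rintegral => x /set_mem[Kx _].
by have [/(_ x Kx) -> _] := vcombinationE (eq K KM); rewrite dotvDr dotvZr.
Qed.

End load_functional.

(** * The velocity space and its norm *)

Section velocity_space.
Context {R : realType} {n : nat} {M : mesh R n.+1}.
Local Notation pos := (@pos R n.+1 M).
Local Notation pt := 'rV[R]_n.+1.
Local Notation mp := (mpoly.mpoly n.+1 R).
Local Notation scalar := (wfun M R).
Local Notation vector := (wfun M pt).
Hypothesis nM : forall K, K \in elts M -> nsimplex pos K.
Variables (Omega : set pt) (m k : nat).
Local Notation V := (Vh Omega m k : vector -> Prop).

Lemma face_in_faces K z : K \in elts M -> z \in K -> K :\ z \in faces M.
Proof. by move=> KM zK; apply/imset2P; exists K z => //; rewrite inE KM. Qed.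

Lemma Vh_vpoly v : V v -> vpoly v.
Proof.
move=> [Pi Pb _] i K KM; split; first by exists m; exact: Pi.
by move=> z zK; exists k; apply: Pb; exact: face_in_faces.
Qed.

Lemma vcombE (c : R) (u v : vector) : vcomb c (c *: u + v) u v.
Proof. by move=> K KM i; split=> [x _|z _ x _] /=; rewrite !mxE. Qed.

Lemma subspace_Vh : subspace V.
Proof.
split.
  split=> [K _ i|e _ i|e _ _ x _]; last by [].
    by apply: Pol_ext (Pol_cst _ m 0) => x _; rewrite mxE.
  by apply: Pol_ext (Pol_cst _ k 0) => x _; rewrite mxE.
move=> c u v [u1 u2 u3] [v1 v2 v3]; split=> [K KM i|e eF i|e eF eO x ex].
- by apply: Pol_ext (Pol_lin c (u1 K KM i) (v1 K KM i)) => x _; rewrite /= !mxE.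
- by apply: Pol_ext (Pol_lin c (u2 e eF i) (v2 e eF i)) => x _; rewrite /= !mxE.
- by have /= := u3 e eF eO x ex; have /= := v3 e eF eO x ex => /= h1 h2;
    rewrite -[LHS]/(c *: u.2 e x + v.2 e x) h1 h2 scaler0 addr0.
Qed.

Lemma form_linear_on (L : vector -> R) : form_linear vpoly vcomb L -> linear_on V L.
Proof.
move=> lL c u v Vu Vv; apply: lL; [|exact: Vh_vpoly|exact: Vh_vpoly|exact: vcombE].
by apply: Vh_vpoly; apply: subspace_Vh.2.
Qed.

Lemma jump_form_ge0 (v : vector) : vpoly v -> 0 <= jump_form k v v.
Proof.
move=> rv; apply: sumr_ge0 => K KM; apply: sumr_ge0 => z zK.
apply: (int_ge0 (face_integration (nM KM) zK)).
  exact: jump_integrand_adm.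
move=> x _; apply: mulr_ge0; last exact: dotv_ge0.
by rewrite invr_ge0; apply: ltW; exact: diam_cell_gt0 (nM KM).
Qed.

Lemma grad_form_ge0 (v : vector) : vpoly v -> 0 <= grad_form m v v.
Proof.
move=> rv; apply: sumr_ge0 => K KM; apply: (int_ge0 (cell_integration (nM KM))).
  exact: grad_integrand_adm.
by move=> x _; apply: sumr_ge0 => i _; exact: dotv_ge0.
Qed.

Lemma energy_ge0 (v : vector) : vpoly v -> 0 <= energy m k v v.
Proof. by move=> rv; apply: addr_ge0; [exact: grad_form_ge0|exact: jump_form_ge0]. Qed.

Lemma energy_psd : psd_on V (energy m k).
Proof.
split.
- by move=> x y _ _; exact: energyC.
- by move=> z Vz; apply: form_linear_on; apply: energy_lin => //; exact: Vh_vpoly.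
- by move=> x Vx; apply: energy_ge0; exact: Vh_vpoly.
Qed.

Lemma normV_sqr (v : vector) : vpoly v -> normV m k v ^+ 2 = energy m k v v.
Proof. by move=> rv; apply: sqr_sqrtr; exact: energy_ge0. Qed.

Lemma normV_ge0 (v : vector) : 0 <= normV m k v.
Proof. exact: sqrtr_ge0. Qed.

Lemma sum_eq0_ge0 (I : finType) (P : pred I) (F : I -> R) :
  (forall i, P i -> 0 <= F i) -> \sum_(i | P i) F i = 0 -> forall i, P i -> F i = 0.
Proof. by move=> F0 /eqP; rewrite psumr_eq0// => /allP h i Pi; have := h i (mem_index_enum _); rewrite Pi => /eqP. Qed.

Section null.
Variables (r C : R) (r2 : 2 <= r).
Hypothesis embedding : forall v : vector, V v -> Lr_norm r v <= C * normV m k v.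

Lemma Lr_integrand_adm (v : vector) K : K \in elts M -> vpoly v ->
  bmeas (cell K) (fun x => enorm (v.1 K x) `^ r).
Proof.
move=> KM rv; apply: (adm_powR (cell_integration (nM KM))).
- exact: le_trans (ler0n R 2) r2.
- exact: enorm_adm.
- by move=> x _; exact: enorm_ge0.
Qed.

(** The embedding controls the cell values only. Once these vanish, so do their face projections,
    and the jump term is a weighted norm of the face values. *)
Lemma normV_null (v : vector) : V v -> normV m k v = 0 -> vzero v.
Proof.
move=> Vv v0; have rv := Vh_vpoly Vv; have r0 : 0 < r := lt_le_trans (ltr0n R 2) r2.
have e0 : energy m k v v = 0 by rewrite -normV_sqr// v0 expr0n.
have J0 : jump_form k v v = 0.
  by move: e0; rewrite /energy; have := grad_form_ge0 rv; have := jump_form_ge0 rv; lra.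
have S0 : \sum_(K in elts M) int_cell K (fun x => enorm (v.1 K x) `^ r) = 0.
  have := embedding Vv; rewrite v0 mulr0 => h.
  have := powR_ge0 (\sum_(K in elts M) int_cell K (fun x => enorm (v.1 K x) `^ r)) r^-1.
  rewrite le_eqVlt ltNge [X in ~~ X]h orbF eq_sym powR_eq0 => /andP[/eqP //].
have Z1 K : K \in elts M -> forall i x, cell K x -> v.1 K x 0 i = 0.
  move=> KM i x Kx; have [P1 _ _] := Vv.
  apply: (int_powR_eq0 (cell_integration (nM KM)) r0 (f := fun i y => v.1 K y 0 i) (P1 K KM) _ i Kx).
  apply: (sum_eq0_ge0 _ S0 KM) => K' K'M.
  apply: (int_ge0 (cell_integration (nM K'M))); first exact: Lr_integrand_adm.
  by move=> y _; exact: powR_ge0.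
move=> i K KM; split; first by move=> x; exact: Z1.
move=> z zK x Kx /=.
have HF := face_integration (nM KM) zK.
have jE : int_face (K :\ z) (fun x => (diam (cell K))^-1 * dotv (jump k v K z x) (jump k v K z x)) = 0.
  have ge K' z' : K' \in elts M -> z' \in K' -> 0 <= int_face (K' :\ z') (fun x =>
      (diam (cell K'))^-1 * dotv (jump k v K' z' x) (jump k v K' z' x)).
    move=> K'M z'K; apply: (int_ge0 (face_integration (nM K'M) z'K)).
      exact: jump_integrand_adm.
    move=> y _; apply: mulr_ge0; last exact: dotv_ge0.
    by rewrite invr_ge0; apply: ltW; exact: diam_cell_gt0 (nM K'M).
  have s0 : \sum_(z in K) int_face (K :\ z) (fun x =>
      (diam (cell K))^-1 * dotv (jump k v K z x) (jump k v K z x)) = 0.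
    by apply: (sum_eq0_ge0 _ J0 KM) => K' K'M; apply: sumr_ge0 => z' z'K; exact: ge.
  by apply: (sum_eq0_ge0 _ s0 zK) => z' z'K; exact: ge.
have P0 y : cell (K :\ z) y -> face_proj k (K :\ z) (fun y => v.1 K y 0 i) y = 0.
  move=> Ky; have Na := vpoly_cell_face nM KM i rv zK.
  have h : face_proj k (K :\ z) (fun y => v.1 K y 0 i) y =
      1 * face_proj k (K :\ z) (fun y => v.1 K y 0 i) y +
      face_proj k (K :\ z) (fun y => v.1 K y 0 i) y.
    have e w : cell (K :\ z) w -> v.1 K w 0 i = 1 * v.1 K w 0 i + v.1 K w 0 i.
      by move=> Kw; rewrite Z1 ?mulr0 ?addr0//; exact: (cell_sub (finset.subD1set K z)).
    exact: (face_proj_lin (nM KM) k zK Na Na e Ky).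
  by move: h; lra.
have jump0 y : cell (K :\ z) y -> jump k v K z y 0 i = - v.2 (K :\ z) y 0 i.
  by move=> Ky; rewrite mxE P0// add0r.
have [_ P2 _] := Vv; have P2i := P2 _ (face_in_faces KM zK) i.
have Nj j := jump_adm nM KM k j rv zK.
apply: (int_sqr_eq0 HF P2i _ Kx).
apply/eqP; rewrite eq_le; apply/andP; split; last first.
  apply: (int_ge0 HF); last by move=> y _; rewrite -expr2 sqr_ge0.
  by apply: (adm_mul HF); exact: (Pol_adm HF P2i).
have d0 := diam_cell_gt0 (nM KM).
(* Multiplying by the diameter removes the weight; one component of v_b squared is then at most the
   full square of the jump. *)
have -> : 0 = diam (cell K) * int_face (K :\ z) (fun x =>
   (diam (cell K))^-1 * dotv (jump k v K z x) (jump k v K z x)).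
  by rewrite jE mulr0.
rewrite -(intZ HF); last exact: jump_integrand_adm.
apply: (int_le HF).
- by apply: (adm_mul HF); exact: (Pol_adm HF P2i).
- by apply: (admZ HF); exact: jump_integrand_adm.
move=> y Ky; rewrite mulrA mulfV ?gt_eqF// mul1r /dotv (bigD1 i)//= jump0// mulrNN.
by rewrite lerDl; apply: sumr_ge0 => j _; rewrite -expr2 sqr_ge0.
Qed.

Lemma energy_null (v : vector) : V v -> energy m k v v = 0 -> vzero v.
Proof. by move=> Vv e0; apply: normV_null => //; rewrite /normV [X in Num.sqrt X]e0 sqrtr0. Qed.

End null.

End velocity_space.

Section moment_functionals.
Context {R : realType} {n : nat} {M : mesh R n.+1}.
Local Notation pos := (@pos R n.+1 M).
Local Notation pt := 'rV[R]_n.+1.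
Local Notation scalar := (wfun M R).
Local Notation vector := (wfun M pt).
Hypothesis nM : forall K, K \in elts M -> nsimplex pos K.
Variables (a b : nat).

Definition moment_index : finType :=
  (({set vtx M} * mpoly.bmultinom n.+1 a.+1) +
   ({set vtx M} * vtx M * mpoly.bmultinom n.+1 b.+1))%type.

(** Moments against monomials of bounded degree determine a polynomial on a cell or face. Indices
    that name no cell or face of the mesh give the zero functional. *)
Definition moment (t : moment_index) (q : scalar) : R :=
  match t with
  | inl (K, mo) => if K \in elts M then
      int_cell K (fun x => q.1 K x * peval (mpoly.mpolyX R mo) x) else 0
  | inr (K, z, mo) => if (K \in elts M) && (z \in K) then
      int_face (K :\ z) (fun x => q.2 (K :\ z) x * peval (mpoly.mpolyX R mo) x) else 0
  end.

Lemma moment_lin t : form_linear (@spoly R n M) scomb (moment t).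
Proof.
move=> c q q1 q2 rq r1 r2 eq; case: t => [[K mo]|[[K z] mo]] /=.
  case: ifP => KM; last by rewrite mulr0 addr0.
  have HK := cell_integration (nM KM).
  apply: (int_lin_ext HK) => [x Kx||].
  - by have [-> // _] := eq K KM; ring.
  - by apply: (adm_mul HK); [case: (spoly_regular nM KM r1)|exact: (adm_peval HK)].
  - by apply: (adm_mul HK); [case: (spoly_regular nM KM r2)|exact: (adm_peval HK)].
case: ifP => [/andP[KM zK]|_]; last by rewrite mulr0 addr0.
have HF := face_integration (nM KM) zK.
apply: (int_lin_ext HF) => [x Kx||].
- by have [_ ->] := eq K KM => //; ring.
- by apply: (adm_mul HF); [case: (spoly_regular nM KM r1) => _; exact|exact: (adm_peval HF)].
- by apply: (adm_mul HF); [case: (spoly_regular nM KM r2) => _; exact|exact: (adm_peval HF)].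
Qed.

Lemma moment_separates q : (forall K, K \in elts M -> Pol a (cell K) (q.1 K)) ->
  (forall K z, K \in elts M -> z \in K -> Pol b (cell (K :\ z)) (q.2 (K :\ z))) ->
  (forall t, moment t q = 0) -> szero q.
Proof.
move=> P1 P2 h K KM; split.
  apply: (moments_zero (cell_integration (nM KM)) (P1 K KM)) => mo.
  by have := h (inl (K, mo)); rewrite /= KM.
move=> z zK; apply: (moments_zero (face_integration (nM KM) zK) (P2 K z KM zK)) => mo.
by have := h (inr (K, z, mo)); rewrite /= KM zK.
Qed.

End moment_functionals.

Section finite_rank_spaces.
Context {R : realType} {n : nat} {M : mesh R n.+1}.
Local Notation pos := (@pos R n.+1 M).
Local Notation pt := 'rV[R]_n.+1.
Local Notation scalar := (wfun M R).
Local Notation vector := (wfun M pt).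
Hypothesis nM : forall K, K \in elts M -> nsimplex pos K.
Variables (Omega : set pt) (m k : nat).

Lemma finite_rank_Vh (B : vector -> vector -> R) :
  (forall v, vpoly v -> vzero v -> B v v = 0) ->
  finite_rank (Vh Omega m k : vector -> Prop) B.
Proof.
move=> B0; apply: (@finite_rank_fin _ _ _ _ ('I_n.+1 * @moment_index R n M m k)%type
  (fun it (v : vector) => moment it.2 (wcomp v it.1))).
  move=> [i t]; apply: form_linear_on => c u u1 u2 ru r1 r2 eq /=.
  apply: (moment_lin nM _ (ru i) (r1 i) (r2 i)) => K KM.
  exact: eq.
move=> v Vv h; apply: B0; first exact: Vh_vpoly Vv.
have [P1 P2 _] := Vv.
move=> i; apply: (moment_separates nM (a := m) (b := k)).
- by move=> K KM; exact: P1.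
- by move=> K z KM zK; apply: P2; exact: face_in_faces.
- by move=> t; exact: (h (i, t)).
Qed.

End finite_rank_spaces.

Lemma psd_sqrtZ (R : realType) (W : lmodType R) (S : W -> Prop) (B : W -> W -> R) a x :
  subspace S -> psd_on S B -> S x ->
  Num.sqrt (B (a *: x) (a *: x)) = `|a| * Num.sqrt (B x x).
Proof.
move=> sS [BC Bl B0] Sx; have Sax := subspaceZ a sS Sx.
rewrite (linear_onZ _ sS (Bl _ Sax) Sx) BC// (linear_onZ _ sS (Bl _ Sx) Sx) mulrA -expr2.
by rewrite sqrtrM ?sqr_ge0// sqrtr_sqr.
Qed.

(** * The constants [Nh] and [load_norm] as genuine suprema *)

Section constants.
Context {R : realType} {n : nat} {M : mesh R n.+1}.
Local Notation pos := (@pos R n.+1 M).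
Local Notation pt := 'rV[R]_n.+1.
Local Notation scalar := (wfun M R).
Local Notation vector := (wfun M pt).
Hypothesis nM : forall K, K \in elts M -> nsimplex pos K.
Variables (Omega : set pt) (m k : nat) (r C : R) (r2 : 2 <= r).
Hypothesis embedding : forall v : vector, Vh Omega m k v -> Lr_norm r v <= C * normV m k v.
Local Notation V := (Vh Omega m k : vector -> Prop).
Local Notation V0 := (V0h Omega m k : vector -> Prop).
Local Notation N := (normV m k).

Lemma not_wnonzero (v : vector) : ~ wnonzero v -> vzero v.
Proof.
move=> h i K KM; split=> [x Kx|z zK x Kx] /=; apply: contrapT => v0; apply: h.
  by left; exists K, x; split=> //; apply/eqP => e; apply: v0; rewrite e mxE.
right; exists (K :\ z), x; split=> //; first exact: face_in_faces.
by apply/eqP => e; apply: v0; rewrite e mxE.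
Qed.

Lemma wnonzero_normV (v : vector) : V v -> wnonzero v -> 0 < N v.
Proof.
move=> Vv nz; rewrite lt_neqAle normV_ge0 andbT eq_sym; apply/eqP => v0.
have zv := normV_null nM r2 embedding Vv v0; case: nz => [[K [x [KM Kx]]]|[e [x [eF ex]]]].
  by move=> /eqP; apply; apply/rowP => i; rewrite mxE; have [/(_ x Kx)] := zv i K KM.
move: eF ex => /imset2P[K z KM zK ->{e}] ex /eqP; apply.
by apply/rowP => i; rewrite mxE; have [_ /(_ z zK x ex)] := zv i K KM.
Qed.

Lemma Vh_bounded_dual (L : vector -> R) : form_linear vpoly vcomb L ->
  exists2 B, 0 <= B & forall v, V v -> `|L v| <= B * N v.
Proof.
move=> lL.
have sV := subspace_Vh Omega m k : subspace V.
have pE := energy_psd nM Omega m k.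
have fE : finite_rank V (energy m k).
  apply: (finite_rank_Vh nM) => v rv zv.
  exact: (form_linear_vzero (energy_lin nM m k rv)).
have [f fP] := orthobasis_exists sV pE fE.
exists (\sum_(g <- f) Num.sqrt (energy m k g g) * `|L g|).
  by apply: sumr_ge0 => g _; rewrite mulr_ge0// sqrtr_ge0.
move=> v Vv; rewrite mulrC; apply: (null_linear_bound sV pE fP) => //.
  exact: form_linear_on.
move=> z Vz /(energy_null nM r2 embedding Vz) zz.
exact: (form_linear_vzero lL (Vh_vpoly Vz) zz).
Qed.

Lemma dh_bounded : exists2 B, 0 <= B & forall w u v, V w -> V u -> V v ->
  `|dh m w u v| <= B * N w * N u * N v.
Proof.
apply: (trilinear_bound (S := V) (B := energy m k)).
- exact: subspace_Vh.
- exact: energy_psd.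
- apply: (finite_rank_Vh nM) => v rv zv.
  exact: (form_linear_vzero (energy_lin nM m k rv)).
- by move=> u v Vu Vv; apply: form_linear_on; apply: (dh_lin_field nM);
    [exact: Vh_vpoly Vu|exact: Vh_vpoly Vv].
- by move=> u v Vu Vv; apply: form_linear_on; apply: (dh_lin_arg nM);
    [exact: Vh_vpoly Vu|exact: Vh_vpoly Vv].
- by move=> u v Vu Vv; apply: form_linear_on; apply: (dh_lin_test nM);
    [exact: Vh_vpoly Vu|exact: Vh_vpoly Vv].
move=> w u v Vw Vu Vv /(energy_null nM r2 embedding Vw) zw.
have rw := Vh_vpoly Vw; have ru := Vh_vpoly Vu; have rv := Vh_vpoly Vv.
split.
- exact: (form_linear_vzero (dh_lin_field nM m ru rv) rw zw).
- exact: (form_linear_vzero (dh_lin_arg nM m ru rv) rw zw).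
- exact: (form_linear_vzero (dh_lin_test nM m ru rv) rw zw).
Qed.

Lemma normVZ a v : V v -> N (a *: v) = `|a| * N v.
Proof. exact: (psd_sqrtZ a (subspace_Vh Omega m k) (energy_psd nM Omega m k)). Qed.

Lemma V0h_Vh v : V0 v -> V v. Proof. by case. Qed.

Lemma Qh_spoly (q : scalar) : Qh m q -> spoly q.
Proof.
move=> [P1 P2 _] K KM; split; first by exists m.-1; exact: P1.
by move=> z zK; exists m; apply: P2; exact: face_in_faces.
Qed.

Lemma subspace_V0h : subspace V0.
Proof.
have sV := subspace_Vh Omega m k : subspace V.
split.
  split; first exact: sV.1.
  move=> q /Qh_spoly rq; apply: (linear_on0 (L := bh m ^~ q) sV).
  by apply: form_linear_on; exact: bh_lin_vector.
move=> a u v [Vu bu] [Vv bv]; split; first exact: sV.2.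
move=> q Qq; have rq := Qh_spoly Qq.
have lb : linear_on V (bh m ^~ q) by apply: form_linear_on; exact: bh_lin_vector.
by have /= -> := lb a u v Vu Vv; rewrite bu// bv// mulr0 addr0.
Qed.

Definition Nh_set := [set t | exists w u v : vector,
    [/\ V0 w /\ wnonzero w, V0 u /\ wnonzero u, V0 v /\ wnonzero v &
        t = dh m w u v / (N w * N u * N v)]].

(** [sup] is an upper bound only for a set that is bounded above; the bound comes from the
    finite-rank estimate of the trilinear form. *)
Lemma Nh_set_bounded : has_ubound Nh_set.
Proof.
have [B B0 dB] := dh_bounded; exists B => t [w [u [v [[[Vw _] nw] [[Vu _] nu] [[Vv _] nv] ->]]]].
have Nw := wnonzero_normV Vw nw; have Nu := wnonzero_normV Vu nu.
have Nv := wnonzero_normV Vv nv.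
have Np : 0 < N w * N u * N v := mulr_gt0 (mulr_gt0 Nw Nu) Nv.
move: Np (dB w u v Vw Vu Vv); move: (dh _ _ _ _) (N w) (N u) (N v) => d x y z Np h.
by rewrite ler_pdivrMr//; apply: le_trans (ler_norm _) _; rewrite !mulrA.
Qed.

(** Exchanging u and v changes the sign of [dh] and keeps the denominator, so the set contains -t
    along with t; for an empty set [sup] is 0. *)
Lemma Nh_ge0 : 0 <= Nh M Omega m k.
Proof.
have [[t St]|Se] := pselect (Nh_set !=set0); last first.
  rewrite (_ : Nh M Omega m k = sup Nh_set)// (_ : Nh_set = set0) ?sup0//.
  by apply/seteqP; split=> [t St|t []]; case: Se; exists t.
have [w [u [v [Hw Hu Hv tE]]]] := St.
have le x : Nh_set x -> x <= Nh M Omega m k by move=> Sx; apply: ub_le_sup => //; exact: Nh_set_bounded.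
have h1 := le _ St; have h2 : - t <= Nh M Omega m k.
  apply: le; exists w, v, u; split=> //; rewrite tE -mulNr -dhC.
  by congr (_ / _); rewrite mulrAC.
by move: (Nh _ _ _ _) h1 h2 => x; lra.
Qed.

(** Arguments that vanish on the mesh are excluded from the supremum and are treated apart: there
    the form is zero. *)
Lemma dh_le_Nh w u v : V0 w -> V0 u -> V0 v ->
  dh m w u v <= Nh M Omega m k * (N w * N u * N v).
Proof.
move=> Vw Vu Vv.
have rw := Vh_vpoly Vw.1; have ru := Vh_vpoly Vu.1; have rv := Vh_vpoly Vv.1.
have ge0 : 0 <= Nh M Omega m k * (N w * N u * N v).
  by rewrite !mulr_ge0 ?normV_ge0// Nh_ge0.
have [nw|/not_wnonzero zw] := pselect (wnonzero w); last first.
  have e0 : dh m w u v = 0 := form_linear_vzero (dh_lin_field nM m ru rv) rw zw.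
  by rewrite e0.
have [nu|/not_wnonzero zu] := pselect (wnonzero u); last first.
  have e0 : dh m w u v = 0 := form_linear_vzero (dh_lin_arg nM m rw rv) ru zu.
  by rewrite e0.
have [nv|/not_wnonzero zv] := pselect (wnonzero v); last first.
  have e0 : dh m w u v = 0 := form_linear_vzero (dh_lin_test nM m rw ru) rv zv.
  by rewrite e0.
rewrite -ler_pdivrMr; last by rewrite !mulr_gt0// wnonzero_normV//; apply: V0h_Vh.
by apply: ub_le_sup; [exact: Nh_set_bounded|exists w, u, v].
Qed.

Variables (f : pt -> pt) (oO : open Omega) (hf : L2_vector Omega f).

Definition load_set := [set t | exists v : vector,
    [/\ V0 v, wnonzero v & t = load M Omega f v / N v]].

Lemma load_set_bounded : has_ubound load_set.
Proof.
have [B B0 lB] := Vh_bounded_dual (load_lin nM oO hf).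
exists B => t [v [[Vv _] nv ->]]; rewrite ler_pdivrMr; last exact: wnonzero_normV.
by apply: le_trans (ler_norm _) _; exact: lB.
Qed.

Lemma load_linear_on : linear_on V (load M Omega f).
Proof. by apply: form_linear_on; exact: load_lin. Qed.

Lemma load_le_norm v : V0 v -> load M Omega f v <= load_norm M Omega m k f * N v.
Proof.
move=> Vv; have rv := Vh_vpoly Vv.1.
have [nv|/not_wnonzero zv] := pselect (wnonzero v).
  rewrite -ler_pdivrMr; last exact: (wnonzero_normV Vv.1).
  by apply: ub_le_sup; [exact: load_set_bounded|exists v].
have e0 : load M Omega f v = 0 := form_linear_vzero (load_lin nM oO hf) rv zv.
have e1 : energy m k v v = 0 := form_linear_vzero (energy_lin nM m k rv) rv zv.
by rewrite e0 /normV [X in Num.sqrt X]e1 sqrtr0 mulr0.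
Qed.

(** The load is estimated at both v and -v, whose norms agree. *)
Lemma load_norm_ge0 : 0 <= load_norm M Omega m k f.
Proof.
have [[t St]|Se] := pselect (load_set !=set0); last first.
  rewrite (_ : load_norm M Omega m k f = sup load_set)// (_ : load_set = set0) ?sup0//.
  by apply/seteqP; split=> [t St|t []]; case: Se; exists t.
have [v [Vv nv tE]] := St; have Nv := wnonzero_normV Vv.1 nv.
have sV := subspace_Vh Omega m k : subspace V.
have VN : V0 (-1 *: v) by exact: (subspaceZ _ subspace_V0h).
have := load_le_norm VN; rewrite (linear_onZ _ sV load_linear_on Vv.1) mulN1r.
rewrite (normVZ _ Vv.1) normrN1 mul1r.
have := load_le_norm Vv.
move: (load M Omega f v) (load_norm _ _ _ _ _) => l F l1 l2.
have : 0 <= F * N v by lra.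
by rewrite pmulr_lge0.
Qed.

End constants.

(** * Stability of the pressure *)

Section pressure_space.
Context {R : realType} {n : nat} {M : mesh R n.+1}.
Local Notation pos := (@pos R n.+1 M).
Local Notation pt := 'rV[R]_n.+1.
Local Notation scalar := (wfun M R^o).
Local Notation vector := (wfun M pt).
Variables (Omega : set pt) (oO : open Omega) (cO : connected Omega).
Hypothesis hM : conforming_partition M Omega.
Variables (m k : nat) (m0 : (0 < m)%N).
Let nM : forall K, K \in elts M -> nsimplex pos K. Proof. by case: hM. Qed.
Local Notation V := (Vh Omega m k : vector -> Prop).
Local Notation Q := (Qh m : scalar -> Prop).
Local Notation N := (normV m k).

Lemma scombE (c : R) (p q : scalar) : scomb c (c *: p + q) p q.
Proof. by []. Qed.

Lemma subspace_Qh : subspace Q.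
Proof.
split.
  split=> [K _|e _|]; [exact: Pol_cst|exact: Pol_cst|].
  by apply: big1 => K KM; exact: (int_cst0 (cell_integration (nM KM))).
move=> c p q Qp Qq; have rp := Qh_spoly Qp; have rq := Qh_spoly Qq.
case: Qp => p1 p2 p3; case: Qq => q1 q2 q3; split=> [K KM|e eF|].
- exact: (Pol_lin c (p1 K KM) (q1 K KM)).
- exact: (Pol_lin c (p2 e eF) (q2 e eF)).
apply: (etrans (sum_cell_lin nM (c := c) (f1 := p.1) (f2 := q.1) _)) => [K KM|].
  split; [by case: (spoly_regular nM KM rp)|by case: (spoly_regular nM KM rq)|].
  exact: (scombE c p q KM).1.
by rewrite p3 q3 mulr0 addr0.
Qed.

Lemma form_linear_on_Qh (L : scalar -> R) : form_linear spoly scomb L -> linear_on Q L.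
Proof.
move=> lL c p q Qp Qq; apply: lL; [|exact: (Qh_spoly Qp)|exact: (Qh_spoly Qq)|exact: scombE].
exact: (Qh_spoly (subspace_Qh.2 c p q Qp Qq)).
Qed.

Lemma finite_rank_Qh (B : scalar -> scalar -> R) :
  (forall q, spoly q -> szero q -> B q q = 0) -> finite_rank Q B.
Proof.
move=> B0; apply: (@finite_rank_fin _ _ _ _ (@moment_index R n M m.-1 m)
  (fun t (q : scalar) => moment t q)).
  by move=> t; apply: form_linear_on_Qh; exact: moment_lin.
move=> q Qq h; apply: B0; first exact: (Qh_spoly Qq).
have [P1 P2 _] := Qq; apply: (moment_separates nM (a := m.-1) (b := m)) => //.
by move=> K z KM zK; apply: P2; exact: face_in_faces.
Qed.

Definition wgrad_form (p q : scalar) : R :=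
  \sum_(K in elts M) int_cell K (fun x => dotv (wgrad m p K x) (wgrad m q K x)).

(** The polarisation of the square of [normQ]. *)
Definition pressure_form (p q : scalar) : R :=
  \sum_(K in elts M) int_cell K (fun x => p.1 K x * q.1 K x) +
  \sum_(K in elts M) (diam (cell K)) ^+ 2 *
    int_cell K (fun x => dotv (wgrad m p K x) (wgrad m q K x)).

Lemma wgrad_formC p q : wgrad_form p q = wgrad_form q p.
Proof. by apply: eq_bigr => K _; congr int_cell; apply/funext => x; rewrite dotvC. Qed.

Lemma pressure_formC p q : pressure_form p q = pressure_form q p.
Proof.
rewrite /pressure_form; apply: f_equal2; apply: eq_bigr => K _.
  by apply: f_equal; apply/funext => x; rewrite mulrC.
by apply: f_equal; apply: f_equal; apply/funext => x; rewrite dotvC.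
Qed.

Lemma wgrad_dotv_adm p q K : K \in elts M -> spoly p -> spoly q ->
  bmeas (cell K) (fun x => dotv (wgrad m p K x) (wgrad m q K x)).
Proof.
by move=> KM rp rq; apply: (adm_dotv (cell_integration (nM KM))) => i; exact: wgrad_adm.
Qed.

Lemma wgrad_form_lin q : spoly q -> form_linear spoly scomb (wgrad_form ^~ q).
Proof.
move=> rq c p p1 p2 rp r1 r2 eq; apply: (sum_cell_lin nM) => K KM; split.
- exact: wgrad_dotv_adm.
- exact: wgrad_dotv_adm.
- move=> x Kx; rewrite (wgrad_lin (nM KM) m _ _ _ (eq K KM) Kx) ?dotvDl ?dotvZl//;
  exact: spoly_regular.
Qed.

Lemma pressure_form_lin q : spoly q -> form_linear spoly scomb (pressure_form ^~ q).
Proof.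
move=> rq c p p1 p2 rp r1 r2 eq; apply: combine_add.
  apply: (sum_cell_lin nM) => K KM; have HK := cell_integration (nM KM).
  have [b _] := spoly_regular nM KM rq; have [b1 _] := spoly_regular nM KM r1.
  have [b2 _] := spoly_regular nM KM r2; split; [exact: (adm_mul HK b1 b)|exact: (adm_mul HK b2 b)|].
  by move=> x Kx; have [-> // _] := eq K KM; ring.
rewrite mulr_sumr -big_split/=; apply: eq_bigr => K KM; apply: combine_scale.
apply: (int_lin_ext (cell_integration (nM KM))) => [x Kx||].
- rewrite (wgrad_lin (nM KM) m _ _ _ (eq K KM) Kx) ?dotvDl ?dotvZl//;
  exact: spoly_regular.
- exact: wgrad_dotv_adm.
- exact: wgrad_dotv_adm.
Qed.

Lemma wgrad_form_psd : psd_on Q wgrad_form.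
Proof.
split.
- by move=> p q _ _; exact: wgrad_formC.
- by move=> q Qq; apply: form_linear_on_Qh; apply: wgrad_form_lin; exact: (Qh_spoly Qq).
- move=> q Qq; apply: sumr_ge0 => K KM; apply: (int_ge0 (cell_integration (nM KM))).
    by apply: wgrad_dotv_adm => //; exact: (Qh_spoly Qq).
  by move=> x _; exact: dotv_ge0.
Qed.

Lemma cell_volume_gt0 K : K \in elts M -> 0 < int_cell K (cst 1).
Proof.
move=> KM; have HK := cell_integration (nM KM).
rewrite lt_neqAle eq_sym andbC; apply/andP; split.
  by apply: (int_ge0 HK) => [|x _ /=]; [exact: bmeas_cst|exact: ler01].
apply/eqP => v0; have [cK _] := nM KM.
have [b bK] : exists b, b \in K by apply/card_gt0P; rewrite cK.
have e : peval (pC 1) = cst 1 :> (pt -> R) by apply/funext => x; rewrite pevalC.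
suff : peval (pC 1) (pos b) = 0 by rewrite pevalC => /eqP; rewrite oner_eq0.
apply: (int_def HK (p := pC 1)); [by move=> x _; rewrite pevalC ler01|by rewrite e|].
exact: vertex_in_cell.
Qed.

Lemma int_dotv_eq0 K (g : pt -> pt) : K \in elts M ->
  (forall i, Pol m (cell K) (fun x => g x 0 i)) ->
  int_cell K (fun x => dotv (g x) (g x)) = 0 -> forall x, cell K x -> g x = 0.
Proof.
move=> KM Pg g0 x Kx; have HK := cell_integration (nM KM); apply/rowP => i; rewrite mxE.
have Ng j : bmeas (cell K) (fun x => g x 0 j * g x 0 j).
  by apply: (adm_mul HK); exact: (Pol_adm HK (Pg j)).
move: g0; rewrite [LHS](int_sum HK)// => s0.
apply: (int_sqr_eq0 HK (Pg i) _ Kx).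
apply: (sum_eq0_ge0 _ s0) => // j _; apply: (int_ge0 HK) => // y _.
by rewrite -expr2 sqr_ge0.
Qed.

(* Across a shared face both constants equal the value of q_b there. *)
Lemma wgrad_form_null q : Q q -> wgrad_form q q = 0 -> szero q.
Proof.
move=> Qq q0; have rq := Qh_spoly Qq; have [P1 P2 P3] := Qq.
have W0 K : K \in elts M -> forall x, cell K x -> wgrad m q K x = 0.
  move=> KM; have [Pw _] := wgrad_spec (nM KM) m (spoly_regular nM KM rq).
  apply: int_dotv_eq0 => //; apply: (sum_eq0_ge0 _ q0 KM) => K' K'M.
  apply: (int_ge0 (cell_integration (nM K'M))); first exact: wgrad_dotv_adm.
  by move=> x _; exact: dotv_ge0.
have ex K : exists c, K \in elts M -> (forall x, cell K x -> q.1 K x = c) /\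
    forall z, z \in K -> forall x, cell (K :\ z) x -> q.2 (K :\ z) x = c.
  have [KM|] := boolP (K \in elts M); last by exists 0.
  have [|c cP] := wgrad_zero_const (nM KM) m0 (P1 K KM) _ (W0 K KM); last by exists c.
  by move=> z zK; apply: P2; exact: face_in_faces.
have [c cP] := choice ex.
have cst_c : forall K K', K \in elts M -> K' \in elts M -> c K = c K'.
  apply: (mesh_connected oO cO hM) => K K' KM K'M cKK'.
  (* A cell has n + 2 vertices, one more than the intersection, which is therefore the face opposite
     to the remaining vertex. *)
  have face L : L \in elts M -> K :&: K' \subset L -> exists2 z, z \in L & L :\ z = K :&: K'.
    move=> LM sub; have [cL _] := nM LM.
    have : #|L :\: (K :&: K')| == 1%N.
      by rewrite cardsDS// cL cKK' subSnn.
    move=> /cards1P[z zE]; exists z.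
      by have := finset.set11 z; rewrite -zE finset.inE => /andP[].
    by rewrite -zE finset.setDDr finset.setDv finset.set0U; apply/finset.setIidPr.
  have [z zK zE] := face K KM (finset.subsetIl _ _).
  have [z' zK' zE'] := face K' K'M (finset.subsetIr _ _).
  have [b bI] : exists b, b \in K :&: K' by apply/card_gt0P; rewrite cKK'.
  have [_ /(_ z zK (pos b))] := cP K KM; have [_ /(_ z' zK' (pos b))] := cP K' K'M.
  by rewrite zE zE' => h1 h2; rewrite -h1 ?h2//; exact: vertex_in_cell.
move=> K KM.
suff cK0 : c K = 0 by have [e1 e2] := cP K KM; rewrite -cK0; split.
(* The vanishing integral of q_i is the common constant times the total volume of the cells, which
   is positive. *)
move: P3; rewrite (eq_bigr (fun L => c K * int_cell L (cst 1))) => [|L LM].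
  rewrite -mulr_sumr => /eqP; rewrite mulf_eq0 => /orP[/eqP //|/eqP s0].
  have := cell_volume_gt0 KM; rewrite (sum_eq0_ge0 _ s0 KM) ?ltxx// => L LM.
  by apply: ltW; exact: cell_volume_gt0.
have HL := cell_integration (nM LM).
rewrite -(intZ HL); last exact: bmeas_cst.
apply: (int_ext HL); last by case: (spoly_regular nM LM rq).
by move=> x Lx; have [-> // _] := cP L LM; rewrite mulr1; exact: cst_c.
Qed.

Definition gradient_field (q : scalar) : vector := (fun K x => wgrad m q K x, fun _ _ => 0).

(** The weak gradient in b_h has order m, exactly the degree of the cell values in V_h, and zero
    face values meet the boundary condition. *)
Lemma Vh_gradient_field q : Q q -> V (gradient_field q).
Proof.
move=> Qq; have rq := Qh_spoly Qq; split=> //.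
  by move=> K KM i; have [Pw _] := wgrad_spec (nM KM) m (spoly_regular nM KM rq); exact: Pw.
by move=> e _ i; apply: Pol_ext (Pol_cst _ k 0) => x _; rewrite mxE.
Qed.

Lemma gradient_field_comb c q q1 q2 : spoly q -> spoly q1 -> spoly q2 -> scomb c q q1 q2 ->
  vcomb c (gradient_field q) (gradient_field q1) (gradient_field q2).
Proof.
move=> rq r1 r2 eq K KM i; split=> [x Kx|z zK x Kx] /=; last by rewrite !mxE mulr0 addr0.
by rewrite (wgrad_lin (nM KM) m _ _ _ (eq K KM) Kx) ?mxE//; exact: spoly_regular.
Qed.

(** The energy of the gradient fields is a bilinear form of the pressures and ignores the kernel of
    [wgrad_form], which by [wgrad_form_null] consists of functions vanishing on the mesh; hence the
    finite-rank bound. *)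
Lemma energy_gradient_field : exists2 B, 0 <= B & forall q, Q q ->
  normV m k (gradient_field q) <= B * Num.sqrt (wgrad_form q q).
Proof.
pose T (p q : scalar) := energy m k (gradient_field p) (gradient_field q).
have lin q : Q q -> linear_on Q (T^~ q).
  move=> Qq c p1 p2 Q1 Q2; apply: (energy_lin nM m k (Vh_vpoly (Vh_gradient_field Qq))).
  - by apply: Vh_vpoly; apply: Vh_gradient_field; apply: subspace_Qh.2.
  - exact: Vh_vpoly (Vh_gradient_field Q1).
  - exact: Vh_vpoly (Vh_gradient_field Q2).
  - apply: gradient_field_comb => //; [|exact: (Qh_spoly Q1)|exact: (Qh_spoly Q2)].
    exact: (Qh_spoly (subspace_Qh.2 c p1 p2 Q1 Q2)).
have TC p q : T p q = T q p by exact: energyC.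
have [B B0 BP] : exists2 B, 0 <= B & forall p q, Q p -> Q q ->
    `|T p q| <= B * Num.sqrt (wgrad_form p p) * Num.sqrt (wgrad_form q q).
  apply: (bilinear_bound subspace_Qh wgrad_form_psd).
  - apply: finite_rank_Qh => q rq zq.
    exact: (form_linear_szero (wgrad_form_lin rq) rq zq).
  - exact: lin.
  - by move=> q Qq c p1 p2 Q1 Q2; rewrite !(TC q); exact: lin.
  - move=> z q Qz Qq /(wgrad_form_null Qz) zz.
    suff e : T z q = 0 by rewrite e TC e.
    have rv := Vh_vpoly (Vh_gradient_field Qz).
    apply: (form_linear_vzero (energy_lin nM m k (Vh_vpoly (Vh_gradient_field Qq))) rv).
    move=> i K KM; split=> [x Kx|z' zK x Kx] /=; last by rewrite mxE.
    have rz := spoly_regular nM KM (Qh_spoly Qz).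
    have : wcombination K 1 z z z.
      by have [h1 h2] := zz K KM; split=> [y Ky|w wK y Ky]; rewrite ?h1 ?h2// mulr0 addr0.
    move=> /(wgrad_lin (nM KM) m rz rz rz) /(_ x Kx).
    by rewrite scale1r => /eqP; rewrite -subr_eq0 opprD addNKr oppr_eq0 => /eqP ->; rewrite mxE.
exists (Num.sqrt B); first exact: sqrtr_ge0.
move=> q Qq; have -> : Num.sqrt (wgrad_form q q) = Num.sqrt (Num.sqrt (wgrad_form q q) ^+ 2).
  by rewrite sqrtr_sqr ger0_norm// sqrtr_ge0.
rewrite -sqrtrM//; apply: ler_wsqrtr; apply: (le_trans (ler_norm _)).
by rewrite expr2 mulrA; exact: BP.
Qed.

(** Equivalence of norms in finite dimension: on Q_h the weak gradient alone is already a norm. *)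
Lemma normQ_wgrad_form : exists2 B, 0 <= B & forall q, Q q ->
  normQ m q <= B * Num.sqrt (wgrad_form q q).
Proof.
have [B B0 BP] : exists2 B, 0 <= B & forall p q, Q p -> Q q ->
    `|pressure_form p q| <= B * Num.sqrt (wgrad_form p p) * Num.sqrt (wgrad_form q q).
  apply: (bilinear_bound subspace_Qh wgrad_form_psd).
  - apply: finite_rank_Qh => q rq zq.
    exact: (form_linear_szero (wgrad_form_lin rq) rq zq).
  - by move=> q Qq; apply: form_linear_on_Qh; apply: pressure_form_lin; exact: (Qh_spoly Qq).
  - move=> q Qq c p1 p2 Q1 Q2; rewrite !(pressure_formC q).
    have lq : linear_on Q (pressure_form^~ q).
      by apply: form_linear_on_Qh; apply: pressure_form_lin; exact: (Qh_spoly Qq).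
    exact: (lq c p1 p2 Q1 Q2).
  - move=> z q Qz Qq /(wgrad_form_null Qz) zz.
    suff e : pressure_form z q = 0 by rewrite e pressure_formC e.
    exact: (form_linear_szero (pressure_form_lin (Qh_spoly Qq)) (Qh_spoly Qz) zz).
exists (Num.sqrt B); first exact: sqrtr_ge0.
move=> q Qq; have -> : Num.sqrt (wgrad_form q q) = Num.sqrt (Num.sqrt (wgrad_form q q) ^+ 2).
  by rewrite sqrtr_sqr ger0_norm// sqrtr_ge0.
rewrite -sqrtrM//; apply: ler_wsqrtr; apply: (le_trans (ler_norm _)).
by rewrite expr2 mulrA; exact: BP.
Qed.

(* b_h(v, q) is the squared norm of the weak gradient of q at
   v = {grad_w q, 0}. *)
Lemma pressure_stability : exists2 B, 0 <= B & forall q D, Q q -> 0 <= D ->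
  (forall v, V v -> bh m v q <= D * normV m k v) -> normQ m q <= B * D.
Proof.
have [B1 B10 h1] := energy_gradient_field; have [B2 B20 h2] := normQ_wgrad_form.
exists (B2 * B1); first exact: mulr_ge0.
move=> q D Qq D0 hb; apply: (le_trans (h2 q Qq)); rewrite -mulrA ler_wpM2l//.
have [_ _ /(_ q Qq) w0] := wgrad_form_psd.
have : Num.sqrt (wgrad_form q q) ^+ 2 <= D * normV m k (gradient_field q).
  by rewrite sqr_sqrtr//; exact: (hb _ (Vh_gradient_field Qq)).
move: (h1 q Qq) (sqrtr_ge0 (wgrad_form q q)).
move: (normV _ _ _) (Num.sqrt (wgrad_form q q)) => a s hs s0 hd.
have [->|sn] := eqVneq s 0; first by rewrite mulr_ge0.
have sp : 0 < s by rewrite lt_neqAle eq_sym sn.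
have : s * s <= B1 * D * s.
  rewrite -expr2; apply: (le_trans hd); apply: (le_trans (ler_wpM2l D0 hs)).
  by rewrite mulrA (mulrC D).
by rewrite ler_pM2r.
Qed.

End pressure_space.

(** * Bounds by generalised Hoelder inequalities *)

Section power_inequalities.
Context {R : realType}.
Implicit Types (a b e r s S x y : R).

(** The inequality ln t <= t - 1 at t = a^r / S. The scale S is free; at the weighted mean the terms
    t - 1 cancel in the sum. *)
Lemma powR_le_expR a e r S : 0 < r -> 0 < S -> 0 <= e -> 0 <= a ->
  a `^ e <= expR (e / r * (ln S + (a `^ r / S - 1))).
Proof.
move=> r0 S0 e0 a0; have [->|an0] := eqVneq a 0.
  have [->|en0] := eqVneq e 0; first by rewrite powRr0 mul0r mul0r expR0.
  by rewrite powR0// ltW// expR_gt0.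
have ap : 0 < a by rewrite lt_neqAle eq_sym an0.
have yp : 0 < a `^ r := powR_gt0 r ap.
have -> : a `^ e = expR (e / r * ln (a `^ r)).
  rewrite ln_powR mulrA divfK ?gt_eqF//.
  by rewrite -ln_powR lnK// posrE powR_gt0.
rewrite ler_expR ler_wpM2l ?divr_ge0 ?(ltW r0)//.
have tp : 0 < a `^ r / S by rewrite divr_gt0.
rewrite [X in ln X <= _](_ : a `^ r = S * (a `^ r / S)); last first.
  by rewrite mulrCA mulfV ?mulr1// gt_eqF.
rewrite lnM ?posrE// lerD2l.
move: (a `^ r / S) tp => t tp.
rewrite -(expRK (t - 1)) ler_ln ?posrE ?expR_gt0//.
by have := expR_ge1Dx (t - 1); rewrite addrC subrK.
Qed.

(** Weighted arithmetic-geometric mean inequality for the a_i^r with weights e_i / r. S is the mean,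
    and the exponents supplied by [powR_le_expR] add up to ln S. *)
Lemma weighted_young (I : finType) (e a : I -> R) r : 0 < r ->
  (forall i, 0 <= e i) -> (forall i, 0 <= a i) -> \sum_i e i = r ->
  \prod_i a i `^ e i <= r^-1 * \sum_i e i * a i `^ r.
Proof.
move=> r0 e0 a0 er; set S := r^-1 * _.
have t0 i : 0 <= e i * a i `^ r by rewrite mulr_ge0// powR_ge0.
have S0 : 0 <= S by rewrite mulr_ge0 ?invr_ge0 ?(ltW r0)// sumr_ge0.
have [Sz|Sn0] := eqVneq S 0.
  have [i ei] : exists i, 0 < e i.
    apply: contrapT => h; move: r0; rewrite -er big1 ?ltxx// => i _.
    by apply/eqP; rewrite eq_le e0 andbT leNgt; apply/negP => ei; apply: h; exists i.
  have s0 : \sum_i e i * a i `^ r = 0.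
    by apply/eqP; move/eqP: Sz; rewrite mulf_eq0 invr_eq0 gt_eqF.
  have /eqP := sum_eq0_ge0 (P := predT) (fun i _ => t0 i) s0 (i := i) isT.
  rewrite mulf_eq0 gt_eqF//= powR_eq0 => /andP[/eqP ai _].
  by rewrite (bigD1 i)//= ai powR0 ?gt_eqF// mul0r.
have Sp : 0 < S by rewrite lt_neqAle eq_sym Sn0.
apply: (@le_trans _ _ (\prod_i expR (e i / r * (ln S + (a i `^ r / S - 1))))).
  by apply: ler_prod => i _; rewrite powR_ge0; exact: powR_le_expR.
rewrite -expR_sum.
have -> : \sum_i (e i / r * (ln S + (a i `^ r / S - 1))) = ln S.
  have -> : \sum_i (e i / r * (ln S + (a i `^ r / S - 1))) =
      (\sum_i e i) * ((ln S - 1) / r) + (\sum_i e i * a i `^ r) / (r * S).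
    rewrite !mulr_suml -big_split/=; apply: eq_bigr => i _.
    by field; rewrite !gt_eqF.
  rewrite er; have -> : \sum_i e i * a i `^ r = r * S by rewrite /S mulrA mulfV ?mul1r// gt_eqF.
  by field; rewrite !gt_eqF.
by rewrite lnK.
Qed.

Lemma powR_swap s x y : 0 <= s <= 1 -> 0 <= x -> x <= y -> y `^ s * x <= x `^ s * y.
Proof.
move=> /andP[s0 s1] x0 xy; have y0 := le_trans x0 xy.
have [->|xn0] := eqVneq x 0; first by rewrite mulr0 mulr_ge0// powR_ge0.
have xp : 0 < x by rewrite lt_neqAle eq_sym xn0.
have yp := lt_le_trans xp xy.
have split z : 0 < z -> z = z `^ s * z `^ (1 - s).
  move=> zp; rewrite -powRD; last by rewrite (gt_eqF zp) implybT.
  by rewrite addrC subrK powRr1// ltW.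
have -> : y `^ s * x = y `^ s * (x `^ s * x `^ (1 - s)) by rewrite -split.
have -> : x `^ s * y = x `^ s * (y `^ s * y `^ (1 - s)) by rewrite -split.
rewrite mulrCA ler_wpM2l ?powR_ge0//.
by rewrite ler_wpM2l ?powR_ge0// ge0_ler_powR ?nnegrE ?subr_ge0.
Qed.

(** In both orderings of a and b this reduces to the monotonicity of z^(1 - s). With s = r - 2 it
    covers r < 3, without any negative power. *)
Lemma powR_diff_small s a b : 0 <= s <= 1 -> 0 <= a -> 0 <= b ->
  `|a `^ s - b `^ s| * b <= b `^ s * `|a - b|.
Proof.
move=> s01 a0 b0; have [ab|ba] := leP a b.
  have h : a `^ s <= b `^ s by rewrite ge0_ler_powR ?nnegrE//; case/andP: s01.
  rewrite distrC ger0_norm ?subr_ge0// distrC ger0_norm ?subr_ge0//.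
  rewrite mulrBl mulrBr lerB//.
  have := powR_swap s01 a0 ab; lra.
have h : b `^ s <= a `^ s by rewrite ge0_ler_powR ?nnegrE ?(ltW ba)//; case/andP: s01.
rewrite ger0_norm ?subr_ge0// ger0_norm ?subr_ge0 ?(ltW ba)//.
by rewrite mulrBl mulrBr lerB// powR_swap// ltW.
Qed.

(** The second inequality of [power_constant] at y = 0 and a nonzero x. *)
Lemma power_constant_ge1 n r C : power_constant n.+1 r C -> 1 <= C.
Proof.
move=> hC; pose x : 'rV[R]_n.+1 := delta_mx 0 0.
have x0 : enorm x != 0.
  by rewrite enorm_eq0; apply/eqP => /rowP/(_ 0)/eqP; rewrite !mxE eqxx oner_eq0.
have xp : 0 < enorm x by rewrite lt_neqAle eq_sym x0 enorm_ge0.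
have e0 : enorm (0 : 'rV[R]_n.+1) = 0 by apply/eqP; rewrite enorm_eq0.
have [_ + _] := hC x 0; rewrite scaler0 !subr0 e0 addr0 enormZ ger0_norm ?powR_ge0//.
rewrite -mulrA -[leLHS]mul1r ler_pM2r// mulr_gt0//.
by rewrite powR_gt0.
Qed.

End power_inequalities.

Section hoelder_mesh.
Context {R : realType} {n : nat} {M : mesh R n.+1}.
Local Notation pos := (@pos R n.+1 M).
Local Notation pt := 'rV[R]_n.+1.
Local Notation mfun := ({set vtx M} -> pt -> R).
Hypothesis nM : forall K, K \in elts M -> nsimplex pos K.

Definition mesh_int (g : mfun) : R := \sum_(K in elts M) int_cell K (g K).
Definition mesh_adm (g : mfun) := forall K, K \in elts M -> bmeas (cell K) (g K).

Lemma mesh_int_le (g h : mfun) : mesh_adm g -> mesh_adm h ->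
  (forall K x, K \in elts M -> cell K x -> g K x <= h K x) ->
  mesh_int g <= mesh_int h.
Proof.
move=> ag ah gh; apply: ler_sum => K KM.
by apply: (int_le (cell_integration (nM KM)) (ag K KM) (ah K KM)) => x; exact: gh.
Qed.

Lemma mesh_int_comb (I : finType) (c : I -> R) (g : I -> mfun) :
  (forall i, mesh_adm (g i)) ->
  mesh_int (fun K x => \sum_i c i * g i K x) = \sum_i c i * mesh_int (g i).
Proof.
move=> ag; under [RHS]eq_bigr do rewrite mulr_sumr.
rewrite exchange_big/=; apply: eq_bigr => K KM; have HK := cell_integration (nM KM).
rewrite (int_sum HK) => [|i]; last by apply: (admZ HK); exact: ag.
by apply: eq_bigr => i _; rewrite (intZ HK)//; exact: ag.
Qed.

Lemma adm_prod (J : Type) (s : seq J) (F : J -> mfun) : (forall j, mesh_adm (F j)) ->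
  mesh_adm (fun K x => \prod_(j <- s) F j K x).
Proof. by move=> aF K KM; apply: bmeas_prod => j; exact: aF. Qed.

Lemma mesh_adm_powR (g : mfun) s : 0 <= s -> mesh_adm g ->
  (forall K x, K \in elts M -> cell K x -> 0 <= g K x) ->
  mesh_adm (fun K x => g K x `^ s).
Proof. by move=> s0 ag g0 K KM; apply: bmeas_powR => //; [exact: ag|move=> x; exact: g0]. Qed.

(** Young's inequality for the normalised factors f_i / A_i, then integration. Positive upper bounds
    A_i in place of the norms allow this division even if a norm is zero; since the exponents add up
    to r, only L^r norms occur. *)
Lemma hoelder_mesh (I : finType) (e A : I -> R) (f : I -> mfun) r : 0 < r ->
  (forall i, 0 <= e i) -> \sum_i e i = r -> (forall i, mesh_adm (f i)) ->
  (forall i K x, K \in elts M -> cell K x -> 0 <= f i K x) -> (forall i, 0 < A i) ->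
  (forall i, mesh_int (fun K x => f i K x `^ r) <= A i `^ r) ->
  mesh_int (fun K x => \prod_i f i K x `^ e i) <= \prod_i A i `^ e i.
Proof.
move=> r0 e0 er af f0 A0 fA; set P := \prod_i A i `^ e i.
have P0 : 0 <= P by apply: prodr_ge0 => i _; exact: powR_ge0.
have afr i : mesh_adm (fun K x => f i K x `^ r).
  by apply: mesh_adm_powR => //; [exact: ltW|exact: f0].
pose c i := P * r^-1 * e i / A i `^ r.
apply: (@le_trans _ _ (mesh_int (fun K x => \sum_i c i * f i K x `^ r))).
  apply: mesh_int_le.
  - by apply: adm_prod => i; apply: mesh_adm_powR => //; exact: f0.
  - move=> K KM; apply: bmeas_sum => i; apply: bmeasZ; exact: afr.
  move=> K x KM Kx.
  have g0 i : 0 <= f i K x / A i by rewrite divr_ge0 ?f0 ?(ltW (A0 i)).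
  have -> : \prod_i f i K x `^ e i = P * \prod_i (f i K x / A i) `^ e i.
    rewrite -big_split/=; apply: eq_bigr => i _; rewrite -powRM ?(ltW (A0 i))//.
    by rewrite mulrCA mulfV ?mulr1// gt_eqF.
  apply: (le_trans (ler_wpM2l P0 (weighted_young r0 e0 g0 er))).
  rewrite !mulr_sumr le_eqVlt; apply/orP; left; apply/eqP; apply: eq_bigr => i _.
  rewrite powRM ?f0// ?invr_ge0 ?(ltW (A0 i))//.
  have -> : (A i)^-1 `^ r = (A i `^ r)^-1.
    by rewrite -powR_inv1 ?(ltW (A0 i))// -powRrM mulN1r powRN.
  rewrite /c; ring.
rewrite mesh_int_comb//.
apply: (@le_trans _ _ (\sum_i P * r^-1 * e i)).
  apply: ler_sum => i _; rewrite /c -mulrA -[leRHS]mulr1 ler_wpM2l//.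
    by rewrite !mulr_ge0// invr_ge0 ltW.
  by rewrite mulrC ler_pdivrMr ?powR_gt0// mul1r.
by rewrite -mulr_sumr er divfK// gt_eqF.
Qed.

Lemma hoelder3 (A B C r : R) (f g h : mfun) : 2 <= r ->
  0 < A -> 0 < B -> 0 < C -> mesh_adm f -> mesh_adm g -> mesh_adm h ->
  (forall K x, 0 <= f K x) -> (forall K x, 0 <= g K x) -> (forall K x, 0 <= h K x) ->
  mesh_int (fun K x => f K x `^ r) <= A `^ r -> mesh_int (fun K x => g K x `^ r) <= B `^ r ->
  mesh_int (fun K x => h K x `^ r) <= C `^ r ->
  mesh_int (fun K x => f K x `^ (r - 2) * (g K x * h K x)) <= A `^ (r - 2) * (B * C).
Proof.
move=> r2 A0 B0 C0 af ag ah f0 g0 h0 fA gB hC.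
have := @hoelder_mesh 'I_3 (fun i => nth 0 [:: r - 2; 1; 1] i) (fun i => nth 0 [:: A; B; C] i)
  (fun i => nth f [:: f; g; h] i) r.
rewrite !big_ord_recl !big_ord0/= !powRr1 ?(ltW B0) ?(ltW C0)// mulr1.
have -> : (fun K x => \prod_(i < 3) nth f [:: f; g; h] i K x `^ nth 0 [:: r - 2; 1; 1] i) =
    (fun K x => f K x `^ (r - 2) * (g K x * h K x)).
  apply/funext => K; apply/funext => x; rewrite !big_ord_recl !big_ord0/=.
  by rewrite !powRr1 ?mulr1.
have all3 (P : 'I_3 -> Prop) : P ord0 -> P (lift ord0 ord0) -> P (lift ord0 (lift ord0 ord0)) ->
    forall i, P i.
  move=> p0 p1 p2 [[|[|[|//]]] hi].
  - by rewrite (_ : Ordinal hi = ord0)//; exact: val_inj.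
  - by rewrite (_ : Ordinal hi = lift ord0 ord0)//; exact: val_inj.
  - by rewrite (_ : Ordinal hi = lift ord0 (lift ord0 ord0))//; exact: val_inj.
apply.
- exact: lt_le_trans (ltr0n R 2) r2.
- by apply: all3 => /=; rewrite ?ler01// subr_ge0.
- by rewrite addr0 subrK.
- exact: all3.
- by apply: all3 => /= K x _ _.
- exact: all3.
- exact: all3.
Qed.

Lemma hoelder4 (A B C D r : R) (f g h l : mfun) : 3 <= r ->
  0 < A -> 0 < B -> 0 < C -> 0 < D ->
  mesh_adm f -> mesh_adm g -> mesh_adm h -> mesh_adm l ->
  (forall K x, 0 <= f K x) -> (forall K x, 0 <= g K x) ->
  (forall K x, 0 <= h K x) -> (forall K x, 0 <= l K x) ->
  mesh_int (fun K x => f K x `^ r) <= A `^ r -> mesh_int (fun K x => g K x `^ r) <= B `^ r ->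
  mesh_int (fun K x => h K x `^ r) <= C `^ r -> mesh_int (fun K x => l K x `^ r) <= D `^ r ->
  mesh_int (fun K x => f K x `^ (r - 3) * (g K x * (h K x * l K x))) <=
    A `^ (r - 3) * (B * (C * D)).
Proof.
move=> r3 A0 B0 C0 D0 af ag ah al f0 g0 h0 l0 fA gB hC lD.
have := @hoelder_mesh 'I_4 (fun i => nth 0 [:: r - 3; 1; 1; 1] i)
  (fun i => nth 0 [:: A; B; C; D] i) (fun i => nth f [:: f; g; h; l] i) r.
rewrite !big_ord_recl !big_ord0/= !powRr1 ?(ltW B0) ?(ltW C0) ?(ltW D0)// mulr1.
have -> : (fun K x => \prod_(i < 4) nth f [:: f; g; h; l] i K x `^ nth 0 [:: r - 3; 1; 1; 1] i) =
    (fun K x => f K x `^ (r - 3) * (g K x * (h K x * l K x))).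
  apply/funext => K; apply/funext => x; rewrite !big_ord_recl !big_ord0/=.
  by rewrite !powRr1 ?mulr1.
have all4 (P : 'I_4 -> Prop) : P ord0 -> P (lift ord0 ord0) -> P (lift ord0 (lift ord0 ord0)) ->
    P (lift ord0 (lift ord0 (lift ord0 ord0))) -> forall i, P i.
  move=> p0 p1 p2 p3 [[|[|[|[|//]]]] hi].
  - by rewrite (_ : Ordinal hi = ord0)//; exact: val_inj.
  - by rewrite (_ : Ordinal hi = lift ord0 ord0)//; exact: val_inj.
  - by rewrite (_ : Ordinal hi = lift ord0 (lift ord0 ord0))//; exact: val_inj.
  - by rewrite (_ : Ordinal hi = lift ord0 (lift ord0 (lift ord0 ord0)))//; exact: val_inj.
apply.
- exact: lt_le_trans (ltr0n R 3) r3.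
- by apply: all4 => /=; rewrite ?ler01// subr_ge0.
- by rewrite addr0 -(natrD R 1 1) -(natrD R 1 2) subrK.
- exact: all4.
- by apply: all4 => /= K x _ _.
- exact: all4.
- exact: all4.
Qed.

End hoelder_mesh.

Section reaction_bounds.
Context {R : realType} {n : nat} {M : mesh R n.+1}.
Local Notation pos := (@pos R n.+1 M).
Local Notation pt := 'rV[R]_n.+1.
Local Notation vector := (wfun M pt).
Local Notation mfun := ({set vtx M} -> pt -> R).
Hypothesis nM : forall K, K \in elts M -> nsimplex pos K.
Variables (Omega : set pt) (m k : nat) (r C : R) (r2 : 2 <= r) (C0 : 0 < C).
Hypothesis embedding : forall v : vector, Vh Omega m k v -> Lr_norm r v <= C * normV m k v.
Local Notation V := (Vh Omega m k : vector -> Prop).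
Local Notation N := (normV m k).

Lemma mesh_int_norm (g h : mfun) : mesh_adm g -> mesh_adm h ->
  (forall K x, K \in elts M -> cell K x -> `|g K x| <= h K x) ->
  `|mesh_int g| <= mesh_int h.
Proof.
move=> ag ah gh; apply: (le_trans (ler_norm_sum _ _ _)); apply: ler_sum => K KM.
have HK := cell_integration (nM KM); rewrite ler_norml; apply/andP; split.
  rewrite -mulN1r -(intZ HK); last exact: ah.
  apply: (int_le HK); [by apply: (admZ HK); exact: ah|exact: ag|].
  by move=> x /(gh K x KM); rewrite mulN1r ler_norml => /andP[].
apply: (int_le HK); [exact: ag|exact: ah|].
by move=> x /(gh K x KM); rewrite ler_norml => /andP[].
Qed.

Lemma Vh_sub (u v : vector) : V u -> V v -> V (wfun_sub u v).
Proof. exact: (subspaceB (subspace_Vh Omega m k)). Qed.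

Lemma enorm_mesh_adm v : V v -> mesh_adm (fun K x => enorm (v.1 K x)).
Proof. by move=> Vv K KM; apply: enorm_adm => //; exact: Vh_vpoly Vv. Qed.

Lemma Lr_bound v B : V v -> N v <= B ->
  mesh_int (fun K x => enorm (v.1 K x) `^ r) <= (C * B) `^ r.
Proof.
move=> Vv vB; have r0 : 0 < r := lt_le_trans (ltr0n R 2) r2.
have J0 : 0 <= mesh_int (fun K x => enorm (v.1 K x) `^ r).
  apply: sumr_ge0 => K KM; apply: (int_ge0 (cell_integration (nM KM))).
    exact: (Lr_integrand_adm nM r2 KM (Vh_vpoly Vv)).
  by move=> x _; exact: powR_ge0.
have h : mesh_int (fun K x => enorm (v.1 K x) `^ r) `^ r^-1 <= C * B.
  exact: le_trans (embedding Vv) (ler_wpM2l (ltW C0) vB).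
have -> : mesh_int (fun K x => enorm (v.1 K x) `^ r) =
    (mesh_int (fun K x => enorm (v.1 K x) `^ r) `^ r^-1) `^ r.
  by rewrite -powRrM mulVf ?gt_eqF// powRr1.
apply: ge0_ler_powR => //; first exact: ltW.
  by rewrite nnegrE powR_ge0.
by rewrite nnegrE; apply: le_trans h; exact: powR_ge0.
Qed.

Lemma scale_hoelder3 A X Y : 0 < A ->
  (C * A) `^ (r - 2) * (C * X * (C * Y)) = C `^ r * (A `^ (r - 2) * X * Y).
Proof.
move=> A0; rewrite powRM ?(ltW A0) ?(ltW C0)//.
have -> : C `^ r = C `^ (r - 2) * (C * C).
  rewrite -expr2 -powR_mulrn ?(ltW C0)// -powRD ?subrK//.
  by rewrite (gt_eqF C0) implybT.
by ring.
Qed.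

Lemma scale_hoelder4 A X Y : 0 < A ->
  (C * A) `^ (r - 3) * (C * X * (C * A * (C * Y))) = C `^ r * (A `^ (r - 2) * X * Y).
Proof.
move=> A0; rewrite -(scale_hoelder3 X Y A0).
have -> : (C * A) `^ (r - 2) = (C * A) `^ (r - 3) * (C * A).
  have CA : 0 < C * A by rewrite mulr_gt0.
  have -> : r - 2 = (r - 3) + 1 by ring.
  by rewrite powRD ?powRr1 ?(ltW CA)// (gt_eqF CA) implybT.
by ring.
Qed.

Variables (alpha : R) (a0 : 0 < alpha).

Lemma ch_bound w u v A X Y : V w -> V u -> V v -> N w <= A -> N u <= X -> N v <= Y ->
  0 < A -> 0 < X -> 0 < Y ->
  `|ch alpha r w u v| <= alpha * (C `^ r * (A `^ (r - 2) * X * Y)).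
Proof.
move=> Vw Vu Vv wA uX vY A0 X0 Y0.
rewrite /ch normrM (gtr0_norm a0) ler_pM2l// -scale_hoelder3//.
pose h : mfun := fun K x => enorm (w.1 K x) `^ (r - 2) * (enorm (u.1 K x) * enorm (v.1 K x)).
have rs : 0 <= r - 2 by rewrite subr_ge0.
have ah : mesh_adm h.
  move=> K KM; apply: bmeasM; last by apply: bmeasM; exact: enorm_mesh_adm.
  exact: (mesh_adm_powR rs (enorm_mesh_adm Vw) (fun _ _ _ _ => enorm_ge0 _) KM).
apply: (@le_trans _ _ (mesh_int h)).
  apply: mesh_int_norm => //.
    by move=> K KM; apply: ch_integrand_adm => //; [exact: Vh_vpoly Vw|exact: Vh_vpoly Vu|exact: Vh_vpoly Vv].
  move=> K x KM Kx; rewrite normrM ger0_norm ?powR_ge0// ler_wpM2l ?powR_ge0//.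
  exact: dotv_cs.
apply: hoelder3 => //; rewrite ?mulr_gt0//; try exact: enorm_mesh_adm;
  try (by move=> *; exact: enorm_ge0); exact: Lr_bound.
Qed.

Variables (Cr : R) (hCr : power_constant n.+1 r Cr).

(** For r >= 3 the first inequality of C_r is multiplied by |y| |v|. For r < 3 its powers are
    singular at 0 and [powR_diff_small] is used instead; its constant 1 is enlarged to 2 C_r, so
    both cases end with the same factor. *)
Lemma power_diff (x y v : pt) :
  `|enorm x `^ (r - 2) - enorm y `^ (r - 2)| * `|dotv y v| <=
  if r < 3 then 2 * Cr * (enorm y `^ (r - 2) * (enorm (x - y) * enorm v))
  else Cr * (enorm x `^ (r - 3) * (enorm (x - y) * (enorm y * enorm v))) +
       Cr * (enorm y `^ (r - 3) * (enorm (x - y) * (enorm y * enorm v))).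
Proof.
have C1 := power_constant_ge1 hCr.
have := dotv_cs y v; move: `|dotv y v| => d dle.
have h : `|enorm x `^ (r - 2) - enorm y `^ (r - 2)| * d <=
   `|enorm x `^ (r - 2) - enorm y `^ (r - 2)| * enorm y * enorm v.
  by rewrite -mulrA ler_wpM2l.
apply: (le_trans h); case: ifP => [r3|/negbT]; last first.
  rewrite -leNgt => r3; have [/(_ (or_introl r3)) hp _ _] := hCr x y.
  have := ler_wpM2r (mulr_ge0 (enorm_ge0 y) (enorm_ge0 v)) hp; rewrite mulrA.
  by move=> h'; apply: (le_trans h'); rewrite le_eqVlt; apply/orP; left; apply/eqP; ring.
have s01 : 0 <= r - 2 <= 1 by apply/andP; split; move: r2 r3; lra.
have h1 := powR_diff_small s01 (enorm_ge0 x) (enorm_ge0 y).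
have h2 : enorm y `^ (r - 2) * `|enorm x - enorm y| <= enorm y `^ (r - 2) * enorm (x - y).
  by rewrite ler_wpM2l ?powR_ge0// enorm_dist.
have h3 := ler_wpM2r (enorm_ge0 v) (le_trans h1 h2).
apply: (le_trans h3); rewrite -[leLHS]mulrA -[leLHS]mul1r.
apply: ler_wpM2r; first by rewrite !mulr_ge0 ?powR_ge0 ?enorm_ge0.
by move: C1; lra.
Qed.

(** The common bound A for w and y makes the two Hoelder terms of the case r >= 3 equal, whence the
    factor 2 in the smallness condition. *)
Lemma ch_diff w y v A G X : V w -> V y -> V v -> N w <= A -> N y <= A ->
  N (wfun_sub w y) <= G -> N v <= X -> 0 < A -> 0 < G -> 0 < X ->
  `|ch alpha r w y v - ch alpha r y y v| <=
  alpha * (2 * Cr * (C `^ r * (A `^ (r - 2) * G * X))).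
Proof.
move=> Vw Vy Vv wA yA gG vX A0 G0 X0; have Vg := Vh_sub Vw Vy.
have rw := Vh_vpoly Vw; have ry := Vh_vpoly Vy; have rv := Vh_vpoly Vv.
have Cr0 : 0 <= Cr by apply: le_trans (power_constant_ge1 hCr); exact: ler01.
have rs : 0 <= r - 2 by rewrite subr_ge0.
pose g : mfun := fun K x =>
  (enorm (w.1 K x) `^ (r - 2) - enorm (y.1 K x) `^ (r - 2)) * dotv (y.1 K x) (v.1 K x).
have a1 := fun K KM => ch_integrand_adm nM r2 KM rw ry rv (K := K).
have a2 := fun K KM => ch_integrand_adm nM r2 KM ry ry rv (K := K).
have ag : mesh_adm g.
  move=> K KM; have HK := cell_integration (nM KM).
  apply: (adm_ext HK _ (admB HK (a1 K KM) (a2 K KM))) => x _.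
  by rewrite -mulrBl.
have -> : ch alpha r w y v - ch alpha r y y v = alpha * mesh_int g.
  rewrite /ch -mulrBr; congr (_ * _); apply/esym.
  rewrite /mesh_int -sumrB; apply: eq_bigr => K KM; have HK := cell_integration (nM KM).
  rewrite -(intB HK (a1 K KM) (a2 K KM)); congr int_cell; apply/funext => x.
  by rewrite -mulrBl.
rewrite normrM (gtr0_norm a0) ler_pM2l//.
have eadm u : V u -> mesh_adm (fun K x => enorm (u.1 K x)) by exact: enorm_mesh_adm.
have padm u s : 0 <= s -> V u -> mesh_adm (fun K x => enorm (u.1 K x) `^ s).
  by move=> s0 Vu; apply: mesh_adm_powR => //; [exact: eadm|move=> *; exact: enorm_ge0].
have [r3|r3] := ltP r 3.
  pose h : mfun := fun K x => enorm (y.1 K x) `^ (r - 2) *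
    (enorm ((wfun_sub w y).1 K x) * enorm (v.1 K x)).
  have ah : mesh_adm h.
    by move=> K KM; apply: bmeasM; [exact: padm|apply: bmeasM; exact: eadm].
  apply: (@le_trans _ _ (mesh_int (fun K x => 2 * Cr * h K x))).
    apply: mesh_int_norm => //; first by move=> K KM; apply: bmeasZ; exact: ah.
    move=> K x KM Kx; rewrite normrM.
    by have := power_diff (w.1 K x) (y.1 K x) (v.1 K x); rewrite r3.
  have -> : mesh_int (fun K x => 2 * Cr * h K x) = 2 * Cr * mesh_int h.
    rewrite /mesh_int mulr_sumr; apply: eq_bigr => K KM.
    by rewrite (intZ (cell_integration (nM KM)))//; exact: ah.
  rewrite -scale_hoelder3// ler_wpM2l ?mulr_ge0//.
  apply: hoelder3 => //; rewrite ?mulr_gt0//; try exact: eadm;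
    try (by move=> *; exact: enorm_ge0); exact: Lr_bound.
have rs3 : 0 <= r - 3 by rewrite subr_ge0.
(* The boolean selects the base, |w| or |y|, of the power with exponent r - 3. *)
pose h (b : bool) : mfun := fun K x => enorm ((if b then w else y).1 K x) `^ (r - 3) *
    (enorm ((wfun_sub w y).1 K x) * (enorm (y.1 K x) * enorm (v.1 K x))).
have ah b : mesh_adm (h b).
  move=> K KM; apply: bmeasM; first by apply: padm => //; case: b.
  by apply: bmeasM; [exact: eadm|apply: bmeasM; exact: eadm].
apply: (@le_trans _ _ (mesh_int (fun K x => \sum_(b : bool) Cr * h b K x))).
  apply: mesh_int_norm => //.
    by move=> K KM; apply: bmeas_sum => b; apply: bmeasZ; exact: ah.
  move=> K x KM Kx; rewrite big_bool normrM.
  by have := power_diff (w.1 K x) (y.1 K x) (v.1 K x); rewrite ltNge r3.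
have -> : mesh_int (fun K x => \sum_(b : bool) Cr * h b K x) =
    Cr * (mesh_int (h true) + mesh_int (h false)).
  by rewrite (mesh_int_comb nM (fun=> Cr) ah) big_bool/= mulrDr.
rewrite -mulrA mulrCA ler_wpM2l//.
have hb b : mesh_int (h b) <= C `^ r * (A `^ (r - 2) * G * X).
  rewrite -scale_hoelder4//; apply: hoelder4 => //; rewrite ?mulr_gt0//; try exact: eadm;
    try (by move=> *; exact: enorm_ge0); try exact: Lr_bound.
    by case: b => //; exact: eadm.
  by case: b; exact: Lr_bound.
have := hb true; have := hb false.
move: (mesh_int _) (mesh_int _) (C `^ r * _) => s t z; lra.
Qed.

Lemma ch_ge0 w u : V w -> V u -> 0 <= ch alpha r w u u.
Proof.
move=> Vw Vu; apply: mulr_ge0; first exact: ltW.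
apply: sumr_ge0 => K KM; apply: (int_ge0 (cell_integration (nM KM))).
  by apply: ch_integrand_adm => //; [exact: Vh_vpoly Vw|exact: Vh_vpoly Vu|exact: Vh_vpoly Vu].
by move=> x _; rewrite mulr_ge0 ?powR_ge0// dotv_ge0.
Qed.

End reaction_bounds.

(** * Oseen's iteration *)

Section oseen.
Context {R : realType} {n : nat} {M : mesh R n.+1}.
Local Notation pos := (@pos R n.+1 M).
Local Notation pt := 'rV[R]_n.+1.
Local Notation vector := (wfun M pt).
Local Notation scalar := (wfun M R).
Variables (Omega : set pt) (oO : open Omega) (cO : connected Omega).
Hypothesis hM : conforming_partition M Omega.
Variables (m k : nat) (m0 : (0 < m)%N).
Variables (nu alpha r C Cr : R).
Hypotheses (nu0 : 0 < nu) (alpha0 : 0 < alpha) (r2 : 2 <= r) (C0 : 0 < C).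
Hypothesis embedding : forall v : vector, Vh Omega m k v -> Lr_norm r v <= C * normV m k v.
Hypothesis hCr : power_constant n.+1 r Cr.
Variables (f : pt -> pt) (hf : L2_vector Omega f).
Let nM : forall K, K \in elts M -> nsimplex pos K. Proof. by case: hM. Qed.
Local Notation V := (Vh Omega m k : vector -> Prop).
Local Notation V0 := (V0h Omega m k : vector -> Prop).
Local Notation Q := (Qh m : scalar -> Prop).
Local Notation N := (normV m k).
Local Notation E := (energy m k).
Local Notation F := (load_norm M Omega m k f).
Local Notation NN := (Nh M Omega m k).
Local Notation sol := (solves_linearised Omega m k nu alpha r f).

Lemma form_linear_sub (L : vector -> R) u v : form_linear vpoly vcomb L -> V u -> V v ->
  L (wfun_sub u v) = L u - L v.
Proof.
move=> lL Vu Vv; have lV : linear_on V L := form_linear_on lL.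
exact: (linear_onB lV Vu Vv).
Qed.

Lemma bh_subr v p q : V v -> Q p -> Q q -> bh m v (wfun_sub p q) = bh m v p - bh m v q.
Proof.
move=> Vv Qp Qq.
have lb : linear_on (Qh m : wfun M R^o -> Prop) (bh m v).
  by apply: (form_linear_on_Qh hM); apply: bh_lin_scalar => //; exact: Vh_vpoly Vv.
exact: (linear_onB lb Qp Qq).
Qed.

Lemma Qh_sub p q : Q p -> Q q -> Q (wfun_sub p q).
Proof. exact: (subspaceB (subspace_Qh hM m)). Qed.

Lemma sol_V0h w u p : sol w u p -> V0 u.
Proof. by case. Qed.

Lemma ahE (u v : vector) : ah nu m k u v = nu * E u v.
Proof. by rewrite /ah -mulrDr. Qed.

Lemma dh_diag (w v : vector) : dh m w v v = 0.
Proof. by rewrite /dh subrr. Qed.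

(** At v = u the convection vanishes by skew-symmetry, the pressure term by the constraint, and the
    reaction term is nonnegative. The bound does not depend on w. *)
Lemma sol_bound w u p : V w -> sol w u p -> N u <= F / nu.
Proof.
move=> Vw hs; have V0u := sol_V0h hs; have [Vu Qp eq _] := hs.
have := eq u Vu; rewrite ahE dh_diag (V0u.2 p Qp) !addr0 -(normV_sqr nM m k (Vh_vpoly Vu)).
have := ch_ge0 nM r2 alpha0 Vw Vu; have := load_le_norm nM r2 embedding oO hf V0u.
have := load_norm_ge0 nM r2 embedding oO hf; have := normV_ge0 m k u.
rewrite ler_pdivlMr//; move: (N u) (ch _ _ _ _ _) (load _ _ _ _) (F) nu0.
move=> x c l y nup x0 y0 ly c0 e.
have [->|xn0] := eqVneq x 0; first by rewrite mul0r.
have xp : 0 < x by rewrite lt_neqAle eq_sym xn0.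
rewrite -(ler_pM2r xp); have -> : x * nu * x = nu * x ^+ 2 by ring.
by move: e ly c0; lra.
Qed.

Lemma error_identity (a1 a2 b1 b2 c1 c1' c2 d1 d1' d2 l : R) :
  nu * a1 + b1 + c1 + d1 = l -> nu * a2 + b2 + c2 + d2 = l ->
  nu * (a1 - a2) + (b1 - b2) + (c1 - c1') + (c1' - c2) + (d1 - d1') + (d1' - d2) = 0.
Proof. lra. Qed.

Lemma error_bound (a c1 c2 d s1 s2 : R) :
  a + c1 + c2 - d = 0 -> - s1 <= c2 -> d <= s2 -> 0 <= c1 -> a <= s1 + s2.
Proof. lra. Qed.

Lemma residual_bound (a b c2 c3 d4 d5 t1 t2 t3 t4 : R) :
  a + b + c2 + c3 + d4 + d5 = 0 -> - t1 <= a -> - t2 <= c2 -> - t3 <= c3 ->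
  - t4 <= d4 -> - t4 <= d5 -> b <= t1 + t2 + t3 + (t4 + t4).
Proof. lra. Qed.

Lemma le_mul3 (c a b x y : R) : 0 <= c -> 0 <= a -> 0 <= b -> a <= x -> b <= y ->
  c * a * b <= c * y * x.
Proof. by move=> c0 a0 b0 ax bx; rewrite -!mulrA ler_wpM2l// mulrC ler_pM. Qed.

(** The terms c_h(w; u_h, v) and d_h(w; u_h, v) are added and subtracted, so that each nonlinear
    difference splits into a part linear in the new error and a part caused by the previous one. *)
Lemma error_equation w u p uh ph v : V w -> sol w u p -> sol uh uh ph -> V v ->
  nu * E (wfun_sub u uh) v + bh m v (wfun_sub p ph) + ch alpha r w (wfun_sub u uh) v +
  (ch alpha r w uh v - ch alpha r uh uh v) + dh m w (wfun_sub u uh) v +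
  dh m (wfun_sub w uh) uh v = 0.
Proof.
move=> Vw [Vu Qp eq _] [Vuh Qph eqh _] Vv.
have rw := Vh_vpoly Vw; have rv := Vh_vpoly Vv; have ruh := Vh_vpoly Vuh.
have e1 : E (wfun_sub u uh) v = E u v - E uh v.
  exact: (form_linear_sub (energy_lin nM m k rv)).
have e2 : ch alpha r w (wfun_sub u uh) v = ch alpha r w u v - ch alpha r w uh v.
  exact: (form_linear_sub (ch_lin_arg nM alpha r2 rw rv)).
have e3 : dh m w (wfun_sub u uh) v = dh m w u v - dh m w uh v.
  exact: (form_linear_sub (dh_lin_arg nM m rw rv)).
have e4 : dh m (wfun_sub w uh) uh v = dh m w uh v - dh m uh uh v.
  exact: (form_linear_sub (dh_lin_field nM m ruh rv)).
have := eq v Vv; have := eqh v Vv; rewrite !ahE => h1 h2.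
rewrite [X in nu * X]e1 [X in _ + X + _ + _ + _ + _]bh_subr//.
rewrite [X in _ + X + _ + _ + _]e2 [X in _ + X + _]e3 [X in _ + X]e4.
exact: error_identity h2 h1.
Qed.

(** A bounds the norms of both the previous iterate and the solution; at A = F / nu this is the
    left-hand side of the smallness condition. *)
Definition rate A := (2 * Cr * C `^ r * alpha * A `^ (r - 2) + NN * A) / nu.

(** The error e lies in V_0h, so the pressures drop out; d_h(w; e, e) = 0 and c_h(w; e, e) >= 0.
    There remain the change of the reaction coefficient and d_h(w - u_h; u_h, e), which [Nh]
    controls. *)
Lemma contraction w u p uh ph A G : V0 w -> sol w u p -> sol uh uh ph -> 0 < A -> 0 < G ->
  N w <= A -> N uh <= A -> N (wfun_sub w uh) <= G ->
  N (wfun_sub u uh) <= rate A * G.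
Proof.
move=> V0w hs hsh A0 G0 wA uhA gG.
have V0u := sol_V0h hs; have V0uh := sol_V0h hsh.
have V0e : V0 (wfun_sub u uh) := subspaceB (subspace_V0h nM Omega m k) V0u V0uh.
have V0g : V0 (wfun_sub w uh) := subspaceB (subspace_V0h nM Omega m k) V0w V0uh.
have NN0 : 0 <= NN := Nh_ge0 nM r2 embedding.
have Cr0 : 0 <= Cr by apply: le_trans (power_constant_ge1 hCr); exact: ler01.
have rate0 : 0 <= rate A.
  apply: divr_ge0; last exact: ltW.
  by apply: addr_ge0; apply: mulr_ge0; rewrite ?powR_ge0 ?(ltW A0)// !mulr_ge0 ?powR_ge0 ?(ltW alpha0).
have := error_equation V0w.1 hs hsh V0e.1.
have bz : bh m (wfun_sub u uh) (wfun_sub p ph) = 0.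
  by apply: V0e.2; apply: Qh_sub; [case: hs|case: hsh].
rewrite [bh _ _ _]bz dh_diag -(normV_sqr nM m k (Vh_vpoly V0e.1)) !addr0.
have := normV_ge0 m k (wfun_sub u uh); rewrite le_eqVlt => /orP[/eqP x0 _|x0].
  by rewrite -x0 mulr_ge0// ltW.
have h1 := ch_ge0 nM r2 alpha0 V0w.1 V0e.1.
have h2 := ch_diff nM r2 C0 embedding alpha0 hCr V0w.1 V0uh.1 V0e.1 wA uhA gG (lexx _) A0 G0 x0.
have h3 := dh_le_Nh nM r2 embedding V0g V0e V0uh.
rewrite [dh _ _ uh _]dhC.
have h4 : NN * (N (wfun_sub w uh) * N (wfun_sub u uh) * N uh) <= NN * (G * N (wfun_sub u uh) * A).
  apply: ler_wpM2l => //; apply: ler_pM => //; rewrite ?mulr_ge0 ?normV_ge0//.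
  by rewrite ler_wpM2r ?normV_ge0.
move: (le_trans h3 h4) h2 h1; rewrite ler_norml => h5 /andP[h2 _].
rewrite /rate mulrAC ler_pdivlMr//.
move: h5 h2 x0; set e := wfun_sub u uh.
move: (dh m _ e uh) (ch alpha r w uh e - _) (ch alpha r w e e) (N e) (Nh _ _ _ _).
move=> d c2 c1 x q.
move=> h5 h2 x0 h1 eq; rewrite -(ler_pM2r x0).
have : nu * x ^+ 2 <= (2 * Cr * C `^ r * alpha * A `^ (r - 2) + q * A) * G * x.
  apply: (@le_trans _ _ (alpha * (2 * Cr * (C `^ r * (A `^ (r - 2) * G * x))) + q * (G * x * A))).
    exact: error_bound eq h2 h5 h1.
  by rewrite le_eqVlt; apply/orP; left; apply/eqP; ring.
by rewrite expr2 mulrA (mulrC nu).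
Qed.

(** The error equation is solved for the pressure term. The test functions range over all of V_h,
    where [Nh] says nothing, so convection is estimated by [dh_bounded]; T bounds two successive
    velocity errors. *)
Lemma pressure_bound : exists2 D : R -> R, (forall A, 0 < A -> 0 <= D A) &
  forall w u p uh ph A T, V w -> sol w u p -> sol uh uh ph -> 0 < A -> 0 < T ->
  N w <= A -> N uh <= A -> N (wfun_sub w uh) <= T -> N (wfun_sub u uh) <= T ->
  normQ m (wfun_sub p ph) <= D A * T.
Proof.
have [B B0 stab] := pressure_stability oO cO hM k m0.
have [Bd Bd0 hd] := dh_bounded nM r2 embedding.
have Cr0 : 0 <= Cr by apply: le_trans (power_constant_ge1 hCr); exact: ler01.
pose c A := alpha * (C `^ r * A `^ (r - 2)).
have c0 A : 0 <= c A by rewrite !mulr_ge0 ?powR_ge0// ltW.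
pose D A := nu + c A + 2 * Cr * c A + 2 * Bd * A.
have D0 A : 0 < A -> 0 <= D A.
  move=> A0; apply: addr_ge0; [apply: addr_ge0; [apply: addr_ge0|]|] => //.
  - exact: ltW.
  - by apply: mulr_ge0; [exact: mulr_ge0|exact: c0].
  - by apply: mulr_ge0; [exact: mulr_ge0|exact: ltW].
exists (fun A => B * D A) => [A A0|]; first by rewrite mulr_ge0 ?D0.
move=> w u p uh ph A T Vw hs hsh A0 T0 wA uhA gT eT.
have [Vu Qp _ _] := hs; have [Vuh Qph _ _] := hsh.
have Ve := Vh_sub Vu Vuh; have Vg := Vh_sub Vw Vuh; have Qd := Qh_sub Qp Qph.
rewrite -mulrA; apply: stab => //; first by rewrite mulr_ge0 ?D0 ?ltW.
move=> v Vv.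
(* The Hoelder bounds require a positive bound for v; a test function of norm zero vanishes on the
   mesh and gives b_h = 0. *)
have := normV_ge0 m k v; rewrite le_eqVlt => /orP[/eqP v0|v0].
  have zv := normV_null nM r2 embedding Vv (esym v0).
  have b0 : bh m v (wfun_sub p ph) = 0.
    exact: (form_linear_vzero (bh_lin_vector nM m (Qh_spoly Qd)) (Vh_vpoly Vv) zv).
  by rewrite [bh _ _ _]b0 -v0 mulr0.
have := error_equation Vw hs hsh Vv.
have h1 : `|E (wfun_sub u uh) v| <= T * N v.
  apply: (le_trans (psd_cs_sqrt (subspace_Vh Omega m k) (energy_psd nM Omega m k) Ve Vv)).
  by apply: ler_wpM2r => //; exact: normV_ge0.
have h2 := ch_bound nM r2 C0 embedding alpha0 Vw Ve Vv wA eT (lexx _) A0 T0 v0.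
have h3 := ch_diff nM r2 C0 embedding alpha0 hCr Vw Vuh Vv wA uhA gT (lexx _) A0 T0 v0.
have h4 : `|dh m w (wfun_sub u uh) v| <= Bd * A * T * N v.
  apply: (le_trans (hd _ _ _ Vw Ve Vv)); apply: ler_wpM2r; first exact: normV_ge0.
  by rewrite -!mulrA; apply: ler_wpM2l => //; apply: ler_pM => //; exact: normV_ge0.
have h5 : `|dh m (wfun_sub w uh) uh v| <= Bd * A * T * N v.
  apply: (le_trans (hd _ _ _ Vg Vuh Vv)); apply: ler_wpM2r; first exact: normV_ge0.
  exact: le_mul3 Bd0 (normV_ge0 _ _ _) (normV_ge0 _ _ _) gT uhA.
have {}h2 : `|ch alpha r w (wfun_sub u uh) v| <= c A * T * N v.
  by move: h2; congr (_ <= _); rewrite /c; ring.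
have {}h3 : `|ch alpha r w uh v - ch alpha r uh uh v| <= 2 * Cr * c A * T * N v.
  by move: h3; congr (_ <= _); rewrite /c; ring.
move=> eq; move: h1 h2 h3 h4 h5.
have -> : D A * T * N v = nu * (T * N v) + c A * T * N v + 2 * Cr * c A * T * N v +
  (Bd * A * T * N v + Bd * A * T * N v) by rewrite /D; ring.
rewrite !ler_norml => /andP[h1 _] /andP[h2 _] /andP[h3 _] /andP[h4 _] /andP[h5 _].
apply: (residual_bound eq) => //.
by rewrite -mulrN ler_pM2l.
Qed.

End oseen.

Section vanishing_sequences.
Context {R : realType}.
Implicit Types (x y : nat -> R).

Lemma squeeze0 x y : (forall l, 0 <= x l) -> (forall l, x l <= y l) ->
  y l @[l --> \oo] --> (0 : R) -> x l @[l --> \oo] --> (0 : R).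
Proof.
move=> x0 xy y0; apply: (@squeeze_cvgr _ _ _ _ (cst 0) y x) => //; last exact: cvg_cst.
by apply: nearW => l; rewrite x0 xy.
Qed.

Lemma geometric_decay x t : 0 <= t < 1 -> (forall l, 0 <= x l) ->
  (forall l, x l.+1 <= t * x l) -> x l @[l --> \oo] --> (0 : R).
Proof.
move=> /andP[t0 t1] x0 xt; apply: (@squeeze0 x (fun l => t ^+ l * x 0%N)) => //.
  elim=> [|l IH]; first by rewrite expr0 mul1r.
  by apply: (le_trans (xt l)); rewrite exprS -mulrA ler_wpM2l.
have ct : t ^+ l @[l --> \oo] --> (0 : R) by apply: cvg_expr; rewrite ger0_norm.
have c := cvgM ct (cvg_cst (x 0%N)); rewrite mul0r in c; exact: c.
Qed.

End vanishing_sequences.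

(** * Convergence of velocity and pressure *)

Section oseen_convergence.
Context {R : realType} {n : nat} {M : mesh R n.+1}.
Local Notation pt := 'rV[R]_n.+1.
Local Notation vector := (wfun M pt).
Local Notation scalar := (wfun M R).
Variables (Omega : set pt) (oO : open Omega) (cO : connected Omega).
Hypothesis hM : conforming_partition M Omega.
Variables (m k : nat) (m0 : (0 < m)%N).
Variables (nu alpha r C Cr : R).
Hypotheses (nu0 : 0 < nu) (alpha0 : 0 < alpha) (r2 : 2 <= r) (C0 : 0 < C).
Hypothesis embedding : forall v : vector, Vh Omega m k v -> Lr_norm r v <= C * normV m k v.
Hypothesis hCr : power_constant n.+1 r Cr.
Variables (f : pt -> pt) (hf : L2_vector Omega f).
Let nM : forall K, K \in elts M -> nsimplex (@Defs.pos R n.+1 M) K. Proof. by case: hM. Qed.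
Local Notation V := (Vh Omega m k : vector -> Prop).
Local Notation N := (normV m k).
Local Notation F := (load_norm M Omega m k f).
Local Notation NN := (Nh M Omega m k).
Local Notation sol := (solves_linearised Omega m k nu alpha r f).
Variables (uh : vector) (ph : scalar) (huh : sol uh uh ph).
Variables (u : nat -> vector) (p : nat -> scalar) (hu0 : V (u 0%N)).
Hypothesis hu : forall l, (1 <= l)%N -> sol (u l.-1) (u l) (p l).
Hypothesis hsmall : 2 * C `^ r * Cr * alpha * (F `^ (r - 2) / nu `^ (r - 1)) +
  NN * F / nu ^+ 2 < 1.

Let F0 : 0 <= F. Proof. exact: (load_norm_ge0 nM r2 embedding oO hf). Qed.

Let Vu l : V (u l).
Proof. by case: l => // l; case: (hu (ltn0Sn l)). Qed.

Let V0u l : V0h Omega m k (u l.+1).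
Proof. exact: sol_V0h (hu (ltn0Sn l)). Qed.

Let uh_bound : N uh <= F / nu.
Proof. by case: (huh) => Vuh _ _ _; exact: (sol_bound oO hM nu0 alpha0 r2 embedding hf Vuh huh). Qed.

Let u_bound l : N (u l.+1) <= F / nu.
Proof. exact: (sol_bound oO hM nu0 alpha0 r2 embedding hf (Vu l) (hu (ltn0Sn l))). Qed.

Let err l := N (wfun_sub (u l) uh).

Lemma rate_lt1 : 0 < F -> rate (M := M) Omega m k nu alpha r C Cr (F / nu) < 1.
Proof.
move=> Fp; apply: le_lt_trans hsmall; rewrite le_eqVlt; apply/orP; left; apply/eqP.
rewrite /rate; have -> : (F / nu) `^ (r - 2) = F `^ (r - 2) / nu `^ (r - 2).
  by rewrite powRM ?invr_ge0 ?(ltW nu0)// -powR_inv1 ?(ltW nu0)// -powRrM mulN1r powRN.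
have -> : nu `^ (r - 1) = nu `^ (r - 2) * nu.
  have -> : r - 1 = (r - 2) + 1 by ring.
  by rewrite powRD ?powRr1 ?(ltW nu0)// (gt_eqF nu0) implybT.
move: (Nh _ _ _ _) (load_norm _ _ _ _ _) (F `^ (r - 2)) => q g y.
by field; rewrite !gt_eqF// powR_gt0.
Qed.

(** For zero load the bound F / nu is not positive and [contraction] does not apply; but then the
    solution and all iterates after the first step have norm zero. *)
Lemma zero_load_error l : F = 0 -> err l.+1 = 0.
Proof.
move=> Fz; have [Vuh _ _ _] := huh.
have sV := subspace_Vh Omega m k : subspace V.
have pE := energy_psd nM Omega m k.
have Ve : V (wfun_sub (u l.+1) uh) := Vh_sub (Vu _) Vuh.
have z v : V v -> N v <= F / nu -> energy m k v (wfun_sub (u l.+1) uh) = 0.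
  move=> Vv; rewrite Fz mul0r => vz; apply: (psd_null sV pE Vv Ve).
  rewrite -(normV_sqr nM m k (Vh_vpoly Vv)).
  by have -> : N v = 0; [apply/eqP; rewrite eq_le vz normV_ge0|rewrite expr0n].
have e : energy m k (wfun_sub (u l.+1) uh) (wfun_sub (u l.+1) uh) = 0.
  have h := form_linear_sub (energy_lin nM m k (Vh_vpoly Ve)) (Vu l.+1) Vuh.
  apply: (etrans h); have h1 := z _ (Vu l.+1) (u_bound l); have h2 := z _ Vuh uh_bound.
  by rewrite [X in X - _]h1 [X in _ - X]h2 subrr.
by rewrite /err /normV [X in Num.sqrt X]e sqrtr0.
Qed.

(** The initial guess need be neither discretely divergence free nor bounded by F / nu, so the
    contraction starts with the first computed iterate. *)
Lemma error_contraction : exists2 t, 0 <= t < 1 & forall l, err l.+2 <= t * err l.+1.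
Proof.
have [Fz|Fn] := eqVneq F 0.
  by exists 0 => [|l]; [rewrite lexx ltr01|rewrite mul0r zero_load_error].
have Fp : 0 < F by rewrite lt_neqAle eq_sym Fn F0.
set t := rate (M := M) Omega m k nu alpha r C Cr (F / nu).
have t1 : t < 1 := rate_lt1 Fp.
have A0 : 0 < F / nu by rewrite divr_gt0.
have step l G : 0 < G -> err l.+1 <= G -> err l.+2 <= t * G.
  move=> G0 hG.
  exact: (contraction hM nu0 alpha0 r2 C0 embedding hCr (V0u l) (hu (ltn0Sn l.+1)) huh
    A0 G0 (u_bound l) uh_bound hG).
have t0 : 0 <= t.
  have G0 : 0 < err 1%N + 1 by rewrite ltr_wpDl// normV_ge0.
  have le1 : err 1%N <= err 1%N + 1 by rewrite lerDl ler01.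
  have := le_trans (normV_ge0 _ _ _) (step 0%N _ G0 le1).
  by rewrite pmulr_lge0.
exists t; first by rewrite t0.
(* [step] needs a positive bound G. If the previous error is zero and the next were positive, G
   equal to the next error would give a contradiction with t < 1. *)
move=> l; have := normV_ge0 m k (wfun_sub (u l.+1) uh); rewrite -/(err l.+1) le_eqVlt.
move=> /orP[/eqP e0|e0]; last exact: step.
rewrite -e0 mulr0 leNgt; apply/negP => x0.
have := step l _ x0; rewrite -e0 => /(_ (ltW x0)).
by rewrite leNgt -[X in _ < X]mul1r ltr_pM2r// t1.
Qed.

Lemma velocity_convergence : err l @[l --> \oo] --> (0 : R).
Proof.
have [t t01 ht] := error_contraction.
by rewrite -cvg_shiftS; apply: (geometric_decay t01) => // l; exact: normV_ge0.
Qed.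

Lemma pressure_convergence : normQ m (wfun_sub (p l) ph) @[l --> \oo] --> (0 : R).
Proof.
have [D D0 hD] := pressure_bound oO cO hM m0 nu0 alpha0 r2 C0 embedding hCr f.
(* The added 1 keeps A positive when the load is zero; the pressure bound needs no smallness of
   A. *)
pose A := F / nu + 1.
have A0 : 0 < A by rewrite ltr_wpDl// divr_ge0 ?F0 ?(ltW nu0).
(* The harmonic term makes T positive, as [pressure_bound] requires, without changing its limit. *)
pose T l := err l.+1 + err l.+2 + harmonic l.
have h0 l : 0 < harmonic l :> R by rewrite /= invr_gt0 ltr0n.
have T0 l : 0 < T l by rewrite ltr_wpDl// addr_ge0// normV_ge0.
rewrite -(cvg_shiftn 2); apply: (@squeeze0 _ _ (fun l => D A * T l)).
- by move=> l; exact: sqrtr_ge0.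
- move=> l; rewrite addn2.
  have le1 x : x <= F / nu -> x <= A by move=> h; rewrite (le_trans h)// lerDl.
  apply: (hD (u l.+1) (u l.+2) _ uh) => //.
  + exact: (hu (ltn0Sn l.+1)).
  + by apply: le1; exact: u_bound.
  + by apply: le1; exact: uh_bound.
  + by rewrite /T -addrA lerDl addr_ge0 ?(ltW (h0 l))// normV_ge0.
  + by rewrite /T addrAC lerDr addr_ge0 ?(ltW (h0 l))// normV_ge0.
have e1 : err l.+1 @[l --> \oo] --> (0 : R) by rewrite cvg_shiftS; exact: velocity_convergence.
have e2 : err l.+2 @[l --> \oo] --> (0 : R).
  by rewrite (cvg_shiftS (fun l => err l.+1)).
have eT : T l @[l --> \oo] --> (0 : R).
  have c := cvgD (cvgD e1 e2) (@cvg_harmonic R); rewrite !addr0 in c; exact: c.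
have c := cvgM (cvg_cst (D A)) eT; rewrite mulr0 in c; exact: c.
Qed.

End oseen_convergence.

Unset Implicit Arguments.
Set Strict Implicit.
Set Printing Implicit Defensive.

Theorem theorem6p2 (R : realType) (n : nat) (hn : n = 2%N \/ n = 3%N)
  (Omega : set 'rV[R]_n) (hOmega : lipschitz_polyhedral_domain Omega)
  (nu alpha r : R) (hnu : 0 < nu) (halpha : 0 < alpha)
  (hr : 2 <= r) (hr3 : n = 3%N -> r <= 6)
  (f : 'rV[R]_n -> 'rV[R]_n) (hf : L2_vector Omega f)
  (m k : nat) (hm : (1 <= m)%N) (hk : k = m.-1 \/ k = m)
  (H : Type) (Th : H -> mesh R n) (sigma : R)
  (hTh : forall h, conforming_partition (Th h) Omega)
  (hsigma : forall h, shape_regular (Th h) sigma)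
  (Crt : R) (hCrt0 : 0 < Crt)
  (hCrt : forall h (v : wfun (Th h) 'rV[R]_n), Vh Omega m k v ->
     Lr_norm r v <= Crt * normV m k v)
  (Cr : R) (hCr0 : 0 < Cr) (hCr : power_constant n r Cr)
  (h : H)
  (uh : wfun (Th h) 'rV[R]_n) (ph : wfun (Th h) R)
  (huh : solves_linearised Omega m k nu alpha r f uh uh ph)
  (u : nat -> wfun (Th h) 'rV[R]_n) (p : nat -> wfun (Th h) R)
  (hu0 : Vh Omega m k (u 0%N))
  (hu : forall l, (1 <= l)%N ->
     solves_linearised Omega m k nu alpha r f (u l.-1) (u l) (p l))
  (hsmall :
     2 * Crt `^ r * Cr * alpha *
       (load_norm (Th h) Omega m k f `^ (r - 2) / nu `^ (r - 1)) +
     Nh (Th h) Omega m k * load_norm (Th h) Omega m k f / nu ^+ 2 < 1) :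
  normV m k (wfun_sub (u l) uh) @[l --> \oo] --> (0 : R) /\
  normQ m (wfun_sub (p l) ph) @[l --> \oo] --> (0 : R).
Proof.
have [[_ oO cO _] _] := hOmega.
(* The preceding results are stated in dimension [n.+1], where faces are parametrised by a simplex
   of dimension n. *)
case: n hn => [[]//|n] _ in Omega hOmega oO cO f hf Th hTh hsigma hCrt hCr hr3 uh ph huh u p hu0 hu hsmall *.
split.
  exact: (velocity_convergence oO (hTh h) hnu halpha hr hCrt0 (hCrt h) hCr hf huh hu0 hu hsmall).
exact: (pressure_convergence oO cO (hTh h) hm hnu halpha hr hCrt0 (hCrt h) hCr hf huh hu0 hu hsmall).
Qed.
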